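(* Let $X$ be the Cantor space, let $\Gamma \le \mathrm{Homeo}(X)$ be a minimal ample group over $X$, let $K \subseteq X$ be a $\Gamma$-malleable subset, and let $\Sigma$ be an ample group over $K$ which contains $\Gamma_K$. Then the equivalence relation $R_\Gamma(K,\Sigma)$ is orbit equivalent to $R_\Gamma$.
   Context: Conventions. For a compact metrizable $0$-dimensional space $Z$, $\mathrm{Homeo}(Z)$ is its homeomorphism group. A subgroup $G\le \mathrm{Homeo}(Z)$ is a full group if every $g\in\mathrm{Homeo}(Z)$ for which there are a finite clopen partition $Z=\bigsqcup_{i=1}^n U_i$ and $g_1,\dots,g_n\in G$ with $g(x)=g_i(x)$ for all $x\in U_i$ belongs to $G$. An ample group over $Z$ is a countable, locally finite full group $G\le\mathrm{Homeo}(Z)$ such that for every $g\in G$ the set $\{x\in Z: g(x)=x\}$ is clopen in $Z$. A group over $X$ is minimal if all of its orbits on $X$ are dense. For a countable group $G\le \mathrm{Homeo}(X)$, $R_G$ is the equivalence relation on $X$ whose classes are the $G$-orbits, and $M(G)$ is the set of $G$-invariant Borel probability measures on $X$. Two equivalence relations $R,S$ on $X$ are orbit equivalent if there is a homeomorphism $h\colon X\to X$ with $(h\times h)R=S$. A closed set $K\subseteq X$ is $\Gamma$-thin if $\mu(K)=0$ for all $\mu\in M(\Gamma)$; it is $\Gamma$-étale if for every $\gamma\in\Gamma$ and every clopen subset $A$ of $K$ the set $\gamma A\cap K$ is clopen in $K$; it is $\Gamma$-malleable if it is closed, $\Gamma$-thin and $\Gamma$-étale. An involution is an element $\gamma$ with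 $\gamma^2=\mathrm{id}$. If $K$ is $\Gamma$-étale and $\gamma\in\Gamma$ is an involution, $\gamma_K\colon K\to K$ is the homeomorphism given by $\gamma_K(x)=\gamma(x)$ if $\gamma(x)\in K$ and $\gamma_K(x)=x$ otherwise. $\Gamma_K$ is the smallest full subgroup of $\mathrm{Homeo}(K)$ containing $\gamma_K$ for every involution $\gamma\in\Gamma$. For a closed $K\subseteq X$ and a subgroup $\Delta\le\mathrm{Homeo}(K)$, $R_\Gamma(K,\Delta)$ is the finest (smallest) equivalence relation $S$ on $X$ which is coarser than (i.e. contains) $R_\Gamma$ and satisfies $(x,\delta x)\in S$ for all $x\in K$ and all $\delta\in\Delta$. *)

(* Defs.v *)
From HB Require Import structures.
From Stdlib Require Import RelationClasses.
From mathcomp Require Import all_boot all_order all_algebra.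
From mathcomp Require Import all_classical all_reals all_analysis.

Set Implicit Arguments.
Unset Strict Implicit.
Unset Printing Implicit Defensive.

Local Open Scope classical_set_scope.

(* Groups of homeomorphisms are represented by the set of their elements. In
   the definitions about groups over Z, the space Z is meant to be compact,
   metrizable and zero-dimensional; this holds automatically for cantor_space
   and for its closed subsets. A subset K of a space is itself used as a
   space, through set_type K and its subspace topology. *)

Section Groups.
Variable Z : topologicalType.

Definition homeo : set (Z -> Z) :=
  [set f | continuous f /\
     exists g : Z -> Z, [/\ continuous g, cancel f g & cancel g f]].

Definition homeo_subgroup (G : set (Z -> Z)) : Prop :=
  [/\ G `<=` homeo,
      G id,
      forall f g, G f -> G g -> G (f \o g) &
      forall f g, G f -> cancel f g -> cancel g f -> G g].

Definition full_group (G : set (Z -> Z)) : Prop :=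
  homeo_subgroup G /\
  forall (g : Z -> Z) (n : nat) (U : 'I_n -> set Z) (gs : 'I_n -> Z -> Z),
    homeo g ->
    (forall i, clopen (U i)) ->
    \bigcup_i U i = [set: Z] ->
    trivIset [set: 'I_n] U ->
    (forall i, G (gs i)) ->
    (forall i x, U i x -> g x = gs i x) ->
    G g.

(* smallest homeo_subgroup F is the group generated by F *)
Definition locally_finite_group (G : set (Z -> Z)) : Prop :=
  forall F : set (Z -> Z), F `<=` G -> finite_set F ->
    finite_set (smallest homeo_subgroup F).

Definition ample_group (G : set (Z -> Z)) : Prop :=
  [/\ full_group G,
      countable G,
      locally_finite_group G &
      forall g, G g -> clopen [set x | g x = x]].

Definition orbit (G : set (Z -> Z)) (x : Z) : set Z := [set g x | g in G].

Definition minimal_group (G : set (Z -> Z)) : Prop :=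
  forall x, dense (orbit G x).

Definition orbit_relation (G : set (Z -> Z)) : set (Z * Z) :=
  [set p | orbit G p.1 p.2].

Definition orbit_equivalent (R S : set (Z * Z)) : Prop :=
  exists2 h : Z -> Z, homeo h & [set (h p.1, h p.2) | p in R] = S.

End Groups.

Arguments homeo : clear implicits.

Definition is_equivalence (T : Type) (S : set (T * T)) : Prop :=
  Equivalence (fun x y => S (x, y)).

Section Malleable.
Variables (R : realType) (X : ptopologicalType).

Local Notation borel_probability :=
  (probability (g_sigma_algebraType (@open X)) R).

Definition invariant_probabilities (G : set (X -> X)) :
    set borel_probability :=
  [set mu : borel_probability |
     forall g, G g -> forall A, (@open X).-sigma.-measurable A ->
     mu (g @^-1` A) = mu A].

Definition thin (G : set (X -> X)) (K : set X) : Prop :=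
  forall mu, invariant_probabilities G mu -> mu K = 0%E.

Definition etale (G : set (X -> X)) (K : set X) : Prop :=
  forall g, G g -> forall A : set K, clopen A ->
    clopen [set y : K | (g @` (set_val @` A)) (set_val y)].

Definition malleable (G : set (X -> X)) (K : set X) : Prop :=
  [/\ closed K, thin G K & etale G K].

End Malleable.

Section Induced.
Variables (X : topologicalType) (G : set (X -> X)) (K : set X).

(* insubd x y is y, seen as a point of K, if y lies in K, and x otherwise *)
Definition induced_map (g : X -> X) : K -> K :=
  fun x => insubd x (g (set_val x)).

Definition induced_group : set (K -> K) :=
  smallest (@full_group K)
    [set induced_map g | g in [set g | G g /\ g \o g = id]].

Definition extended_relation (D : set (K -> K)) : set (X * X) :=
  smallest (@is_equivalence X)
    (orbit_relation G `|`
     [set (set_val x, set_val (d x)) | x in [set: K] & d in D]).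

End Induced.

(* Main.v *)
Require Import Defs.
From HB Require Import structures.
From Stdlib Require Import RelationClasses.
From mathcomp Require Import all_boot all_order all_algebra.
From mathcomp Require Import all_classical all_reals all_analysis.

(* Write Gamma as an increasing union of finite groups acting freely on the atoms of finer
   and finer clopen partitions, so that R_Gamma is an increasing union of finite relations
   E n, and let P0, P1 be the analogous sequences of Gamma_K and Sigma on K.  Minimality
   leaves room to embed countably many copies of K in X, with one more copy as their limit,
   away from the Gamma-orbit of K and in such a way that R_Gamma restricts to P1 on every
   copy.  R_Gamma is then broken along these copies: it contains a chain D which restricts
   to P0 on every copy, coincides with E near K, and generates R_Gamma together with the
   P1-links of the copies.  By a back-and-forth argument (after Krieger) some homeomorphism
   of X preserves D and shifts K to the first copy, each copy to the next one, and the
   limit copy to itself.  It carries R_Gamma(K, Sigma), which is D together with the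
   P1-links of K and of all the copies, onto D together with the P1-links of the copies,
   that is R_Gamma.  Thinness of K enters through its combinatorial form: for large n a
   class of E n has at most as many points in K as in any given clopen atom. *)

Set Implicit Arguments.
Unset Strict Implicit.
Unset Printing Implicit Defensive.

Local Open Scope classical_set_scope.

(** * Chains of finite equivalence relations *)

(** The mismatch to overcome is that [E] restricts to [P0] on [K] while the enlarged relation has to
    restrict to [P1] there. A partial conjugacy can only be extended between closed sets on which
    the relation looks the same; hence [E] is broken down to [P0] on the copies, so that inside [D]
    the set [K] together with the copies looks like the copies alone. The limit copy is there
    because the domain of the extension has to be compact, and the shift extends to it by a fixed
    index. That [E] restricts to [P0] on [K], although Gamma_K is defined by involutions only, holds
    because a link between different atoms can be performed by an involution glued together in the
    full group. Thinness becomes a counting statement because the extension must send the points of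
    [K] in a class to prescribed atoms within the same class, so these atoms must have enough points
    in it. The combinatorial part sees the topology only through natural number labels; topology
    returns in the passage from groups to chains and in the measure argument. *)

Definition ev (P : nat -> Prop) := exists N, forall n, N <= n -> P n.

Lemma evI P Q : ev P -> ev Q -> ev (fun n => P n /\ Q n).
Proof.
move=> [N HN] [M HM]; exists (maxn N M) => n.
by rewrite geq_max => /andP[? ?]; split; [exact: HN | exact: HM].
Qed.

Lemma ev_ge k : ev (fun n => k <= n). Proof. by exists k. Qed.

Lemma ev_ex P k : ev P -> exists2 n, k <= n & P n.
Proof.
by move=> [N HN]; exists (maxn N k); [rewrite leq_maxr | apply/HN/leq_maxl].
Qed.

Lemma ev_bounded (P : nat -> nat -> Prop) N :
  (forall v, v < N -> ev (P v)) -> ev (fun n => forall v, v < N -> P v n).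
Proof.
elim: N => [_|N IH HP]; first by exists 0 => n _ v.
have [M1 H1] := IH (fun v hv => HP v (leqW hv)).
have [M2 H2] := HP N (leqnn _).
exists (maxn M1 M2) => n; rewrite geq_max => /andP[n1 n2] v.
rewrite ltnS leq_eqVlt => /orP[/eqP ->|]; [exact: H2 | exact: H1].
Qed.

Lemma enum_labelled (T : choiceType) (Q : T -> Prop) (lab : T -> nat) N :
  (forall x, Q x -> lab x < N) ->
  (forall x y, Q x -> Q y -> lab x = lab y -> x = y) ->
  exists2 s : seq T, uniq s & forall x, x \in s <-> Q x.
Proof.
elim: N Q => [|N IH] Q HN inj.
  by exists [::] => // x; split => // /HN.
have [|x y [Qx _] [Qy _]|s us Hs] := IH (fun x => Q x /\ lab x != N).
- by move=> x [/HN]; rewrite ltnS leq_eqVlt => /orP[->|].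
- exact: inj.
have [[x [Qx lx]]|nex] := pselect (exists x, Q x /\ lab x = N).
  exists (x :: s) => [|y].
    rewrite /= us andbT; apply/negP => /Hs[_]; by rewrite lx eqxx.
  rewrite in_cons; split.
    by case/orP => [/eqP -> //|/Hs[]].
  move=> Qy; case: (eqVneq (lab y) N) => ly; last by rewrite (_ : y \in s) ?orbT//; apply/Hs.
  by rewrite (inj _ _ Qy Qx) ?eqxx// lx.
exists s => // y; split => [/Hs[]//|Qy]; apply/Hs; split => //.
by apply/eqP => ly; apply: nex; exists y.
Qed.

(* The atoms of the [n]-th clopen partition are the fibres of [c n].  By [ch_inj] a class of
   [E n] meets an atom at most once; by [ch_lift] it is the orbit of a finite group which
   permutes the atoms of every partition of index at least [n]. *)
Record chain (T : Type) (c : nat -> T -> nat) (E : nat -> T -> T -> Prop) :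
  Prop := Chain {
  ch_refineS : forall n x y, c n.+1 x = c n.+1 y -> c n x = c n y;
  ch_refl : forall n x, E n x x;
  ch_sym : forall n x y, E n x y -> E n y x;
  ch_trans : forall n x y z, E n x y -> E n y z -> E n x z;
  ch_monoS : forall n x y, E n x y -> E n.+1 x y;
  ch_inj : forall n x y, E n x y -> c n x = c n y -> x = y;
  ch_lift : forall n m x y x', n <= m -> E n x y -> c m x = c m x' ->
    exists2 y', c m y' = c m y & E n x' y' }.

(* Compactness of the space with clopen basis given by the atoms, in terms of labels. *)
Record separated (T : Type) (c : nat -> T -> nat) : Prop := Separated {
  sp_fin : forall n, exists N, forall x, c n x < N;
  sp_sep : forall x y, (forall n, c n x = c n y) -> x = y;
  sp_lim : forall u : nat -> T, (forall n, c n (u n.+1) = c n (u n)) ->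
    exists x, forall n, c n x = c n (u n) }.

Section ChainTheory.
Context {T : Type} {c : nat -> T -> nat} {E : nat -> T -> T -> Prop}.
Hypothesis cE : chain c E.

Lemma ch_refine n m x y : n <= m -> c m x = c m y -> c n x = c n y.
Proof.
move=> /subnK <-; elim: (m - n) => // k IH.
by rewrite addSn => /(ch_refineS cE)/IH.
Qed.

Lemma ch_mono n m x y : n <= m -> E n x y -> E m x y.
Proof.
move=> /subnK <- H; elim: (m - n) => // k IH.
by rewrite addSn; apply: (ch_monoS cE).
Qed.

(** The lifted link ends in the atom of [y'], and [ch_inj] at level [m] leaves [y'] as the only
    candidate. So for [E m]-linked pairs an [E n]-link is a matter of [m]-atoms. *)
Lemma ch_lift_eq n m x y x' y' : n <= m -> E n x y -> c m x = c m x' ->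
  E m x' y' -> c m y = c m y' -> E n x' y'.
Proof.
move=> nm exy cx exy' cy.
have [z cz ez] := ch_lift cE nm exy cx.
rewrite (ch_inj cE (n := m) (x := y') (y := z)) ?cz//.
exact: (ch_trans cE) (ch_sym cE exy') (ch_mono nm ez).
Qed.

End ChainTheory.

(* [f] is a homeomorphism onto a closed subset which is étale for the union of the [E n],
   and transports the union of the [P n] to the restriction of that relation. *)
Record embedding (L T : Type) (l : nat -> L -> nat) (P : nat -> L -> L -> Prop)
  (c : nat -> T -> nat) (E : nat -> T -> T -> Prop) (f : L -> T) : Prop := Embedding {
  em_inj : injective f;
  em_cont : forall n, ev (fun m => forall u v, l m u = l m v -> c n (f u) = c n (f v));
  em_open : forall n, ev (fun m => forall u v, c m (f u) = c m (f v) -> l n u = l n v);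
  em_rel : forall n, ev (fun m => forall u v, P n u v -> E m (f u) (f v));
  em_refl : forall n, ev (fun m => forall u v, E n (f u) (f v) -> P m u v);
  em_etale : forall n, ev (fun m => forall u v y,
    E n (f u) y -> c m y = c m (f v) -> exists v', y = f v') }.

(** The pulled-back relation lies in a single [P N0], where links lift along atoms; [em_rel] sends
    the lifted link into some [E m], and continuity of [f] lets [ch_lift_eq] bring it down to level
    [n]. *)
Lemma em_pull (L T : Type) (l : nat -> L -> nat) P (c : nat -> T -> nat) E f :
  chain l P -> chain c E -> embedding l P c E f ->
  forall n, ev (fun N => forall u v u', E n (f u) (f v) -> l N u' = l N u ->
    exists2 v', l N v' = l N v & E n (f u') (f v')).
Proof.
move=> lP cE ef n.
have [N0 _ H0] := ev_ex 0 (em_refl ef n).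
have [m nm Hm] := ev_ex n (em_rel ef N0).
have [N HN] := evI (em_cont ef m) (ev_ge N0).
exists N => k /HN[Hk N0k] u v u' euv lu.
have [v' lv puv] := ch_lift lP N0k (H0 _ _ euv) (esym lu).
exists v' => //.
by apply: (ch_lift_eq cE nm euv) (Hm _ _ puv) _; apply: Hk.
Qed.

(** The counting form of thinness. The atom is that of an arbitrary point [b], possibly far from the
    image of [f]. *)
Definition small (L : Type) (T : eqType) (c : nat -> T -> nat) (E : nat -> T -> T -> Prop)
    (f : L -> T) :=
  forall j, ev (fun q => forall b x (s : seq T), uniq s ->
    (forall y, y \in s -> E q x y /\ exists u, y = f u) ->
    exists s' : seq T, [/\ uniq s', size s <= size s' &
      forall y, y \in s' -> E q x y /\ c j y = c j b]).

(** One level of a chain freed from its index, in the role of Krieger's unit systems. The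
    back-and-forth produces pairs of atoms and relation that are transported by a bijection and are
    not levels of the given chain. *)
Record unit_rel (T : Type) (a : T -> nat) (A : T -> T -> Prop) : Prop := UnitRel {
  ur_refl : forall x, A x x;
  ur_sym : forall x y, A x y -> A y x;
  ur_trans : forall x y z, A x y -> A y z -> A x z;
  ur_inj : forall x y, A x y -> a x = a y -> x = y;
  ur_lift : forall x y x', A x y -> a x = a x' -> exists2 y', a y' = a y & A x' y' }.

Record refines (T : Type) (a : T -> nat) (A : T -> T -> Prop) (b : T -> nat) (B : T -> T -> Prop)
  : Prop := Refines {
  rf_at : forall x y, b x = b y -> a x = a y;
  rf_rel : forall x y, A x y -> B x y;
  rf_lift : forall x y x', A x y -> b x = b x' -> exists2 y', b y' = b y & A x' y' }.

(** * Exchanging classes within one unit system *)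

Section Units.
Context {T : choiceType}.
Implicit Types (a b : T -> nat) (A B : T -> T -> Prop).

Lemma chain_unit c E n : @chain T c E -> unit_rel (c n) (E n).
Proof.
move=> cE; split; [exact: (ch_refl cE)|exact: (ch_sym cE)|exact: (ch_trans cE)|
  exact: (ch_inj cE)|by move=> x y x'; apply: (ch_lift cE)].
Qed.

Lemma refines_trans a A b B d D : unit_rel b B ->
  refines a A b B -> refines b B d D -> refines a A d D.
Proof.
move=> uB [f1 f2 f3] [g1 g2 g3]; split.
- by move=> x y /g1/f1.
- by move=> x y /f2/g2.
- move=> x y x' axy dx; have [y' dy bxy] := g3 _ _ _ (f2 _ _ axy) dx.
  have [y2 by2 ax2] := f3 _ _ _ axy (g1 _ _ dx); exists y' => //.
  suff -> : y' = y2 by [].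
  apply: (ur_inj uB); last by rewrite by2; apply: g1.
  exact: (ur_trans uB) (ur_sym uB bxy) (f2 _ _ ax2).
Qed.

Lemma chain_refines c E n m m' : @chain T c E -> n <= m -> m <= m' ->
  refines (c n) (E n) (c m') (E m).
Proof.
move=> cE nm mm'; split.
- by move=> x y; apply: (ch_refine cE); apply: leq_trans mm'.
- by move=> x y; apply: (ch_mono cE).
- by move=> x y x'; apply: (ch_lift cE); apply: leq_trans mm'.
Qed.

(** A lifted [A]-link is a [B]-link, and a [B]-class meets each atom at most once, so the lift of
    [y] is [y1]. Thus inside [B] the relation [A] is a relation between [b]-atoms. *)
Lemma rf_inv a A b B x y x1 y1 : refines a A b B -> unit_rel b B ->
  B x y -> B x1 y1 -> b x = b x1 -> b y = b y1 -> A x y <-> A x1 y1.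
Proof.
have main : forall x y x1 y1, refines a A b B -> unit_rel b B ->
  B x y -> B x1 y1 -> b x = b x1 -> b y = b y1 -> A x y -> A x1 y1.
  move=> {}x {}y {}x1 {}y1 [f1 f2 f3] uB bxy bxy1 ex ey axy.
  have [z bz az] := f3 _ _ _ axy ex.
  rewrite (ur_inj uB (x := y1) (y := z)) ?bz//.
  exact: (ur_trans uB) (ur_sym uB bxy1) (f2 _ _ az).
move=> f uB bxy bxy1 ex ey; split; first exact: main.
by apply: main => //.
Qed.

Definition transport b B w x := xget w [set y | B w y /\ b y = b x].

Lemma transportP b B w x y : unit_rel b B -> B x y -> b y = b w ->
  B w (transport b B w x) /\ b (transport b B w x) = b x.
Proof.
move=> uB bxy ey; rewrite /transport; case: xgetP => [z _ //|/=].
have [z bz Bz] := ur_lift uB (ur_sym uB bxy) ey.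
by move=> /(_ z) [].
Qed.

Lemma transportE b B w x y : unit_rel b B -> B w y -> b y = b x ->
  transport b B w x = y.
Proof.
move=> uB bwy ey; rewrite /transport; case: xgetP => [z _ [/= bz ez]|/(_ y) []//].
apply: (ur_inj uB); last by rewrite ez.
exact: (ur_trans uB) (ur_sym uB bz) bwy.
Qed.

Lemma transport_self a A p x0 q : unit_rel a A -> a x0 = a q -> A x0 p ->
  A q (transport a A q p) /\ a (transport a A q p) = a p.
Proof.
by move=> uA e h; apply: (@transportP a A q p x0) => //; exact: (ur_sym uA).
Qed.

(** Two classes with points in a common atom meet the same atoms by [ur_lift], so they can be
    exchanged atom by atom. The last clause, that nothing else moves, protects earlier choices when
    exchanges are iterated. *)
Lemma unit_swap a A x0 y0 : unit_rel a A -> a x0 = a y0 ->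
  exists s : T -> T, [/\ involutive s, forall p, a (s p) = a p,
    forall p q, A (s p) (s q) <-> A p q, s x0 = y0 &
    forall p, s p = p /\ (A x0 y0 \/ ~ A x0 p /\ ~ A y0 p) \/
      A x0 p /\ A y0 (s p) \/ A y0 p /\ A x0 (s p)].
Proof.
move=> uA axy.
have [Axy|nA] := pselect (A x0 y0).
  exists id; split => //; first exact: (ur_inj uA).
  by move=> p; left; split => //; left.
pose s p := if pselect (A x0 p) then transport a A y0 p
            else if pselect (A y0 p) then transport a A x0 p else p.
have disj p : A x0 p -> A y0 p -> False.
  by move=> h1 h2; apply: nA; exact: (ur_trans uA) h1 (ur_sym uA h2).
have s1 p : A x0 p -> A y0 (s p) /\ a (s p) = a p.
  by move=> h; rewrite /s; case: pselect => //= ?; apply: transport_self h.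
have s2 p : A y0 p -> A x0 (s p) /\ a (s p) = a p.
  move=> h; rewrite /s; case: pselect => [/disj/(_ h)//|?] /=.
  by case: pselect => //= ?; apply: transport_self h.
have s3 p : ~ A x0 p -> ~ A y0 p -> s p = p.
  by move=> h1 h2; rewrite /s; case: pselect => //= ?; case: pselect.
have sa p : a (s p) = a p.
  have [h|h] := pselect (A x0 p); first by case: (s1 _ h).
  have [h'|h'] := pselect (A y0 p); first by case: (s2 _ h').
  by rewrite s3.
have ss : involutive s.
  move=> p.
  have [h|h] := pselect (A x0 p).
    have [h1 h2] := s1 _ h; have [h3 h4] := s2 _ h1.
    apply: (ur_inj uA); last by rewrite h4.
    exact: (ur_trans uA) (ur_sym uA h3) h.
  have [h'|h'] := pselect (A y0 p).
    have [h1 h2] := s2 _ h'; have [h3 h4] := s1 _ h1.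
    apply: (ur_inj uA); last by rewrite h4.
    exact: (ur_trans uA) (ur_sym uA h3) h'.
  by rewrite !s3.
have sA p q : A p q -> A (s p) (s q).
  move=> Apq.
  have [h|h] := pselect (A x0 p).
    have [h1 _] := s1 _ h; have [h2 _] := s1 _ (ur_trans uA h Apq).
    exact: (ur_trans uA) (ur_sym uA h1) h2.
  have [h'|h'] := pselect (A y0 p).
    have [h1 _] := s2 _ h'; have [h2 _] := s2 _ (ur_trans uA h' Apq).
    exact: (ur_trans uA) (ur_sym uA h1) h2.
  rewrite !s3// => hq; [apply: h|apply: h']; exact: (ur_trans uA) hq (ur_sym uA Apq).
exists s; split => //.
- by move=> p q; split => [/sA|/sA //]; rewrite !ss.
- have [h1 h2] := s1 _ (ur_refl uA x0).
  by apply: (ur_inj uA); [exact: (ur_sym uA)|rewrite h2].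
- move=> p; have [h|h] := pselect (A x0 p); first by right; left; split=> //; case: (s1 _ h).
  have [h'|h'] := pselect (A y0 p); first by right; right; split=> //; case: (s2 _ h').
  by left; split; [rewrite s3|right].
Qed.

(* The [A]-class of every prescribed point is moved onto its target by successive
   class exchanges; consistency of the targets keeps earlier points in place. *)
Lemma class_permutation a A a' A' B (g d : T -> T) (I : choiceType) (us : seq I) (p z : I -> T) :
  unit_rel a A -> unit_rel a' A' ->
  (forall x y z, B x y -> B y z -> B x z) -> (forall x y, B x y -> B y x) ->
  (forall x y, A x y -> B x y) ->
  cancel g d -> cancel d g ->
  (forall x, a' (g x) = a x) -> (forall x y, A' (g x) (g y) <-> A x y) ->
  (forall x, B x (d x)) ->
  (forall i, i \in us -> B (p i) (z i)) ->
  (forall i, i \in us -> a (z i) = a' (p i)) ->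
  (forall i j, i \in us -> j \in us -> A (z i) (z j) <-> A' (p i) (p j)) ->
  exists t s : T -> T, [/\ cancel t s /\ cancel s t, forall x, a (t x) = a' x,
    forall x y, A (t x) (t y) <-> A' x y, forall x, B x (t x) &
    forall i, i \in us -> t (p i) = z i].
Proof.
move=> uA uA' Bt Bs AB gd dg ag Ag Bd.
elim: us => [|u us IH] Bz az Az.
  exists d, g; split => // [x|x y]; first by rewrite -ag dg.
  by rewrite -Ag !dg.
have [|||t [s [[ts st] ta tA tB tp]]] := IH.
- by move=> i hi; apply: Bz; rewrite in_cons hi orbT.
- by move=> i hi; apply: az; rewrite in_cons hi orbT.
- by move=> i j hi hj; apply: Az; rewrite in_cons ?hi ?hj orbT.
have uu : u \in u :: us by rewrite in_cons eqxx.
have [w [ww wa wA wu wfix]] := unit_swap (x0 := t (p u)) (y0 := z u) uA (etrans (ta _) (esym (az _ uu))).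
exists (w \o t), (s \o w); split.
- by split => x /=; rewrite ?ww ?ts// st ww.
- by move=> x /=; rewrite wa ta.
- by move=> x y /=; rewrite wA tA.
- move=> x /=; apply: (Bt _ (t x)) => //.
  have Buz : B (t (p u)) (z u) by apply: (Bt _ (p u)); [apply/Bs/tB|exact: Bz].
  case: (wfix (t x)) => [[-> _]|[[h1 h2]|[h1 h2]]].
  + by apply: (Bt _ x); [exact: Bs|].
  + by apply: (Bt _ (t (p u))); [exact/Bs/AB|apply: (Bt _ (z u)) => //; exact: AB].
  + by apply: (Bt _ (z u)); [exact/Bs/AB|apply: (Bt _ (t (p u))); [exact: Bs|exact: AB]].
- move=> i; rewrite in_cons => /orP[/eqP -> //|hi] /=.
  have hi' : i \in u :: us by rewrite in_cons hi orbT.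
  (* If the exchange touches the class of [t (p i)], consistency of the targets forces
     [t (p u) = z u]; the two classes then coincide and the exchange fixes [t (p i)]. *)
  have key : A (t (p u)) (t (p i)) \/ A (z u) (z i) -> w (t (p i)) = t (p i).
    move=> h.
    have Api : A' (p u) (p i) by case: h => [/tA|/Az]//; apply.
    have tz : t (p u) = z u.
      apply: (ur_inj uA); last by rewrite ta az.
      apply: (ur_trans uA (y := z i)).
        by rewrite -tp//; apply/tA.
      by apply: (ur_sym uA); apply/Az.
    case: (wfix (t (p i))) => [[]//|[[h1 h2]|[h1 h2]]];
      apply: (ur_inj uA); rewrite ?wa//.
      by rewrite -tz in h2; apply: (ur_trans uA) (ur_sym uA h2) h1.
    by rewrite -tz in h1; apply: (ur_trans uA) (ur_sym uA h2) h1.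
  rewrite -[RHS](tp _ hi).
  case: (wfix (t (p i))) => [[]//|[[h1 h2]|[h1 h2]]]; apply: key.
    by left.
  by right; rewrite -(tp _ hi).
Qed.

End Units.

(** Greedy choice. If [f u] is related to an already treated [f v], its target is lifted from [z v].
    Otherwise a target unrelated to the earlier ones exists by the pigeonhole principle: a class
    meets the atom of [f u] at most once, and fewer than [r] targets have been placed. *)
Lemma class_targets (T I : choiceType) (b : T -> nat) (B : T -> T -> Prop) (W : T -> Prop)
    (f : I -> T) (us : seq I) r :
  unit_rel b B -> (forall x y, W x -> B x y -> W y) -> uniq us -> size us <= r ->
  (forall i, i \in us -> exists s : seq T, [/\ uniq s, r <= size s &
    forall y, y \in s -> W y /\ b y = b (f i)]) ->
  exists z : I -> T, (forall i, i \in us -> W (z i) /\ b (z i) = b (f i)) /\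
    (forall i j, i \in us -> j \in us -> B (z i) (z j) <-> B (f i) (f j)).
Proof.
move=> uB WB; elim: us => [|u us IH] /=.
  by move=> _ _ _; exists f; split.
move=> /andP[unu uus] szr H.
have [|z [zW zB]] := IH uus (ltnW szr).
  by move=> i hi; apply: H; rewrite in_cons hi orbT.
suff [y [Wy by_ yB]] : exists y, [/\ W y, b y = b (f u) &
    forall i, i \in us -> B y (z i) <-> B (f u) (f i)].
  exists (fun i => if i == u then y else z i); split => [i|i j].
    by rewrite in_cons; case: eqP => [-> //|_ /= /zW].
  rewrite !in_cons; case: eqP => [->|_ /=]; case: eqP => [->|_ /=] //.
  - by move=> _ _; split => _; exact: (ur_refl uB).
  - by move=> _; apply: yB.
  - by move=> hi _; split=> h; apply: (ur_sym uB); apply/yB => //; exact: (ur_sym uB).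
  - exact: zB.
have [[v vus Bvu]|nv] := pselect (exists2 v, v \in us & B (f v) (f u)).
  have [Wv bv] := zW _ vus.
  have [y bfy Bzy] := ur_lift uB Bvu (esym bv).
  exists y; split => //; first exact: WB Bzy.
  move=> i hi; split => h.
    apply: (ur_trans uB) (ur_sym uB Bvu) _; apply/zB => //.
    exact: (ur_trans uB) Bzy h.
  apply: (ur_trans uB) (ur_sym uB Bzy) _; apply/zB => //.
  exact: (ur_trans uB) Bvu h.
have [s [us' szs sW]] := H u (mem_head _ _).
have [[y ys ny]|hy] := pselect (exists2 y, y \in s & forall i, i \in us -> ~ B y (z i)).
  have [Wy by_] := sW _ ys; exists y; split => // i hi; split => h.
    by case: (ny i hi).
  by case: nv; exists i => //; exact: (ur_sym uB).
have rel y : y \in s -> exists i, i \in us /\ B y (z i).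
  move=> ys; apply: contrapT => nn; apply: hy; exists y => // i hi h.
  by apply: nn; exists i.
pose phi y := xget u [set i | i \in us /\ B y (z i)].
have phiP y : y \in s -> phi y \in us /\ B y (z (phi y)).
  by move=> /rel[i hi]; rewrite /phi; case: xgetP => [j _ []//|/(_ i)].
have : size [seq phi y | y <- s] <= size us.
  apply: uniq_leq_size; last by move=> _ /mapP[y /phiP[h _] ->].
  rewrite map_inj_in_uniq// => x y xs ys e.
  have [_ h1] := phiP _ xs; have [_ h2] := phiP _ ys.
  apply: (ur_inj uB); last by rewrite (proj2 (sW _ xs)) (proj2 (sW _ ys)).
  by apply: (ur_trans uB) h1 _; rewrite e; exact: (ur_sym uB).
by rewrite size_map => h; move: (leq_trans szs h); rewrite leqNgt szr.
Qed.

(** * Towers of atoms over the classes of a finite relation *)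

Section Towers.
Context {T : choiceType} {c : nat -> T -> nat} {E : nat -> T -> T -> Prop}.
Hypothesis cE : chain c E.

(** The tower [tw x] is the union of the [k]-atoms met by the [E q]-class of [x]; it is determined
    by that class, and also by the [k]-atom of [x]. One point is picked per tower, inside [V] when
    the tower meets [V]. *)
Lemma tower_representatives q k (V : T -> Prop) : q <= k -> exists R : T -> T,
  [/\ forall x, exists2 y, E q x y & c k y = c k (R x),
      forall x y, E q x y -> R x = R y, forall x y, c k x = c k y -> R x = R y &
      forall x, V x -> V (R x)].
Proof.
move=> qk.
have [[x0 _]|nx] := pselect (exists x0 : T, True); last first.
  by exists id; split => x; case: nx; exists x.
pose tw x := [set p | exists2 y, E q x y & c k y = c k p].
have twE x y : E q x y -> tw x = tw y.
  move=> exy; apply/seteqP; split => p [z ez cz]; exists z => //.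
    exact: (ch_trans cE) (ch_sym cE exy) ez.
  exact: (ch_trans cE) exy ez.
have twc x y : c k x = c k y -> tw x = tw y.
  have sub x1 y1 : c k x1 = c k y1 -> tw x1 `<=` tw y1.
    move=> cxy p [z ez cz]; have [z' cz' ez'] := ch_lift cE qk ez cxy.
    by exists z' => //; rewrite cz'.
  by move=> cxy; apply/seteqP; split; apply: sub.
pose S x := if pselect (exists p, tw x p /\ V p) then tw x `&` V else tw x.
have Stw x : S x `<=` tw x.
  by rewrite /S; case: pselect => ? // p [].
have Sne x : S x !=set0.
  rewrite /S; case: pselect => [[p [? ?]]|?] /=; first by exists p.
  by exists x, x => //; exact: (ch_refl cE).
exists (fun x => xget x0 (S x)); split.
- move=> x; have [p Sp] := Sne x; apply: (Stw x).
  by case: xgetP => [y _ //|/(_ p)].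
- by move=> x y /twE e; rewrite /S e.
- by move=> x y /twc e; rewrite /S e.
- move=> x Vx; have xx : exists p, tw x p /\ V p.
    by exists x; split=> //; exists x => //; exact: (ch_refl cE).
  rewrite /S; case: pselect => //= ?; case: xgetP => [y _ []//|/=].
  by case: xx => p [h1 h2] /(_ p)[].
Qed.

(** One permutation per representative is copied to the whole tower: [x] is read in the class of
    [R x] through its [k]-atom, moved by [t (R x)], and read back in its own class. The result
    depends only on [k]-atoms, hence respects atoms of all levels from [k] on. *)
Lemma tower_extension q k (R : T -> T) (t s : T -> T -> T) : q <= k ->
  (forall x, exists2 y, E q x y & c k y = c k (R x)) ->
  (forall x y, E q x y -> R x = R y) -> (forall x y, c k x = c k y -> R x = R y) ->
  (forall w, cancel (t w) (s w) /\ cancel (s w) (t w)) ->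
  (forall w p, E q p (t w p)) ->
  exists t' s' : T -> T, [/\ cancel t' s', cancel s' t', forall x, E q x (t' x),
    (forall j x y, k <= j -> c j x = c j y -> c j (t' x) = c j (t' y)) /\
    (forall j x y, k <= j -> c j x = c j y -> c j (s' x) = c j (s' y)) &
    forall x, exists x', [/\ E q (R x) x', c k x' = c k x & c k (t' x) = c k (t (R x) x')]].
Proof.
move=> qk R1 R2 R3 ts tE.
have uB : unit_rel (c k) (E q).
  split; [exact: (ch_refl cE)|exact: (ch_sym cE)|exact: (ch_trans cE)| |].
    by move=> x y exy /(ch_refine cE qk); apply: (ch_inj cE).
  by move=> x y x'; apply: (ch_lift cE).
pose tr := transport (c k) (E q).
have hatP x : E q (R x) (tr (R x) x) /\ c k (tr (R x) x) = c k x.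
  by have [y exy cy] := R1 x; apply: transportP cy.
pose ex (t : T -> T -> T) x := tr x (t (R x) (tr (R x) x)).
have exP t0 : (forall w p, E q p (t0 w p)) -> forall x,
    E q x (ex t0 x) /\ c k (ex t0 x) = c k (t0 (R x) (tr (R x) x)).
  move=> h x; have [h1 h2] := hatP x.
  apply: (@transportP _ _ _ _ _ (tr (R x) x)) => //.
  exact: (ch_sym cE).
have sE w p : E q p (s w p).
  by apply: (ch_sym cE); rewrite -{2}[p](proj2 (ts w)); exact: tE.
have exK t0 s0 : (forall w p, E q p (t0 w p)) -> (forall w, cancel (t0 w) (s0 w)) ->
    cancel (ex t0) (ex s0).
  move=> tE0 ts0 x; have [h1 h2] := exP _ tE0 x; have [h3 h4] := hatP x.
  have e1 : R (ex t0 x) = R x by rewrite (R2 _ _ h1).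
  have e2 : tr (R x) (ex t0 x) = t0 (R x) (tr (R x) x).
    apply: (transportE uB) (esym h2).
    exact: (ch_trans cE) h3 (tE0 _ _).
  rewrite {1}/ex e1 e2 ts0; apply: (transportE uB) (esym h4).
  exact: (ch_sym cE).
have exc t0 j x y : (forall w p, E q p (t0 w p)) -> k <= j -> c j x = c j y ->
    c j (ex t0 x) = c j (ex t0 y).
  move=> tE0 kj cxy.
  have [z cz ez] := ch_lift cE (leq_trans qk kj) (proj1 (exP _ tE0 x)) cxy.
  rewrite -cz; congr c; apply: (ch_inj cE (n := k)).
    apply: (ch_mono cE qk); exact: (ch_trans cE) (ch_sym cE ez) (proj1 (exP _ tE0 y)).
  rewrite (ch_refine cE kj cz) !(proj2 (exP _ tE0 _)).
  have cxyk := ch_refine cE kj cxy.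
  have eR := R3 _ _ cxyk; rewrite eR; congr (c k (t0 _ _)).
  by have [h1 h2] := hatP y; apply: (transportE uB); rewrite ?cxyk.
exists (ex t), (ex s); split.
- by apply: exK => // w; case: (ts w).
- by apply: exK => // w; case: (ts w).
- by move=> x; case: (exP _ tE x).
- by split=> j x y; apply: exc.
- move=> x; exists (tr (R x) x); have [? ?] := hatP x; split => //.
  by case: (exP _ tE x).
Qed.
End Towers.

(** * Extending partial conjugacies *)

Section Extension.
Context {L T : choiceType} {l : nat -> L -> nat} {P : nat -> L -> L -> Prop}.
Context {c : nat -> T -> nat} {E : nat -> T -> T -> Prop}.
Hypotheses (lP : chain l P) (cE : chain c E) (cs : separated c).

(** Atoms and relation get separate levels because the step of the back-and-forth combines a
    relation [E q] with atoms of a finer level [k]. *)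
Definition admissible (a : T -> nat) (A : T -> T -> Prop) :=
  unit_rel a A /\ exists M, forall m m', M <= m -> m <= m' -> refines a A (c m') (E m).

Lemma chain_admissible n : admissible (c n) (E n).
Proof.
by split; [exact: chain_unit|exists n => m m'; exact: chain_refines].
Qed.

(** A state of the back-and-forth. The map [g] need not send [f1 u] to [f2 u]: only atoms and links
    correspond, and equality is reached in the limit. By [mt_bnd] the classes of all late levels are
    invariant under [g]. *)
Record matched (f1 f2 : L -> T) a A a' A' (g d : T -> T) : Prop := Matched {
  mt_adm : admissible a A;
  mt_adm' : admissible a' A';
  mt_gd : cancel g d;
  mt_dg : cancel d g;
  mt_at : forall x, a' (g x) = a x;
  mt_rel : forall x y, A' (g x) (g y) <-> A x y;
  mt_bnd : exists M, forall x, E M x (d x);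
  mt_emat : forall u, a (f1 u) = a' (f2 u);
  mt_emrel : forall u v, A (f1 u) (f1 v) <-> A' (f2 u) (f2 v) }.

Definition coherent (a : T -> nat) (A : T -> T -> Prop) (a' : T -> nat) (A' : T -> T -> Prop)
    (g : T -> T) :=
  (forall x, a' (g x) = a x) /\ forall x y, A' (g x) (g y) <-> A x y.

(** Two maps with the same effect on a finer pair agree up to [b']-atoms, so by [rf_inv] they have
    the same effect on the coarser pair. This allows [g] to be replaced at every step without
    disturbing what was settled before. *)
Lemma coherent_trans a A a' A' b B b' B' g0 g1 :
  unit_rel b' B' -> refines a A b B -> refines a' A' b' B' ->
  coherent a A a' A' g0 -> coherent b B b' B' g0 -> coherent b B b' B' g1 ->
  coherent a A a' A' g1.
Proof.
move=> uB r r' [h1 h2] [h3 h4] [h5 h6]; split => [x|x y].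
  by rewrite -h1; apply: (rf_at r'); rewrite h5 h3.
have [bxy|nb] := pselect (B x y); last first.
  by split => [/(rf_rel r')/h6//|/(rf_rel r)].
rewrite -h2; apply: (rf_inv r' uB); rewrite ?h5 ?h3//; [exact/h6|exact/h4].
Qed.

Lemma matched_sym f1 f2 a A a' A' g d :
  matched f1 f2 a A a' A' g d -> matched f2 f1 a' A' a A d g.
Proof.
case=> h1 h2 h3 h4 h5 h6 [M h7] h8 h9; split => //.
- by move=> x; rewrite -h5 h4.
- by move=> x y; rewrite -h6 !h4.
- by exists M => x; apply: (ch_sym cE); rewrite -{2}[x]h3; exact: h7.
- by move=> u v; split => /h9.
Qed.

(** The left side becomes a level [(c m, E m)], the right side its pullback along a new bijection
    [t] replacing [d]. In each class of [E q] the points [f2 u] need targets in the [m]-atoms of the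
    [f1 u], and smallness provides enough of them. Treating one class per tower and copying makes
    [t] respect atoms. *)
Lemma matched_step f1 f2 a A a' A' g d n0 :
  embedding l P c E f1 -> embedding l P c E f2 -> small c E f2 ->
  matched f1 f2 a A a' A' g d ->
  exists m b' B' g' d', [/\ n0 <= m, matched f1 f2 (c m) (E m) b' B' g' d',
    refines a A (c m) (E m), refines a' A' b' B' & coherent a A a' A' g'].
Proof.
move=> e1 e2 sm2 [[uA [M rA]] [uA' [M' rA']] gd dg at_ Arel [Mg dE] fat fA].
pose m := maxn n0 M.
have mn0 : n0 <= m by rewrite leq_maxl.
have mM : M <= m by rewrite leq_maxr.
have um : unit_rel (c m) (E m) by exact: chain_unit.
have rm : refines a A (c m) (E m) by exact: rA.
(* Order of choices: [q] is so large that [E m]-links along [f1] become [E q]-links along [f2] and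
   smallness holds for [m]-atoms; [l N]-atoms decide the [E m]-links along [f1]; [k]-atoms along
   [f2] determine [l N]-atoms and detect the image of [f2]. *)
have [N1 _ HN1] := ev_ex 0 (em_refl e1 m).
have [q mq [[[qrel qsm] qM'] qMg]] :=
  ev_ex m (evI (evI (evI (em_rel e2 N1) (sm2 m)) (ev_ge M')) (ev_ge Mg)).
have EE u v : E m (f1 u) (f1 v) -> E q (f2 u) (f2 v) by move=> /HN1/qrel.
have [N _ [[pull lf1] lf2]] :=
  ev_ex 0 (evI (evI (em_pull lP cE e1 m) (em_cont e1 m)) (em_cont e2 q)).
have [k qk [kN ket]] := ev_ex q (evI (em_open e2 N) (em_etale e2 q)).
have mk : m <= k by exact: leq_trans qk.
have uk : unit_rel (c k) (E k) by exact: chain_unit.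
have uq : unit_rel (c q) (E q) by exact: chain_unit.
have ukq : unit_rel (c k) (E q).
  split; [exact: (ch_refl cE)|exact: (ch_sym cE)|exact: (ch_trans cE)| |].
    by move=> x y exy /(ch_refine cE qk); apply: (ch_inj cE).
  by move=> x y x'; apply: (ch_lift cE).
have rAk : refines a A (c k) (E q) by apply: rA => //; exact: leq_trans mq.
have rAk' : refines a' A' (c k) (E q) by apply: rA'.
have rmk : refines (c m) (E m) (c k) (E q) by exact: chain_refines.
(* For each [w], a bijection whose values on the image of [f2] are the right ones in the [E q]-class
   of [w] only. *)
have tau : forall w, exists ts : (T -> T) * (T -> T),
  [/\ cancel ts.1 ts.2 /\ cancel ts.2 ts.1, forall x, a (ts.1 x) = a' x,
      forall x y, A (ts.1 x) (ts.1 y) <-> A' x y, forall x, E q x (ts.1 x) &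
      (forall u, E q w (f2 u) -> c m (ts.1 (f2 u)) = c m (f1 u)) /\
      (forall u v, E q w (f2 u) -> E q w (f2 v) ->
        E m (ts.1 (f2 u)) (ts.1 (f2 v)) <-> E m (f1 u) (f1 v))].
  move=> w.
  have [Nq HNq] := sp_fin cs q.
  have [us uus usP] := @enum_labelled L (fun u => E q w (f2 u)) (fun u => c q (f2 u)) Nq
    (fun u _ => HNq _) (fun u v hu hv e => em_inj e2 (ch_inj cE (ch_trans cE (ch_sym cE hu) hv) e)).
  have [|i hi|z [zW zE]] := @class_targets T L (c m) (E m) (fun y => E q w y) f1 us (size us) um _ uus (leqnn _).
  - by move=> x y wx /(ch_mono cE mq); apply: (ch_trans cE).
  - have [s' [us' sz H]] := qsm (f1 i) w [seq f2 j | j <- us]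
      (etrans (map_inj_uniq (em_inj e2) _) uus)
      (fun y => fun hy => let: ex_intro2 j hj e := mapP hy in
         conj (eq_ind_r (fun y => E q w y) (proj1 (usP j) hj) e) (ex_intro _ j e)).
    by exists s'; split => //; rewrite size_map in sz.
  have zE' i j : i \in us -> j \in us -> A (z i) (z j) <-> A' (f2 i) (f2 j).
    move=> hi hj; rewrite -fA; split => h.
      have h' := rf_rel rm h.
      by apply/(rf_inv rm um h') => //; [apply/zE|case: (zW i hi)|case: (zW j hj)].
    have h' := rf_rel rm h.
    by apply/(rf_inv rm um h') => //; [apply/zE|case: (zW i hi)|case: (zW j hj)].
  have [t [s [ts ta tA tE tz]]] := @class_permutation T a A a' A' (E q) g d L us f2 z uA uA'
    (@ch_trans _ _ _ cE q) (@ch_sym _ _ _ cE q) (fun x y => @rf_rel _ _ _ _ _ rAk x y) gd dg at_ Arel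
    (fun x => ch_mono cE qMg (dE x))
    (fun i hi => ch_trans cE (ch_sym cE (proj1 (usP i) hi)) (proj1 (zW i hi)))
    (fun i hi => etrans (rf_at rm (proj2 (zW i hi))) (fat i)) zE'.
  exists (t, s); split => //=; split.
    by move=> u /usP hu; rewrite tz//; case: (zW u hu).
  by move=> u v /usP hu /usP hv; rewrite !tz//; exact: zE.
have {tau} [tau tauP] := choice tau.
(* Representatives lie on the image of [f2] whenever possible; [em_etale] then recognises the image
   points in the class of a representative. *)
have [R [R1 R2 R3 R4]] := tower_representatives cE (fun x => exists u, x = f2 u) qk.
have [t [s [ts st tE [tc sc] hat]]] := tower_extension (t := fun w => (tau w).1) (s := fun w => (tau w).2)
  cE qk R1 R2 R3 (fun w => let: And5 h _ _ _ _ := tauP w in h)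
  (fun w p => let: And5 _ _ _ h _ := tauP w in h p).
have hat2 x y : E q x y -> exists x' y', [/\ E q x' y', c k x' = c k x, c k y' = c k y,
    R y = R x & [/\ E q (R x) x', E q (R x) y', c k (t x) = c k ((tau (R x)).1 x') &
    c k (t y) = c k ((tau (R x)).1 y')]].
  move=> exy; have [x' [h1 h2 h3]] := hat x; have [y' [h1' h2' h3']] := hat y.
  rewrite -(R2 _ _ exy) in h1' h3'; exists x', y'; split => //.
    exact: (ch_trans cE) (ch_sym cE h1) h1'.
  by rewrite (R2 _ _ exy).
have tEq x y : E q (t x) (t y) <-> E q x y.
  split => h.
    exact: (ch_trans cE) (tE x) (ch_trans cE h (ch_sym cE (tE y))).
  exact: (ch_trans cE) (ch_sym cE (tE x)) (ch_trans cE h (tE y)).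
have ta x : a (t x) = a' x.
  have [x' [h1 h2 h3]] := hat x; rewrite (rf_at rAk h3).
  by case: (tauP (R x)) => _ -> _ _ _; exact: (rf_at rAk').
have tA x y : A (t x) (t y) <-> A' x y.
  have [exy|nxy] := pselect (E q x y); last first.
    by split => [/(rf_rel rAk)/tEq//|/(rf_rel rAk')].
  have [x' [y' [e' cx cy _ [_ _ ctx cty]]]] := hat2 _ _ exy.
  rewrite (rf_inv rAk ukq (x1 := (tau (R x)).1 x') (y1 := (tau (R x)).1 y'))//.
  - case: (tauP (R x)) => _ _ -> _ _.
    exact: (rf_inv rAk' ukq).
  - exact/tEq.
  - case: (tauP (R x)) => _ _ _ h _.
    exact: (ch_trans cE) (ch_sym cE (h _)) (ch_trans cE e' (h _)).
have f2hat x u v : E q (R x) v -> c k v = c k (f2 u) -> E q x (f2 u) -> exists v', v = f2 v'.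
  move=> h1 h2 h3; have [z ez cz] := R1 (f2 u).
  have [w Rw] : exists w, R (f2 u) = f2 w by apply: R4; exists u.
  rewrite -(R2 _ _ h3) in Rw => {ez cz z}.
  by apply: (ket w u) => //; rewrite -?Rw//; rewrite (R2 _ _ h3).
have t2 u : c m (t (f2 u)) = c m (f1 u).
  have [x' [h1 h2 h3]] := hat (f2 u); rewrite (rf_at rmk h3).
  have [v ev] := f2hat _ _ _ h1 h2 (ch_refl cE q _); subst x'.
  case: (tauP (R (f2 u))) => _ _ _ _ [-> // _]; apply: lf1.
  exact: kN.
have t3 u v : E m (t (f2 u)) (t (f2 v)) <-> E m (f1 u) (f1 v).
  have [exy|nxy] := pselect (E q (f2 u) (f2 v)); last first.
    by split => [/(ch_mono cE mq)/tEq//|/EE].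
  have [x' [y' [e' cx cy eR [ex ey ctx cty]]]] := hat2 _ _ exy.
  have [u' eu'] := f2hat _ _ _ ex cx (ch_refl cE q _); subst x'.
  rewrite -eR in ey.
  have [v' ev'] := f2hat _ _ _ ey cy (ch_refl cE q _); subst y'.
  rewrite eR in ey.
  rewrite (rf_inv rmk ukq (x1 := (tau (R (f2 u))).1 (f2 u')) (y1 := (tau (R (f2 u))).1 (f2 v')))//; last 2 first.
  - exact/tEq.
  - case: (tauP (R (f2 u))) => _ _ _ h _.
    exact: (ch_trans cE) (ch_sym cE (h _)) (ch_trans cE e' (h _)).
  case: (tauP (R (f2 u))) => _ _ _ _ [_ ->//].
  (* By [em_pull], an [E m]-link along [f1] depends only on the [l N]-atoms, which agree for a point
     and its counterpart in the representative class. *)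
  have main u1 v1 u2 v2 : E q (f2 u1) (f2 v1) -> E q (f2 u2) (f2 v2) ->
      l N u2 = l N u1 -> l N v2 = l N v1 -> E m (f1 u1) (f1 v1) -> E m (f1 u2) (f1 v2).
    move=> h1 h2 lu lv h.
    have [w lw hw] := pull _ _ _ h lu.
    suff -> : v2 = w by [].
    apply: (em_inj e2); apply: (ch_inj cE (n := q)); last by apply: lf2; rewrite lw.
    exact: (ch_trans cE) (ch_sym cE h2) (EE _ _ hw).
  split; apply: main => //; try exact: kN; by apply: kN; rewrite ?cx ?cy.
exists m, (c m \o t), (fun x y => E m (t x) (t y)), s, t; split => //.
- split => //.
  + exact: chain_admissible.
  + split.
      split.
      * by move=> x; exact: (ch_refl cE).
      * by move=> x y; exact: (ch_sym cE).
      * by move=> x y z; exact: (ch_trans cE).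
      * by move=> x y h1 h2; apply: (can_inj ts); apply: (ch_inj cE) h1 h2.
      * move=> x y x' h1 h2; have [z cz ez] := ch_lift cE (leqnn m) h1 h2.
        by exists (s z) => /=; rewrite st.
    exists k => j j' kj jj'; split.
    * by move=> x y /(tc _ _ _ (leq_trans kj jj')); apply: (ch_refine cE); apply: leq_trans jj'; exact: leq_trans kj.
    * by move=> x y /(ch_mono cE mq)/tEq; apply: (ch_mono cE); exact: leq_trans kj.
    * move=> x y x' h1 h2; have kj' := leq_trans kj jj'.
      have [z cz ez] := ch_lift cE (leq_trans mk kj') h1 (tc _ _ _ kj' h2).
      exists (s z); last by rewrite st.
      by rewrite -[in RHS](ts y); exact: sc.
  + by move=> x /=; rewrite st.
  + by move=> x y; rewrite !st.
  + by exists q.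
  + by move=> u /=; rewrite t2.
  + by move=> u v; rewrite t3.
- split => [x y /= /(rf_at rm)|x y /tA/(rf_rel rm)//|x y x' /tA h1 h2].
    by rewrite !ta.
  have [z cz ez] := rf_lift rm h1 h2; exists (s z) => /=; first by rewrite st.
  by apply/tA; rewrite st.
- by split => [x|x y]; [rewrite -ta st|rewrite -tA !st].
Qed.

(** One step turns only the left side into a level of the chain; a second one with [f1] and [f2]
    exchanged does the same for the right side, so that both absorb [(c n, E n)]. *)
Lemma matched_step2 f1 f2 a A a' A' g d n :
  embedding l P c E f1 -> embedding l P c E f2 -> small c E f1 -> small c E f2 ->
  matched f1 f2 a A a' A' g d ->
  exists b B b' B' g' d', [/\ matched f1 f2 b B b' B' g' d',
    refines a A b B, refines a' A' b' B', refines (c n) (E n) b B /\ refines (c n) (E n) b' B' &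
    coherent a A a' A' g'].
Proof.
move=> e1 e2 s1 s2 st.
have [m [b' [B' [g1 [d1 [nm st1 r1 r1' co1]]]]]] := matched_step n e1 e2 s2 st.
have [m2 [b [B [d2 [g2 [nm2 st2 r2 r2' co2]]]]]] := matched_step n e2 e1 s1 (matched_sym st1).
have um : unit_rel (c m) (E m) by exact: chain_unit.
have uB' : unit_rel b' B' := proj1 (mt_adm' st1).
have st2' := matched_sym st2.
exists b, B, (c m2), (E m2), g2, d2; split => //.
- exact: refines_trans r1 r2'.
- exact: refines_trans r1' r2.
- split; last exact: chain_refines.
  by apply: refines_trans r2' => //; exact: chain_refines.
- apply: (coherent_trans uB' r1 r1' co1).
    by split; [exact: (mt_at st1)|exact: (mt_rel st1)].
  have [h1 h2] := co2; have K := mt_gd st2'.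
  by split => [x|x y]; [rewrite -h1 K|rewrite -h2 !K].
Qed.

Record tower_map (a a' : nat -> T -> nat) (A A' : nat -> T -> T -> Prop) (g : nat -> T -> T) : Prop :=
 TowerMap {
  tm_adm : forall n, admissible (a n) (A n);
  tm_adm' : forall n, admissible (a' n) (A' n);
  tm_rf : forall n, refines (a n) (A n) (a n.+1) (A n.+1);
  tm_rf' : forall n, refines (a' n) (A' n) (a' n.+1) (A' n.+1);
  tm_c : forall n, refines (c n) (E n) (a n.+1) (A n.+1);
  tm_c' : forall n, refines (c n) (E n) (a' n.+1) (A' n.+1);
  tm_co : forall n, coherent (a n) (A n) (a' n) (A' n) (g n);
  tm_coS : forall n, coherent (a n) (A n) (a' n) (A' n) (g n.+1) }.

(** By coherence the [a' n]-atom of [g m x] is constant for [m >= n], and these atoms determine the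
    labels, so [g m x] converges. For links, the [A' n]-class of [h x] has a point in the
    [a' N]-atom of [h y] for every [N >= n]; by [ur_inj] it is always the same point, hence [h y]
    itself. *)
Lemma tower_map_limit a a' A A' g : tower_map a a' A A' g ->
  exists h : T -> T, (forall n x, a' n (h x) = a n x) /\
    forall n x y, A n x y -> A' n (h x) (h y).
Proof.
case=> ad ad' rf rf' rc rc' co coS.
have rfle n m : n <= m -> refines (a' n) (A' n) (a' m) (A' m).
  move=> /subnK <-; elim: (m - n) => [|k IH].
    by split => // x y x'; apply: (ur_lift (proj1 (ad' n))).
  by apply: refines_trans IH (rf' _); case: (ad' (k + n)).
have rfle0 n m : n <= m -> refines (a n) (A n) (a m) (A m).
  move=> /subnK <-; elim: (m - n) => [|k IH].
    by split => // x y x'; apply: (ur_lift (proj1 (ad n))).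
  by apply: refines_trans IH (rf _); case: (ad (k + n)).
have cole n m : n <= m -> coherent (a n) (A n) (a' n) (A' n) (g m).
  move=> /subnK <-; elim: (m - n) => [|k IH]; first exact: co.
  rewrite addSn; apply: coherent_trans IH (co _) (coS _).
  - by case: (ad' (k + n)).
  - by apply: rfle0; rewrite leq_addl.
  - by apply: rfle; rewrite leq_addl.
have lim x : exists y, forall n, a' n y = a n x.
  have stab n m : n < m -> c n (g m x) = c n (g n.+1 x).
    move=> nm; apply: (rf_at (rc' n)).
    by rewrite (proj1 (cole _ _ nm)) (proj1 (cole _ _ (leqnn _))).
  have [y hy] := sp_lim cs (u := fun n => g n.+1 x) (fun n => stab _ _ (leqnSn _)).
  exists y => n; have [_ [M rM]] := ad' n.
  rewrite (rf_at (rM (maxn M n) (maxn M n) (leq_maxl _ _) (leqnn _)) (hy _)).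
  by apply: (proj1 (cole _ _ _)); rewrite ltnW// ltnS leq_maxr.
have [h hE] := choice lim.
exists h; split => // n x y Axy.
have key N : n <= N -> exists2 z, a' N z = a' N (h y) & A' n (h x) z.
  move=> nN; have h1 : A' n (g N x) (g N y) by apply/(proj2 (cole _ _ nN)).
  have [|z az Az] := rf_lift (rfle _ _ nN) h1 (x' := h x).
    by rewrite hE (proj1 (co _)).
  by exists z => //; rewrite az hE (proj1 (co _)).
have [z az Az] := key n (leqnn _).
suff -> : h y = z by [].
have all N : n <= N -> a' N (h y) = a' N z.
  move=> nN; have [z' az' Az'] := key N nN; rewrite -az'; congr (a' N).
  have un : unit_rel (a' n) (A' n) by case: (ad' n).
  apply: (ur_inj un (ur_trans un (ur_sym un Az') Az)).
  by rewrite az; apply: (rf_at (rfle _ _ nN)).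
apply: (sp_sep cs) => k; apply: (ch_refine cE (leq_maxl k n)).
apply: (rf_at (rc' _)); apply: all; rewrite ltnW// ltnS leq_maxr//.
Qed.

(** The states form two tower maps, one for [g] and one for [d], whose limits are inverse to each
    other. The limit sends [f1 u] to [f2 u] because their atoms correspond at every stage. *)
Theorem embedding_extension f1 f2 :
  embedding l P c E f1 -> embedding l P c E f2 -> small c E f1 -> small c E f2 ->
  exists h k : T -> T, [/\ cancel h k, cancel k h, forall u, h (f1 u) = f2 u,
    (forall n, exists m, forall x y, c m x = c m y -> c n (h x) = c n (h y)) /\
    (forall n, exists m, forall x y, c m x = c m y -> c n (k x) = c n (k y)) &
    (forall n x y, E n x y -> exists m, E m (h x) (h y)) /\
    (forall n x y, E n x y -> exists m, E m (k x) (k y))].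
Proof.
move=> e1 e2 s1 s2.
pose st := ((T -> nat) * (T -> T -> Prop) * ((T -> nat) * (T -> T -> Prop)) * ((T -> T) * (T -> T)))%type.
pose ok (s : st) := matched f1 f2 s.1.1.1 s.1.1.2 s.1.2.1 s.1.2.2 s.2.1 s.2.2.
pose step n (s s' : st) := [/\ refines s.1.1.1 s.1.1.2 s'.1.1.1 s'.1.1.2,
  refines s.1.2.1 s.1.2.2 s'.1.2.1 s'.1.2.2,
  refines (c n) (E n) s'.1.1.1 s'.1.1.2, refines (c n) (E n) s'.1.2.1 s'.1.2.2 &
  coherent s.1.1.1 s.1.1.2 s.1.2.1 s.1.2.2 s'.2.1].
(* The initial state has one atom and the equality relation, so it only asks that [f1] and [f2] be
   injective. *)
pose s0 : st := ((fun=> 0%N, eq), (fun=> 0%N, eq), (id, id)).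
have ok0 : ok s0.
  have ad : admissible (fun=> 0%N) eq.
    split; first by split => //= [x y z -> ->//|x y x' _ _]; exists x'.
    exists 0%N => m m' _ _; split => //= [x y ->|x y x' -> cx]; first exact: (ch_refl cE).
    by exists x'.
  split => //=; first by exists 0%N => x; exact: (ch_refl cE).
  by move=> u v; split => [/(em_inj e1)->//|/(em_inj e2)->].
have ex n (s : {s | ok s}) : exists s' : {s | ok s}, step n (sval s) (sval s').
  case: s => s oks; have [b [B [b' [B' [g [d [k1 k2 k3 [k4 k5] k6]]]]]]] := matched_step2 n e1 e2 s1 s2 oks.
  by exists (exist ok (b, B, (b', B'), (g, d)) k1).
pose nx n s := sval (cid (ex n s)).
pose sq := fix sq n : {s | ok s} := if n is n'.+1 then nx n' (sq n') else exist ok s0 ok0.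
have sqS n : step n (sval (sq n)) (sval (sq n.+1)) by exact: (svalP (cid (ex n (sq n)))).
have sqok n : ok (sval (sq n)) by exact: (svalP (sq n)).
pose s n := sval (sq n).
have tm : tower_map (fun n => (s n).1.1.1) (fun n => (s n).1.2.1)
    (fun n => (s n).1.1.2) (fun n => (s n).1.2.2) (fun n => (s n).2.1).
  split => n; try by case: (sqS n).
  - exact: (mt_adm (sqok n)).
  - exact: (mt_adm' (sqok n)).
  - by split; [exact: (mt_at (sqok n))|exact: (mt_rel (sqok n))].
have tm' : tower_map (fun n => (s n).1.2.1) (fun n => (s n).1.1.1)
    (fun n => (s n).1.2.2) (fun n => (s n).1.1.2) (fun n => (s n).2.2).
  split => n; try by case: (sqS n).
  - exact: (mt_adm' (sqok n)).
  - exact: (mt_adm (sqok n)).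
  - have m := matched_sym (sqok n).
    by split; [exact: (mt_at m)|exact: (mt_rel m)].
  - have [_ _ _ _ [h1 h2]] := sqS n; have K := mt_dg (sqok n.+1).
    by split => [x|x y]; [rewrite -h1 K|rewrite -h2 !K].
have [h [ha hA]] := tower_map_limit tm; have [k [ka kA]] := tower_map_limit tm'.
have ineq n x y : (s n.+1).1.1.1 x = (s n.+1).1.1.1 y -> c n x = c n y.
  by case: (sqS n) => _ _ r _ _; apply: (rf_at r).
have ineq' n x y : (s n.+1).1.2.1 x = (s n.+1).1.2.1 y -> c n x = c n y.
  by case: (sqS n) => _ _ _ r _; apply: (rf_at r).
have hk : cancel h k by move=> x; apply: (sp_sep cs) => n; apply: ineq; rewrite ka ha.
have kh : cancel k h by move=> x; apply: (sp_sep cs) => n; apply: ineq'; rewrite ha ka.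
exists h, k; split => //.
- move=> u; apply: (sp_sep cs) => n; apply: ineq'; rewrite ha.
  exact: (mt_emat (sqok n.+1)).
- split=> n.
    have [_ [M rM]] := mt_adm (sqok n.+1); exists M => x y cxy.
    by apply: ineq'; rewrite !ha; apply: (rf_at (rM M M (leqnn _) (leqnn _))).
  have [_ [M rM]] := mt_adm' (sqok n.+1); exists M => x y cxy.
  by apply: ineq; rewrite !ka; apply: (rf_at (rM M M (leqnn _) (leqnn _))).
- split=> n x y Exy.
    have [_ [M rM]] := mt_adm' (sqok n.+1); exists M.
    apply: (rf_rel (rM M M (leqnn _) (leqnn _))); apply: hA.
    by case: (sqS n) => _ _ r _ _; apply: (rf_rel r).
  have [_ [M rM]] := mt_adm (sqok n.+1); exists M.
  apply: (rf_rel (rM M M (leqnn _) (leqnn _))); apply: kA.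
  by case: (sqS n) => _ _ _ r _; apply: (rf_rel r).
Qed.
End Extension.

(** * Breaking a chain *)

Section AtomRelation.
Context {L : choiceType} {l : nat -> L -> nat} {P : nat -> L -> L -> Prop}.
Hypothesis lP : chain l P.

(** The relation induced by [P n] on the atoms of level [m], an equivalence for [n <= m]. The labels
    of a stage matter only up to atoms, so links between them are expressed in this form. *)
Definition atom_rel m n u v := exists2 v', l m v' = l m v & P n u v'.

Lemma ar_refl m n u v : l m u = l m v -> atom_rel m n u v.
Proof. by exists u => //; exact: (ch_refl lP). Qed.

Lemma ar_rel m n u v : P n u v -> atom_rel m n u v.
Proof. by exists v. Qed.

Lemma ar_sym m n u v : n <= m -> atom_rel m n u v -> atom_rel m n v u.
Proof.
move=> nm [v' lv /(ch_sym lP) puv].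
by have [u' lu pu] := ch_lift lP nm puv lv; exists u'.
Qed.

Lemma ar_trans m n u v w : n <= m -> atom_rel m n u v -> atom_rel m n v w -> atom_rel m n u w.
Proof.
move=> nm [v' lv puv] [w' lw pvw].
have [w2 lw2 pw2] := ch_lift lP nm pvw (esym lv).
by exists w2; [rewrite lw2|exact: (ch_trans lP) puv pw2].
Qed.

Lemma ar_le m m' n n' u v : m' <= m -> n <= n' -> atom_rel m n u v -> atom_rel m' n' u v.
Proof.
move=> mm nn [v' lv puv]; exists v'; first exact: (ch_refine lP mm).
exact: (ch_mono lP nn).
Qed.

Lemma ar_uniq n u v w : P n u v -> P n u w -> l n v = l n w -> v = w.
Proof. by move=> h1 h2; apply: (ch_inj lP); exact: (ch_trans lP) (ch_sym lP h1) h2. Qed.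

Lemma ar_canonical m n (u0 : L) : n <= m -> exists R : L -> L,
  (forall u, atom_rel m n u (R u)) /\ (forall u v, atom_rel m n u v -> R u = R v).
Proof.
move=> nm; exists (fun u => xget u0 [set v | atom_rel m n u v]); split => [u|u v uv].
  by apply: (@xgetI _ _ [set v | atom_rel m n u v] u); exact: ar_refl.
congr (xget _ _); apply/seteqP; split => w /= h.
  exact: ar_trans (ar_sym nm uv) h.
exact: ar_trans uv h.
Qed.

End AtomRelation.

(** * Room provided by minimality and perfectness *)

Section Richness.
Context {T : choiceType} {c : nat -> T -> nat} {E : nat -> T -> T -> Prop}.
Hypotheses (cE : chain c E) (cs : separated c).
Hypothesis minimal : forall n, exists m, forall x z, exists2 y, E m x y & c n y = c n z.
Hypothesis perfect : forall n x, exists2 y, y <> x & c n y = c n x.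

Lemma separate_seq (s : seq T) :
  ev (fun j => forall x y, x \in s -> y \in s -> c j x = c j y -> x = y).
Proof.
elim: s => [|a s IH]; first by exists 0.
have H : ev (fun j => forall y, y \in s -> c j a = c j y -> a = y).
  elim: {IH} s => [|b s IH]; first by exists 0.
  have Hb : ev (fun j => c j a = c j b -> a = b).
    have [->|ab] := eqVneq a b; first by exists 0.
    have [j hj] : exists j, c j a <> c j b.
      apply: contrapT => h; case/eqP: ab; apply: (sp_sep cs) => j.
      by apply: contrapT => h'; apply: h; exists j.
    by exists j => k jk /(ch_refine cE jk).
  have [N HN] := evI IH Hb; exists N => j /HN[h1 h2] y.
  by rewrite in_cons => /orP[/eqP ->//|]; exact: h1.
have [N HN] := evI IH H; exists N => j /HN[h1 h2] x y.
rewrite !in_cons => /orP[/eqP ->|xs] /orP[/eqP ->|ys] //; first exact: h2.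
  by move=> /esym/(h2 _ xs)/esym.
exact: h1.
Qed.

Lemma avoid_seq (V : T -> Prop) (s : seq T) :
  (forall x, (forall n, exists2 y, V y & c n y = c n x) -> V x) ->
  (forall x, x \in s -> ~ V x) ->
  ev (fun j => forall x v, x \in s -> V v -> c j x <> c j v).
Proof.
move=> Vc; elim: s => [|a s IH] sV; first by exists 0.
have [|N HN] := IH.
  by move=> x xs; apply: sV; rewrite in_cons xs orbT.
have [j hj] : exists j, forall v, V v -> c j a <> c j v.
  apply: contrapT => h; apply: (sV a (mem_head _ _)); apply: Vc => j.
  apply: contrapT => h'; apply: h; exists j => v Vv e; apply: h'.
  by exists v.
exists (maxn N j) => k; rewrite geq_max => /andP[Nk jk] x v.
rewrite in_cons => /orP[/eqP ->|xs] Vv; last exact: HN.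
by move/(ch_refine cE jk); exact: hj.
Qed.

Lemma many_points k N x : exists s : seq T,
  [/\ uniq s, size s = N & forall y, y \in s -> c k y = c k x].
Proof.
elim: N => [|N [s [us ss sc]]]; first by exists [::].
have [[|p s'] es] : exists s', s = s' by exists s.
  by exists [:: x]; rewrite -ss es; split => // y; rewrite inE => /eqP ->.
have ps : p \in s by rewrite es mem_head.
have [j kj hj] := ev_ex k (separate_seq s).
have [y yp cy] := perfect j p; exists (y :: s); split => /=.
- by rewrite us andbT; apply/negP => ys; apply: yp; exact: hj.
- by rewrite ss.
- move=> w; rewrite in_cons => /orP[/eqP ->|]; last exact: sc.
  by rewrite -(sc p)//; exact: (ch_refine cE kj).
Qed.

Lemma class_seq n x : exists2 s : seq T, uniq s & forall y, y \in s <-> E n x y.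
Proof.
have [N HN] := sp_fin cs n.
apply: (@enum_labelled T (E n x) (c n) N) => // y z h1 h2.
by apply: (ch_inj cE); exact: (ch_trans cE) (ch_sym cE h1) h2.
Qed.

Lemma minimal_ev n : ev (fun m => forall x z, exists2 y, E m x y & c n y = c n z).
Proof.
have [m H] := minimal n; exists m => k mk x z; have [y e cy] := H x z.
by exists y => //; exact: (ch_mono cE mk).
Qed.

(** Take [N] points in one [k]-atom and a level [j] separating them. By minimality a class of large
    level meets all their [j]-atoms; the points found there share a [k]-atom, where distinct points
    are never [E k]-related. *)
Lemma blocks (x0 : T) k N : ev (fun m => forall x, exists B : nat -> T,
  (forall r, r < N -> E m x (B r)) /\
  forall r r', r < N -> r' < N -> E k (B r) (B r') -> r = r').
Proof.
have [s [us ss sc]] := many_points k N x0.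
have [j kj hj] := ev_ex k (separate_seq s).
have [M HM] := minimal_ev j; exists M => m /HM H x.
have [B HB] := choice (fun r => let: ex_intro2 y e h := H x (nth x0 s r) in
  ex_intro (fun y => E m x y /\ c j y = c j (nth x0 s r)) y (conj e h)).
exists B; split => [r _|r r' hr hr' e]; first by case: (HB r).
have cB q : q < N -> c k (B q) = c k x0.
  move=> hq; rewrite (ch_refine cE kj (proj2 (HB q))).
  by apply: sc; rewrite mem_nth// ss.
have eB : B r = B r' by apply: (ch_inj cE) e _; rewrite !cB.
apply/eqP; rewrite -(nth_uniq x0 _ _ us) ?ss//; apply/eqP.
apply: hj; rewrite ?mem_nth ?ss//.
by rewrite -(proj2 (HB r)) -(proj2 (HB r')) eB.
Qed.

(** Points in a small enough atom around [w] have classes so close to that of [w] that these still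
    avoid the closed set [V], and distinct points of one atom are unrelated. *)
Lemma free_points (V : T -> Prop) m N :
  (forall x, (forall n, exists2 y, V y & c n y = c n x) -> V x) ->
  (exists w, forall y, E m w y -> ~ V y) ->
  exists p : nat -> T, (forall r y, r < N -> E m (p r) y -> ~ V y) /\
    forall r r', r < N -> r' < N -> E m (p r) (p r') -> r = r'.
Proof.
move=> Vc [w fw].
have [s _ sE] := class_seq m w.
have [k mk hk] := ev_ex m (@avoid_seq V s Vc (fun y ys => fw y (proj1 (sE y) ys))).
have [t [ut st tc]] := many_points k N w.
exists (nth w t); split => [r y hr e Vy|r r' hr hr' e].
  have [y' cy ey] := ch_lift cE mk e (tc (nth w t r) (mem_nth _ (eq_rect_r (fun n => r < n) hr st))).
  by apply: (hk y' y) => //; apply/sE.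
apply/eqP; rewrite -(nth_uniq w _ _ ut) ?st//; apply/eqP.
apply: (ch_inj cE) e _; apply: (ch_refine cE mk).
by rewrite !tc// mem_nth// st.
Qed.

(* Otherwise each class of level [m] contains a point of [V], so at a much higher level
   the points of [V] outnumber those of an atom at least two to one. *)
Lemma small_free (V : T -> Prop) (x0 : T) m :
  small c E (fun v : {x | V x} => sval v) -> exists w, forall y, E m w y -> ~ V y.
Proof.
move=> sm.
have [M mM bl] := ev_ex m (blocks x0 m 2).
have [q Mq smq] := ev_ex M (sm M).
apply: contrapT => nf.
have meet w : exists y, E m w y /\ V y.
  apply: contrapT => h; apply: nf; exists w => y e Vy; apply: h.
  by exists y.
have [v vP] := choice meet.
have [B BP] := choice bl.
have [s us sE] := class_seq q x0.
pose vs := [seq y <- s | `[< V y >]].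
have vsP y : y \in vs <-> E q x0 y /\ V y.
  rewrite mem_filter; split => [/andP[/asboolP Vy /sE]//|[/sE e Vy]].
  by rewrite e andbT; apply/asboolP.
have [|y /vsP[e Vy]|s' [us' sz s'P]] := smq x0 x0 vs.
- by rewrite filter_uniq.
- by split=> //; exists (exist _ y Vy).
pose g i y := v (B y i).
have gE i y : i < 2 -> E M y (g i y).
  move=> hi; have [h _] := BP y.
  exact: (ch_trans cE) (h _ hi) (ch_mono cE mM (proj1 (vP _))).
have ginj i i' y y' : i < 2 -> i' < 2 -> y \in s' -> y' \in s' -> g i y = g i' y' -> i = i' /\ y = y'.
  move=> hi hi' hy hy' e.
  have yy' : y = y'.
    apply: (ch_inj cE (n := M)); last by rewrite (proj2 (s'P _ hy)) (proj2 (s'P _ hy')).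
    apply: (ch_trans cE) (gE _ _ hi) _; rewrite e; exact: (ch_sym cE) (gE _ _ hi').
  split=> //; subst y'; apply: (proj2 (BP y)) => //.
  apply: (ch_trans cE) (proj1 (vP _)) _; rewrite -[v _]/(g i y) e.
  exact: (ch_sym cE) (proj1 (vP _)).
have gs' i y : i < 2 -> y \in s' -> g i y \in vs.
  move=> hi hy; apply/vsP; split; last by case: (vP (B y i)).
  exact: (ch_trans cE) (proj1 (s'P _ hy)) (ch_mono cE Mq (gE _ _ hi)).
have : size ([seq g 0 y | y <- s'] ++ [seq g 1 y | y <- s']) <= size vs.
  apply: uniq_leq_size.
    rewrite cat_uniq !map_inj_in_uniq ?us' /= ?andbT//; last 2 first.
    - by move=> y y' hy hy' /(ginj 1 1 _ _ isT isT hy hy')[].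
    - by move=> y y' hy hy' /(ginj 0 0 _ _ isT isT hy hy')[].
    apply/hasPn => _ /mapP[y hy ->]; apply/negP => /mapP[y' hy'].
    by move=> /(ginj 1 0 _ _ isT isT hy hy')[].
  by move=> y; rewrite mem_cat => /orP[] /mapP[y' hy' ->]; exact: gs'.
rewrite size_cat !size_map => h; have : size s' + size s' <= size s' := leq_trans h sz.
rewrite -{3}[size s']addn0 leq_add2l leqn0 => /eqP s0.
have [e Vv] := vP x0.
have : v x0 \in vs by apply/vsP; split => //; apply: (ch_mono cE) e; exact: leq_trans Mq.
by move: sz; rewrite s0 leqn0 size_eq0 => /eqP ->.
Qed.

End Richness.

(* The state after finitely many steps: [pt] is the current approximation of the copy of
   [L], made of finitely many points of [T], one for each atom of [L]; the [lo]-classes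
   meeting their [hi]-atoms are broken according to the labels [lbl]. *)
Record stage (L T : Type) := Stage { lo : nat; hi : nat; pt : L -> T; lbl : T -> L }.

Section Breaking.
Context {T : choiceType} {c : nat -> T -> nat} {E : nat -> T -> T -> Prop}.
Hypotheses (cE : chain c E) (cs : separated c).
Hypothesis minimal : forall n, exists m, forall x z, exists2 y, E m x y & c n y = c n z.
Hypothesis perfect : forall n x, exists2 y, y <> x & c n y = c n x.
Context {L : choiceType} {l : nat -> L -> nat} {P0 P1 : nat -> L -> L -> Prop}.
Hypotheses (lP0 : chain l P0) (lP1 : chain l P1) (ls : separated l).
Hypothesis P01 : forall n u v, P0 n u v -> P1 n u v.
Hypothesis l0 : forall u v, l 0 u = l 0 v.
Variable u0 : L.
Variable V : T -> Prop.
Hypothesis Vclosed : forall x, (forall n, exists2 y, V y & c n y = c n x) -> V x.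
Hypothesis Vfree : forall m, exists w, forall y, E m w y -> ~ V y.

Notation ar0 := (@atom_rel _ l P0).
Notation ar1 := (@atom_rel _ l P1).
Notation stageLT := (stage L T).
Implicit Types S : stageLT.

Definition special S x := exists u y, E (lo S) x y /\ c (hi S) y = c (hi S) (pt S u).

Definition broken n S x y := E (lo S) x y /\ (special S x -> ar0 n n (lbl S x) (lbl S y)).

(** [gd_lbl0] makes the broken relation restrict to [P0] on the copy; [gd_lbl1] keeps all labels of
    a special class in one [P1]-class of atoms, so that [P1]-links restore what was broken. *)
Record good n S : Prop := Good {
  gd_lohi : lo S <= hi S;
  gd_pt : forall u v, l n u = l n v -> pt S u = pt S v;
  gd_rel : forall u v, P1 n u v -> E (lo S) (pt S u) (pt S v);
  gd_refl : forall u v y, E (lo S) (pt S u) y -> c (hi S) y = c (hi S) (pt S v) -> ar1 n n u v;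
  gd_inj : forall u v, c (hi S) (pt S u) = c (hi S) (pt S v) -> l n u = l n v;
  gd_avoid : forall u y k, E (lo S) (pt S u) y -> V k -> c (hi S) y <> c (hi S) k;
  gd_lbl : forall x y, c (hi S) x = c (hi S) y -> lbl S x = lbl S y;
  gd_lbl1 : forall x y u, E (lo S) x y -> c (hi S) y = c (hi S) (pt S u) -> ar1 n n u (lbl S x);
  gd_lbl0 : forall x u, c (hi S) x = c (hi S) (pt S u) -> ar0 n n u (lbl S x) }.

(** [nx_broken] makes the broken relations increase; [nx_heal] rejoins an old class that meets no
    atom of a new point; [nx_rich] yields smallness, as the number of atoms of [L] bounds the number
    of points of the copy in a class. *)
Record next n S S' : Prop := Next {
  nx_lo : lo S < lo S';
  nx_hi : hi S <= lo S';
  nx_rel : forall u v, P1 n u v -> E (lo S) (pt S' u) (pt S' v);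
  nx_pt : forall u, c (hi S) (pt S' u) = c (hi S) (pt S u);
  nx_broken : forall x y, broken n S x y -> special S' x -> ar0 n.+1 n.+1 (lbl S' x) (lbl S' y);
  nx_heal : forall x y, E (lo S) x y -> special S' x ->
    (forall u w, E (lo S) x w -> c (hi S') w <> c (hi S') (pt S' u)) ->
    ar0 n.+1 n.+1 (lbl S' x) (lbl S' y);
  nx_rich : exists N, (forall u, l n.+1 u < N) /\ forall x b, special S' x ->
    exists s : seq T, [/\ uniq s, N <= size s &
      forall y, y \in s -> broken n.+1 S' x y /\ c (hi S) y = c (hi S) b] }.

Lemma good0 : exists S, good 0 S.
Proof.
have [w fw] := Vfree 0.
have [s _ sE] := class_seq cE cs 0 w.
have [k _ hk] := ev_ex 0 (@avoid_seq _ _ _ cE V s Vclosed (fun y ys => fw y (proj1 (sE y) ys))).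
(* Level 0 of [l] is a single atom, so one point and one label suffice. *)
exists (Stage 0 k (fun=> w) (fun=> u0)); split => //=.
- by move=> u v _; exact: (ch_refl cE).
- by move=> u v y _ _; exact: (ar_refl lP1).
- by move=> u y v e Vv; apply: hk => //; apply/sE.
- by move=> x y u _ _; exact: (ar_refl lP1).
- by move=> x u _; exact: (ar_refl lP0).
Qed.

(* The new points of each [P1]-class of atoms of level [n.+1] are placed in one [mu]-class free
   of [V], that of [p i].  There, every atom of level [n.+1] owns [ell.+1] blocks of level
   [mu1]: block [0] hosts the points of the atom, and the others are labelled by it, so that
   the class remains rich after breaking. *)
Lemma step n S : good n S -> exists S', good n.+1 S' /\ next n S S'.
Proof.
case: S => nu nu' z la; case=> /= lohi zl zrel zrefl zinj zavoid lal la1 la0.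
have [ell lell] := sp_fin ls n.+1.
have [mu1 nmu1 vis] := ev_ex nu' (minimal_ev cE minimal nu').
have [mu gemu blk] :=
  ev_ex (maxn nu.+1 mu1) (blocks cE cs minimal perfect (z u0) mu1 (ell * ell.+1)).
have [numu mu1mu] : nu < mu /\ mu1 <= mu by move: gemu; rewrite geq_max => /andP[].
have {gemu} nu'mu : nu' <= mu by apply: leq_trans mu1mu.
have numu1 : nu <= mu1 by exact: leq_trans nmu1.
have [p [pfree pinj]] := free_points cE cs perfect ell Vclosed (Vfree mu).
(* [tau u] indexes the [P1 n.+1]-class of the atom of [u]. [R2] represents the finer partition by
   links of [P1 n]: atoms linked there must receive [nu]-related points, so they share the hosting
   block of their representative. *)
have [R1 [R1P R1E]] := ar_canonical lP1 u0 (leqnn n.+1).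
have [R2 [R2P R2E]] := ar_canonical lP1 u0 (leqnSn n).
pose tau u := l n.+1 (R1 u).
have tau_lt u : tau u < ell by exact: lell.
have tauE u v : ar1 n.+1 n.+1 u v -> tau u = tau v by move=> /R1E; rewrite /tau => ->.
have tauI u v : tau u = tau v -> ar1 n.+1 n.+1 u v.
  move=> e; apply: (ar_trans lP1 (leqnn _)) (R1P u) _.
  by apply: (ar_trans lP1 (leqnn _)) (ar_refl lP1 _ e) (ar_sym lP1 (leqnn _) (R1P v)).
have [B0 B0P] := choice blk.
pose B i := B0 (p i).
pose idx a j := a * ell.+1 + j.
have idx_lt a j : a < ell -> j <= ell -> idx a j < ell * ell.+1.
  move=> ha hj; apply: (@leq_trans (a.+1 * ell.+1)); last by rewrite leq_mul2r ha orbT.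
  by rewrite mulSn addnC /idx ltn_add2l ltnS.
have idxI a j a' j' : j <= ell -> j' <= ell -> idx a j = idx a' j' -> a = a' /\ j = j'.
  move=> hj hj' e.
  have := congr1 (divn^~ ell.+1) e; have := congr1 (modn^~ ell.+1) e.
  by rewrite /idx !modnMDl !divnMDl// !divn_small ?ltnS// !addn0 !modn_small ?ltnS.
have BE i r : r < ell * ell.+1 -> E mu (p i) (B i r).
  by move=> hr; case: (B0P (p i)) => h _; exact: h.
have BI i r r' : r < ell * ell.+1 -> r' < ell * ell.+1 -> E mu1 (B i r) (B i r') -> r = r'.
  by move=> hr hr'; case: (B0P (p i)) => _; exact.
pose bidx u := idx (l n.+1 (R2 u)) 0.
have bidx_lt u : bidx u < ell * ell.+1 by apply: idx_lt.
(* The base point [y0] depends on [u] only through [tau u] and [R2 u]; points of atoms linked by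
   [P1 n] are all reached from the same [y0] by [E nu]-links, which gives [nx_rel]. *)
have zex u : exists y, [/\ E mu1 (B (tau u) (bidx u)) y, c nu' y = c nu' (z u) &
    exists y0, E nu y0 y /\ y0 = xget (z u0) [set y0 | E mu1 (B (tau u) (bidx u)) y0 /\ c nu' y0 = c nu' (z (R2 u))]].
  set y0 := xget _ _.
  have [h1 h2] : E mu1 (B (tau u) (bidx u)) y0 /\ c nu' y0 = c nu' (z (R2 u)).
    have [y e1 e2] := vis (B (tau u) (bidx u)) (z (R2 u)).
    exact: (@xgetI _ _ [set y0 | E mu1 (B (tau u) (bidx u)) y0 /\ c nu' y0 = c nu' (z (R2 u))] y).
  have [v lv pv] := R2P u.
  have zv : z v = z (R2 u) by apply: zl; exact: (ch_refine lP1 (leqnSn n)).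
  have [|y cy ey] := ch_lift cE lohi (ch_sym cE (zrel _ _ pv)) (x' := y0).
    by rewrite zv h2.
  exists y; split => //; last by exists y0.
  exact: (ch_trans cE) h1 (ch_mono cE numu1 ey).
have [z' z'P] := choice zex.
have z'c u : c nu' (z' u) = c nu' (z u) by case: (z'P u).
have z'B u : E mu1 (B (tau u) (bidx u)) (z' u) by case: (z'P u).
have z'p u : E mu (p (tau u)) (z' u).
  exact: (ch_trans cE) (BE _ _ (bidx_lt u)) (ch_mono cE mu1mu (z'B u)).
have z'E u v : ar1 n.+1 n u v -> E nu (z' u) (z' v).
  move=> uv; have eR : R2 u = R2 v by exact: R2E.
  have et : tau u = tau v by apply: tauE; exact: (ar_le lP1 (leqnn _) (leqnSn _) uv).
  have [_ _ [y [e1 ey]]] := z'P u; have [_ _ [y' [e2 ey']]] := z'P v.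
  have yy : y = y' by rewrite ey ey' /bidx et eR.
  by apply: (ch_trans cE) (ch_sym cE e1) _; rewrite yy.
have z'at u v : l n.+1 u = l n.+1 v -> z' u = z' v.
  move=> e; apply: (ch_inj cE (n := nu)); first by apply: z'E; exact: (ar_refl lP1).
  by apply: (ch_refine cE lohi); rewrite !z'c (zl u v)//; exact: (ch_refineS lP1).
have z'ar u v q : E nu q (z' u) -> E nu q (z' v) -> ar1 n.+1 n u v.
  move=> h1 h2; have e : E nu (z' u) (z' v) by exact: (ch_trans cE) (ch_sym cE h1) h2.
  have et : tau u = tau v.
    apply: pinj => //; apply: (ch_trans cE) (z'p u) _.
    by apply: (ch_trans cE) (ch_sym cE (z'p v)); apply: (ch_mono cE) e; exact: ltnW.
  have ei : bidx u = bidx v.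
    apply: (BI (tau u)) => //; apply: (ch_trans cE) (z'B u) _; rewrite et.
    by apply: (ch_trans cE) (ch_sym cE (z'B v)); apply: (ch_mono cE) e.
  have [el _] := idxI _ _ _ _ (leq0n _) (leq0n _) ei.
  apply: (ar_trans lP1 (leqnSn _)) (R2P u) _.
  apply: (ar_trans lP1 (leqnSn _)) (ar_refl lP1 _ el) (ar_sym lP1 (leqnSn _) (R2P v)).
(* [F] is the finite union of the hosting classes. Labels are first defined on [F], and [hat]
   transfers them to special points through [mu']-atoms. *)
have [F FP] : exists F : seq T, forall q, q \in F <-> exists2 i, i < ell & E mu (p i) q.
  have [C CP] := choice (fun i => let: ex_intro2 s _ h := class_seq cE cs mu (p i) in
    ex_intro (fun s : seq T => forall y, y \in s <-> E mu (p i) y) s h).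
  exists (flatten [seq C i | i <- iota 0 ell]) => q; split.
    move=> /flattenP[t /mapP[i]]; rewrite mem_iota => /andP[_ hi] -> /CP h.
    by exists i.
  move=> [i hi /CP h]; apply/flattenP; exists (C i) => //.
  by apply/mapP; exists i => //; rewrite mem_iota.
have FV q : q \in F -> ~ V q by move=> /FP[i hi]; exact: pfree.
have [mu' mumu' [Fsep Fav]] := ev_ex mu (evI (separate_seq cE cs F) (avoid_seq cE Vclosed FV)).
have z'F u : z' u \in F by apply/FP; exists (tau u).
have FE q q' : q \in F -> E mu q q' -> q' \in F.
  by move=> /FP[i hi e] e'; apply/FP; exists i => //; exact: (ch_trans cE) e e'.
pose hat x := xget (z u0) [set q | q \in F /\ c mu' q = c mu' x].
have hatE x q : q \in F -> c mu' q = c mu' x -> hat x = q.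
  move=> qF cq; apply: xget_unique => //= y [yF cy].
  by apply: Fsep => //; rewrite cy.
pose col q := exists u, E nu q (z' u).
pose cell q w := exists j, j <= ell /\ E mu1 (B (tau w) (idx (l n.+1 w) j)) q.
(* On a [nu]-class containing a new point the old label is refined along [P1 n]; elsewhere the label
   is the owner of the block, or outside the blocks any point with the right [tau]. *)
pose la' q := if pselect (col q) then
    xget u0 [set w | exists u, [/\ E nu q (z' u), P1 n u w & l n w = l n (la q)]]
  else xget (xget u0 [set w | E mu (p (tau w)) q]) [set w | E mu (p (tau w)) q /\ cell q w].
have la'_col q u : E nu q (z' u) ->
    exists w, [/\ P1 n u w, l n w = l n (la q) & l n.+1 w = l n.+1 (la' q)].
  move=> e.
  have [w lw pw] : ar1 n n u (la q).
    by apply: la1 e _; rewrite z'c.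
  exists w; split => //; rewrite /la'; case: pselect => [?|[]] /=; last by exists u.
  case: xgetP => [w2 _ [u2 [e2 pw2 lw2]]|/(_ w)[]]; last by exists u.
  have [u2' lu2 pu2] := z'ar _ _ _ e e2.
  have [w3 lw3 pw3] := ch_lift lP1 (leqnSn n) pw2 (esym lu2).
  rewrite -lw3; congr (l _); apply: (ar_uniq lP1 pw).
    exact: (ch_trans lP1) pu2 pw3.
  by rewrite lw (ch_refineS lP1 lw3).
have la'_tau q w0 : E mu (p (tau w0)) q -> ar1 n.+1 n.+1 w0 (la' q).
  move=> e; have [[u hu]|nc] := pselect (col q).
    have [w [pw _ lw]] := la'_col _ _ hu.
    have et : tau w0 = tau u.
      apply: pinj => //; apply: (ch_trans cE) e _.
      apply: (ch_trans cE) (ch_sym cE (z'p u)); apply: (ch_mono cE) hu; exact: ltnW.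
    apply: (ar_trans lP1 (leqnn _)) (tauI _ _ et) _.
    by exists w => //; exact: (ch_monoS lP1).
  rewrite /la'; case: pselect => //= _; apply: tauI; apply: pinj => //.
  apply: (ch_trans cE e); apply: (ch_sym cE).
  case: xgetP => [w _ []//|_].
  exact: (xgetI u0 (e : [set w | E mu (p (tau w)) q] w0)).
have la'_const q q' : E nu q q' -> ~ col q -> la' q = la' q'.
  move=> e nc; have nc' : ~ col q'.
    by move=> [u hu]; apply: nc; exists u; exact: (ch_trans cE) hu.
  have e1 : E mu1 q q' by exact: (ch_mono cE) e.
  have e2 : E mu q q' by exact: (ch_mono cE) e1.
  have sw (X Y : Prop) : (X <-> Y) -> X = Y by move=> h; exact/propext.
  have h1 w : E mu (p (tau w)) q = E mu (p (tau w)) q'.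
    by apply: sw; split => h; [exact: (ch_trans cE) h e2|exact: (ch_trans cE) h (ch_sym cE e2)].
  have h2 w : cell q w = cell q' w.
    apply: sw; split => -[j [hj h]]; exists j; split => //.
      exact: (ch_trans cE) h e1.
    exact: (ch_trans cE) h (ch_sym cE e1).
  rewrite /la'; case: pselect => //= _; case: pselect => //= _.
  congr (xget (xget _ _) _); apply/funext => w /=; first by rewrite h1.
  by rewrite h1 h2.
have la'_cell q w j : ~ col q -> j <= ell -> E mu1 (B (tau w) (idx (l n.+1 w) j)) q ->
    l n.+1 (la' q) = l n.+1 w.
  move=> nc hj e; rewrite /la'; case: pselect => //= _.
  have e' : E mu (p (tau w)) q.
    by apply: (ch_trans cE) (BE _ _ (idx_lt (l n.+1 w) j _ hj)) (ch_mono cE mu1mu e).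
  case: xgetP => [w2 _ [e2 [j2 [hj2 c2]]]|/(_ w)[]]; last by split => //; exists j.
  have et : tau w2 = tau w.
    by apply: pinj => //; apply: (ch_trans cE) e2 (ch_sym cE e').
  rewrite et in c2.
  have [] := idxI (l n.+1 w2) j2 (l n.+1 w) j hj2 hj => //.
  apply: (BI (tau w)); rewrite ?idx_lt//.
  exact: (ch_trans cE) c2 (ch_sym cE e).
pose S' := Stage mu mu' z' (la' \o hat).
have specialP x y u : E mu x y -> c mu' y = c mu' (z' u) ->
    [/\ hat x \in F, c mu' (hat x) = c mu' x & E mu (p (tau u)) (hat x)].
  move=> e cy; have [q cq eq] := ch_lift cE mumu' (ch_sym cE e) cy.
  have qF : q \in F by exact: FE eq.
  by rewrite (hatE x q)//; split => //; exact: (ch_trans cE) (z'p u) eq.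
have hat_rel x y : hat x \in F -> c mu' (hat x) = c mu' x -> E mu x y ->
    [/\ hat y \in F, c mu' (hat y) = c mu' y & E mu (hat x) (hat y)].
  move=> xF cx e; have [q cq eq] := ch_lift cE mumu' e (esym cx).
  have qF : q \in F by exact: FE eq.
  by rewrite (hatE y q).
have hat_nu x y : hat x \in F -> c mu' (hat x) = c mu' x -> E nu x y -> E nu (hat x) (hat y).
  move=> xF cx e.
  have [yF cy exy] := hat_rel _ _ xF cx (ch_mono cE (ltnW numu) e).
  apply: (ch_lift_eq cE _ e (esym cx) (ch_mono cE mumu' exy) (esym cy)).
  by apply: leq_trans mumu'; exact: ltnW.
exists S'; split.
  split => //=.
  - move=> u v pv; apply: (ch_trans cE) (ch_sym cE (z'p u)) _.
    by rewrite (tauE u v) ?z'p//; exists v.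
  - move=> u v y e cy; have yF := FE _ _ (z'F u) e.
    have ey : y = z' v by exact: Fsep.
    apply: tauI; apply: pinj => //; apply: (ch_trans cE) (z'p u) _.
    by apply: (ch_trans cE) (ch_sym cE (z'p v)); rewrite -ey.
  - move=> u v /Fsep e; have {}e := e (z'F u) (z'F v).
    have ln : l n u = l n v by apply: zinj; rewrite -!z'c e.
    have [v' lv pv] : ar1 n.+1 n u v by apply: (z'ar _ _ (z' u)); [|rewrite -e]; exact: (ch_refl cE).
    rewrite -lv; congr (l _); apply: (ch_inj lP1 pv).
    by rewrite (ch_refineS lP1 lv).
  - by move=> u y k e; apply: Fav; exact: FE (z'F u) e.
  - move=> x y e; congr la'; rewrite /hat.
    by rewrite e.
  - move=> x y u e cy; have [_ _ h] := specialP _ _ _ e cy.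
    exact: la'_tau.
  - move=> x u cx.
    rewrite (hatE x (z' u))//.
    have [w [pw lw lw']] := la'_col (z' u) u (ch_refl cE _ _).
    have [u' lu pu] : ar0 n n (la (z' u)) u.
      by apply: (ar_sym lP0 (leqnn n)); apply: la0; rewrite z'c.
    have [u2 lu2 pu2] := ch_lift lP0 (leqnn n) pu (esym lw).
    have eu : u = u2.
      apply: (ar_uniq lP1 (ch_refl lP1 n u)); last by rewrite lu2.
      exact: (ch_trans lP1) pw (P01 pu2).
    exists w => //; rewrite -?lw'//; apply: (ch_monoS lP0); apply: (ch_sym lP0); by rewrite eu.
split => //=.
- by move=> u v pv; apply: z'E; exists v.
- move=> x y [/= e lxy] [u [y' [e' cy']]].
  have [xF cx epx] := specialP _ _ _ e' cy'.
  have exy := hat_nu _ _ xF cx e.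
  have [yF cy _] := hat_rel _ _ xF cx (ch_mono cE (ltnW numu) e).
  have [[w hw]|nc] := pselect (col (hat x)); last first.
    by rewrite (la'_const _ _ exy nc); exact: (ar_refl lP0).
  have [a [pa la_ la__]] := la'_col _ _ hw.
  have [b [pb lb lb_]] := la'_col _ _ (ch_trans cE (ch_sym cE exy) hw).
  have lxe x0 : hat x0 \in F -> c mu' (hat x0) = c mu' x0 -> la (hat x0) = la x0.
    by move=> _ h; apply: lal; apply: (ch_refine cE) h; apply: leq_trans mumu'.
  have sp : special (Stage nu nu' z la) x.
    have [q cq eq] := ch_lift cE (leq_trans lohi (leq_trans nu'mu mumu')) (ch_sym cE (ch_sym cE hw)) cx.
    exists w, q; split => //=; rewrite -z'c; apply: (ch_refine cE) cq; exact: leq_trans mumu'.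
  have := lxy sp; rewrite /= -(lxe x)// -(lxe y)// => h0.
  have h1 : ar0 n n a b.
    apply: (ar_trans lP0 (leqnn _)) (ar_refl lP0 _ la_) _.
    exact: (ar_trans lP0 (leqnn _)) h0 (ar_refl lP0 _ (esym lb)).
  case: h1 => b' lb' pab'.
  have eb : b = b'.
    by apply: (ar_uniq lP1 pb); [exact: (ch_trans lP1) pa (P01 pab')|].
  apply: (ar_trans lP0 (leqnn _)) (ar_refl lP0 _ (esym la__)) _.
  apply: (ar_trans lP0 (leqnn _)) _ (ar_refl lP0 _ lb_).
  by exists b => //; apply: (ch_monoS lP0); rewrite eb.
- move=> x y e [u [y' [e' cy']]] nocol.
  have [xF cx epx] := specialP _ _ _ e' cy'.
  have exy := hat_nu _ _ xF cx e.
  rewrite (la'_const _ _ exy); first exact: (ar_refl lP0).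
  move=> [w hw]; have [q cq eq] := ch_lift cE (ltnW (leq_trans numu mumu')) hw cx.
  exact: nocol eq cq.
- exists ell; split => // x b [u [y' [e' cy']]].
  have [xF cx epx] := specialP _ _ _ e' cy'.
  set v := la' (hat x).
  have tv : tau v = tau u by apply/esym/tauE/la'_tau.
  (* One point in the [nu']-atom of [b] for each of the blocks [1] to [ell] owned by the label of
     [x]. These host no new point, so their labels lie in the atom of that label. *)
  have [Y YP] := choice (fun j => let: ex_intro2 y e h := vis (B (tau v) (idx (l n.+1 v) j.+1)) b in
    ex_intro (fun y => E mu1 (B (tau v) (idx (l n.+1 v) j.+1)) y /\ c nu' y = c nu' b) y (conj e h)).
  have YE j : j < ell -> E mu (p (tau v)) (Y j).
    move=> hj; apply: (ch_trans cE) (BE _ (idx (l n.+1 v) j.+1) _) (ch_mono cE mu1mu (proj1 (YP j))).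
    exact: idx_lt.
  have YF j : j < ell -> Y j \in F by move=> hj; apply/FP; exists (tau v) => //; exact: YE.
  have Ync j : j < ell -> ~ col (Y j).
    move=> hj [w hw].
    have et : tau w = tau v.
      apply: pinj => //; apply: (ch_trans cE) (z'p w) (ch_sym cE _).
      exact: (ch_trans cE) (YE _ hj) (ch_mono cE (ltnW numu) hw).
    have : bidx w = idx (l n.+1 v) j.+1.
      apply: (BI (tau v)) => //; first exact: idx_lt.
      rewrite -et; apply: (ch_trans cE) (z'B w) (ch_sym cE _); rewrite et.
      exact: (ch_trans cE) (proj1 (YP j)) (ch_mono cE numu1 hw).
    by move=> /(idxI _ _ _ _ (leq0n _) hj)[].
  have Yl j : j < ell -> l n.+1 (la' (Y j)) = l n.+1 v.
    by move=> hj; apply: (la'_cell _ _ j.+1) (proj1 (YP j)) => //; exact: Ync.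
  have Yx j : j < ell -> exists y, [/\ E mu x y, c mu' y = c mu' (Y j) & hat y = Y j].
    move=> hj; have eY : E mu (hat x) (Y j).
      apply: (ch_trans cE) (ch_sym cE epx) _; rewrite -tv; exact: YE.
    have [y cy ey] := ch_lift cE mumu' eY cx.
    by exists y; split => //; apply: hatE; [exact: YF|].
  have [W WP] : exists W : nat -> T, forall j, j < ell ->
      [/\ E mu x (W j), c mu' (W j) = c mu' (Y j) & hat (W j) = Y j].
    suff : forall j, exists y, j < ell -> [/\ E mu x y, c mu' y = c mu' (Y j) & hat y = Y j].
      by move=> /choice[W WP]; exists W.
    move=> j.
    have [hj|hj] := pselect (j < ell); last by exists x.
    by have [y hy] := Yx j hj; exists y.
  exists [seq W j | j <- iota 0 ell]; split.
  + rewrite map_inj_in_uniq ?iota_uniq// => j j'; rewrite !mem_iota /= => hj hj' e.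
    have [_ _ h1] := WP _ hj; have [_ _ h2] := WP _ hj'.
    have eY : Y j = Y j' by rewrite -h1 -h2 e.
    have : idx (l n.+1 v) j.+1 = idx (l n.+1 v) j'.+1.
      apply: (BI (tau v)); rewrite ?idx_lt//.
      apply: (ch_trans cE) (proj1 (YP j)) _; rewrite eY; exact: (ch_sym cE) (proj1 (YP j')).
    by move=> /(idxI _ _ _ _ hj hj')[_ []].
  + by rewrite size_map size_iota.
  + move=> y /mapP[j]; rewrite mem_iota /= => hj ->.
    have [h1 h2 h3] := WP _ hj; split.
      split => //= _; rewrite h3; apply: (ar_refl lP0); by rewrite Yl.
    rewrite -(proj2 (YP j)); apply: (ch_refine cE) h2; exact: leq_trans mumu'.
Qed.

Lemma stages : exists S : nat -> stageLT, forall n, good n (S n) /\ next n (S n) (S n.+1).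
Proof.
have [S0 gS0] := good0.
have ex n (S : {S | good n S}) : exists S' : {S | good n.+1 S}, next n (sval S) (sval S').
  by case: S => S gS; have [S' [gS' nS']] := step gS; exists (exist _ S' gS').
pose nx n (s : {S | good n S}) := sval (cid (ex n s)).
pose sq := fix sq n : {S | good n S} := if n is n'.+1 then nx n' (sq n') else exist _ S0 gS0.
exists (fun n => sval (sq n)) => n; split; first exact: (svalP (sq n)).
exact: (svalP (cid (ex n (sq n)))).
Qed.

Record broken_chain (a b : nat -> nat) (D : nat -> T -> T -> Prop) (f : L -> T) : Prop := BrokenChain {
  bc_le : forall n, n <= a n <= b n;
  bc_bS : forall n, b n <= b n.+1;
  bc_chain : chain (fun n => c (b n)) D;
  bc_sub : forall n x y, D n x y -> E (a n) x y;
  bc_emb : embedding l P0 (fun n => c (b n)) D f;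
  bc_small : small (fun n => c (b n)) D f;
  bc_avoid : forall n v y, V v -> E (a n) v y -> D n v y;
  bc_disj : forall n u v z, V v -> E (a n) (f u) z -> c (b n) z <> c (b n) v;
  bc_rel : forall n u v, P1 n u v -> E (a n) (f u) (f v);
  bc_join : forall n x y, E (a n) x y -> (exists m, D m x y) \/
    exists u v, [/\ D n x (f u), D n y (f v) & P1 n u v] }.

(** The copy is the limit [f] of the points [pt]. For [bc_join], the class of a link that never
    enters [D] fails to heal at every level, hence meets atoms of new points at all levels; this
    produces a point of the copy in the class. *)
Theorem breaking : exists a b D f, broken_chain a b D f.
Proof.
have [S HS] := stages.
have g n : good n (S n) by case: (HS n).
have nx n : next n (S n) (S n.+1) by case: (HS n).
pose a n := lo (S n); pose b n := hi (S n); pose Z n := pt (S n).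
pose ct n := c (b n); pose Et n := E (a n).
have ab n : a n <= b n by exact: gd_lohi (g n).
have ba n : b n <= a n.+1 by exact: nx_hi (nx n).
have aS n : a n < a n.+1 by exact: nx_lo (nx n).
have na n : n <= a n by elim: n => // n IH; exact: leq_ltn_trans IH (aS n).
have bS n : b n <= b n.+1 by exact: leq_trans (ba n) (ab _).
have ble n m : n <= m -> b n <= b m.
  move=> /subnK <-; elim: (m - n) => // k IH; exact: leq_trans IH (bS _).
have ale n m : n <= m -> a n <= a m.
  move=> /subnK <-; elim: (m - n) => // k IH; exact: leq_trans IH (ltnW (aS _)).
have cEt : chain ct Et.
  split => [n x y|n|n|n|n x y|n x y|n m x y x' nm].
  - exact: (ch_refine cE).
  - exact: (ch_refl cE).
  - exact: (ch_sym cE).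
  - exact: (ch_trans cE).
  - by apply: (ch_mono cE); exact: ltnW.
  - by move=> e /(ch_refine cE (ab n)); exact: (ch_inj cE).
  - by apply: (ch_lift cE); apply: leq_trans (ab m); exact: ale.
have sep x y n : (forall m, n <= m -> ct m x = ct m y) -> x = y.
  move=> h; apply: (sp_sep cs) => m; apply: (ch_refine cE (m := b (maxn n m))).
    apply: leq_trans (leq_maxr n m) _; exact: leq_trans (na _) (ab _).
  by apply: h; exact: leq_maxl.
have Zm n m u : n <= m -> ct n (Z m u) = ct n (Z n u).
  move=> /subnK <-; elim: (m - n) => // k IH; rewrite addSn -IH.
  by apply: (ch_refine cE (ble _ _ (leq_addl k n))); exact: (nx_pt (nx _)).
have fex u : exists x, forall n, ct n x = ct n (Z n u).
  have nb n : n <= b n by exact: leq_trans (ab n).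
  have [|x xP] := sp_lim cs (u := fun n => Z n u).
    by move=> n; apply: (ch_refine cE (nb n)); exact: Zm.
  by exists x => n; rewrite /ct xP; exact: Zm.
have [f fZ] := choice fex.
have fP1 n u v : P1 n u v -> Et n (f u) (f v).
  move=> puv.
  have ZE m : n <= m -> Et n (Z m u) (Z m v).
    move=> /subnK <-; elim: (m - n) => [|k IH]; first exact: (gd_rel (g n)).
    rewrite addSn; apply: (ch_lift_eq cEt (leq_addl k n)) IH _ (nx_rel (nx _) _) _.
    - by rewrite Zm.
    - by apply: (ch_mono lP1) puv; exact: leq_addl.
    - by rewrite Zm.
  (* The [Et n]-class of [f u] has a point in the [m]-atom of [f v] for every [m]; by [ch_inj] it is
     always the same point, so it is [f v]. *)
  have key m : n <= m -> exists2 y, ct m y = ct m (f v) & Et n (f u) y.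
    by move=> nm; rewrite fZ; apply: (ch_lift cEt nm (ZE _ nm)); rewrite fZ.
  have [y cy ey] := key n (leqnn _).
  suff <- : y = f v by [].
  apply: (sep _ _ n) => m nm; have [y' cy' ey'] := key m nm.
  suff -> : y = y' by [].
  apply: (ch_inj cEt (n := n)); first exact: (ch_trans cEt) (ch_sym cEt ey) ey'.
  by rewrite cy; exact/esym/(ch_refine cE (ble _ _ nm)).
have fet n u v y : Et n (f u) y -> ct n y = ct n (f v) ->
    exists v', [/\ l n v' = l n v, P1 n u v' & y = f v'].
  move=> e cy; have [y' cy' ey'] := ch_lift cEt (leqnn n) e (fZ u n).
  have [v' lv' pv'] : ar1 n n u v.
    by apply: (gd_refl (g n) ey'); rewrite -[LHS]/(ct n y') cy' cy fZ.
  exists v'; split => //; apply: (ch_inj cEt (n := n)).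
    exact: (ch_trans cEt) (ch_sym cEt e) (fP1 _ _ _ pv').
  by rewrite cy !fZ /Z (gd_pt (g n) lv').
have fl n u v : ct n (f u) = ct n (f v) -> l n u = l n v.
  by rewrite !fZ; exact: (gd_inj (g n)).
have finj : injective f.
  by move=> u v e; apply: (sp_sep ls) => n; apply: fl; rewrite e.
have fP1r n u v : Et n (f u) (f v) -> P1 n u v.
  by move=> /fet/(_ erefl)[v' [_ pv /finj ->]].
have flbl n u : ar0 n n u (lbl (S n) (f u)) by apply: (gd_lbl0 (g n)); exact: fZ.
pose D n := broken n (S n).
have spE n x y : Et n x y -> special (S n) x -> special (S n) y.
  move=> e [u [w [ew cw]]]; exists u, w; split => //.
  exact: (ch_trans cE) (ch_sym cE e) ew.
have spat n x y : ct n x = ct n y -> special (S n) x -> special (S n) y.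
  move=> e [u [w [ew cw]]]; have [w' cw' ew'] := ch_lift cE (ab n) ew e.
  by exists u, w'; rewrite cw'.
have spf n u : special (S n) (f u).
  by exists u, (f u); split; [exact: (ch_refl cE)|exact: fZ].
have fD n u v : D n (f u) (f v) <-> P0 n u v.
  split.
    move=> [e /(_ (spf n u)) h].
    have [v' lv pv] : ar0 n n u v.
      apply: (ar_trans lP0 (leqnn n)) (flbl n u) _.
      exact: (ar_trans lP0 (leqnn n)) h (ar_sym lP0 (leqnn n) (flbl n v)).
    by rewrite (ar_uniq lP1 (fP1r _ _ _ e) (P01 pv)).
  move=> p; split; first exact: fP1 (P01 p).
  move=> _; apply: (ar_trans lP0 (leqnn n)) (ar_sym lP0 (leqnn n) (flbl n u)) _.
  exact: (ar_trans lP0 (leqnn n)) (ar_rel n p) (flbl n v).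
have cD : chain ct D.
  split.
  - exact: (ch_refineS cEt).
  - by move=> n x; split; [exact: (ch_refl cE)|move=> _; exact: (ar_refl lP0)].
  - move=> n x y [e h]; split; first exact: (ch_sym cE).
    by move=> /(spE _ _ _ (ch_sym cE e))/h; exact: (ar_sym lP0 (leqnn n)).
  - move=> n x y z [e h] [e' h']; split; first exact: (ch_trans cE) e e'.
    by move=> sx; apply: (ar_trans lP0 (leqnn n)) (h sx) (h' (spE _ _ _ e sx)).
  - move=> n x y d; split; first exact: (ch_monoS cEt) (proj1 d).
    exact: (nx_broken (nx n)).
  - by move=> n x y [e _]; exact: (ch_inj cEt).
  - move=> n m x y x' nm [e h] cx; have [y' cy ey] := ch_lift cEt nm e cx.
    exists y' => //; split => // sx.
    have cxn := ch_refine cE (ble _ _ nm) cx; have cyn := ch_refine cE (ble _ _ nm) cy.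
    rewrite -(gd_lbl (g n) cxn) (gd_lbl (g n) cyn); apply: h.
    exact: spat (esym cxn) sx.
exists a, b, D, f; split.
- by move=> n; rewrite na ab.
- exact: bS.
- exact: cD.
- by move=> n x y [].
- split.
  + exact: finj.
  + move=> n; exists n => m nm u v lu; rewrite -[LHS]/(ct n (f u)) -[RHS]/(ct n (f v)) !fZ /Z.
    by rewrite (gd_pt (g n) (u := u) (v := v))//; exact: (ch_refine lP1 nm).
  + move=> n; exists n => m nm u v /(ch_refine cE (ble _ _ nm)); exact: fl.
  + by move=> n; exists n => m nm u v /(ch_mono lP0 nm)/fD.
  + by move=> n; exists n => m nm u v /fD/(ch_mono lP0 nm).
  + move=> n; exists n => m nm u v y [e _] cy.
    by have [v' [_ _ ->]] := fet _ _ v _ e (ch_refine cE (ble _ _ nm) cy); exists v'.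
- move=> j; exists j.+1 => [[//|n]] jn x0 x s us sP.
  case: s us sP => [|y0 s] us sP; first by exists [::].
  have sx : special (S n.+1) x.
    have [[e _] [u eu]] := sP _ (mem_head _ _).
    by apply: spE (ch_sym cE e) _; rewrite eu.
  have [N [lN rich]] := nx_rich (nx n).
  have [s' [us' szs' s'P]] := rich x x0 sx.
  exists s'; split => //; last first.
    by move=> y /s'P[h1 h2]; split => //; apply: (ch_refine cE) h2; exact: ble.
  apply: leq_trans szs'; rewrite -[N](size_iota 0).
  have [U UP] : exists U : T -> L, forall y, y \in y0 :: s -> y = f (U y).
    suff : forall y, exists u, y \in y0 :: s -> y = f u by move=> /choice[U UP]; exists U.
    move=> y; have [/sP[_ [u ->]]|ny] := pselect (y \in y0 :: s); first by exists u.
    by have [_ [u _]] := sP _ (mem_head _ _); exists u.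
  rewrite -(size_map (fun y => l n.+1 (U y))); apply: uniq_leq_size.
    rewrite map_inj_in_uniq// => y y' hy hy' e.
    have [[h1 _] _] := sP _ hy; have [[h2 _] _] := sP _ hy'.
    apply: (ch_inj cEt (n := n.+1)); first exact: (ch_trans cE) (ch_sym cE h1) h2.
    by rewrite (UP _ hy) (UP _ hy') -/ct !fZ /Z (gd_pt (g n.+1) e).
  by move=> y /mapP[y' _ ->]; rewrite mem_iota add0n lN.
- move=> n v y Vv e; split => // [[u [w [ew cw]]]].
  have [y' cy' ey'] := ch_lift cE (ab n) (ch_sym cE ew) cw.
  by case: (gd_avoid (g n) ey' Vv).
- move=> n u v w Vv e cw; have [y cy ey] := ch_lift cEt (leqnn n) e (fZ u n).
  by apply: (gd_avoid (g n) ey Vv); rewrite -cw.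
- exact: fP1.
- move=> n x y e.
  have [[m [nm Dm]]|nD] := pselect (exists m, n <= m /\ D m x y); first by left; exists m.
  right.
  have col m : n <= m -> exists u w, Et m x w /\ ct m.+1 w = ct m.+1 (Z m.+1 u).
    move=> nm; apply: contrapT => ncol; apply: nD; exists m.+1; split; first exact: leqW.
    have em : Et m x y by exact: (ch_mono cEt) e.
    split; first exact: (ch_monoS cEt) em.
    move=> sx; apply: (nx_heal (nx m) em sx) => u w ew cw.
    by apply: ncol; exists u, w.
  have [u1 [w1 [ew1 cw1]]] := col n (leqnn _).
  (* The point [w1] found at level [n] works at all levels: at level [q] some [w2] in the class is
     close to the copy; [gd_refl] and [nx_rel] lead from it to a point close to the copy in the
     [q]-atom of [w1], and [ch_inj] identifies that point with [w1]. *)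
  have hit m : n <= m -> exists u, ct m.+1 w1 = ct m.+1 (Z m.+1 u).
    move=> /subnK <-; elim: (m - n) => [|k [u cu]]; first by exists u1.
    rewrite addSn; set q := (k + n).+1 in cu *.
    have nq : n <= q by rewrite leqW// leq_addl.
    have [u2 [w2 [ew2 cw2]]] := col q nq.
    have ew12 : Et q w1 w2.
      exact: (ch_trans cE) (ch_mono cEt nq (ch_sym cE ew1)) ew2.
    have cw2q : ct q w2 = ct q (Z q u2).
      by rewrite -(Zm q q.+1 u2 (leqnSn _)); apply: (ch_refine cE (bS q)).
    have [y' cy' ey'] := ch_lift cEt (leqnn q) ew12 cu.
    have [u' lu' pu'] : ar1 q q u2 u.
      by apply: (ar_sym lP1 (leqnn q)); apply: (gd_refl (g q) ey'); rewrite -[LHS]/(ct q y') cy'.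
    have [y2 cy2 ey2] := ch_lift cE (leq_trans (ltnW (aS q)) (ab q.+1)) (nx_rel (nx q) pu') (esym cw2).
    exists u'; suff -> : w1 = y2 by [].
    apply: (ch_inj cEt (n := q)); first exact: (ch_trans cE) ew12 ey2.
    have -> : ct q y2 = ct q (Z q.+1 u') by exact: (ch_refine cE (bS q) cy2).
    rewrite cu (Zm _ _ _ (leqnSn q)).
    by rewrite /Z (gd_pt (g q) lu').
  have hit' k : exists u, ct k w1 = ct k (Z k u).
    have [u cu] := hit (maxn n k) (leq_maxl _ _); exists u.
    have km : k <= (maxn n k).+1 by rewrite leqW// leq_maxr.
    by rewrite -(Zm k _ u km); exact: (ch_refine cE (ble _ _ km)).
  have [U UP] := choice hit'.
  have [|u uP] := sp_lim ls (u := U).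
    move=> k; apply: (gd_inj (g k)); rewrite -[LHS]/(ct k (Z k (U k.+1))) -[RHS]/(ct k (Z k (U k))).
    rewrite -UP -(Zm k k.+1 _ (leqnSn _)).
    exact/esym/(ch_refine cE (bS k) (UP k.+1)).
  (* The class thus contains the point [f u]. By [gd_lbl1] the label of any [x'] in it is, up to
     atoms, some [v] with [P1 n u v], and then [x'] is [D n]-linked to [f v]. *)
  have fw : f u = w1.
    by apply: (sep _ _ 0) => k _; rewrite fZ UP /Z (gd_pt (g k) (uP k)).
  have conn x' : Et n x' (f u) -> exists2 v, P1 n u v & D n x' (f v).
    move=> ex'; have [v lv pv] := gd_lbl1 (g n) ex' (fZ u n).
    exists v => //; split; first exact: (ch_trans cE) ex' (fP1 _ _ _ pv).
    move=> _; apply: (ar_trans lP0 (leqnn n)) (ar_refl lP0 _ (esym lv)) (flbl n v).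
  have [v pv dv] : exists2 v, P1 n u v & D n x (f v) by apply: conn; rewrite fw.
  have [v' pv' dv'] : exists2 v, P1 n u v & D n y (f v).
    by apply: conn; rewrite fw; exact: (ch_trans cE) (ch_sym cE e) ew1.
  by exists v, v'; split => //; exact: (ch_trans lP1) (ch_sym lP1 pv) pv'.
Qed.
End Breaking.

(** * Absorption for chains *)

Lemma separated_sub (T : Type) (c : nat -> T -> nat) (b : nat -> nat) :
  (forall n x y, c n.+1 x = c n.+1 y -> c n x = c n y) ->
  (forall n, n <= b n) -> (forall n, b n <= b n.+1) ->
  separated c -> separated (fun n => c (b n)).
Proof.
move=> cS nb bS cs.
have cle n m x y : n <= m -> c m x = c m y -> c n x = c n y.
  by move=> /subnK <-; elim: (m - n) => // k IH; rewrite addSn => /cS/IH.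
split.
- by move=> n; exact: (sp_fin cs).
- by move=> x y h; apply: (sp_sep cs) => n; exact: cle (h n).
- move=> u uS.
  have [|x xP] := sp_lim cs (u := u).
    by move=> n; apply: cle (uS n).
  have stab n m : n <= m -> c (b n) (u m) = c (b n) (u n).
    move=> /subnK <-; elim: (m - n) => // k IH.
    rewrite addSn -IH; apply: cle (uS _); have : n <= k + n by exact: leq_addl.
    by move=> /subnK <-; elim: (k + n - n) => // j IH'; exact: leq_trans IH' (bS _).
  by exists x => n; rewrite xP stab.
Qed.

(* The space [N* x K], where [N*] is the one-point compactification of [nat] with [None]
   at infinity; at level [n] the indices [>= n] are not distinguished. *)
Section Copies.
Context {K : choiceType}.

Definition trunc n (i : option nat) := if i is Some j then minn j n else n.

(** Division by [n.+1] recovers both components, as [trunc n] is at most [n]. *)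
Definition copies_at (k : nat -> K -> nat) n (u : option nat * K) :=
  k n u.2 * n.+1 + trunc n u.1.

Definition copies_rel (P : nat -> K -> K -> Prop) n (u v : option nat * K) :=
  u.1 = v.1 /\ P n u.2 v.2.

Definition ipred (i : option nat) := if i is Some j then Some j.-1 else None.
Definition isucc (i : option nat) := if i is Some j then Some j.+1 else None.

Lemma trunc_pred n i : i != Some 0 -> trunc n.+1 i = (trunc n (ipred i)).+1.
Proof. by case: i => [[|j]|] //= _; rewrite minnSS. Qed.

Lemma trunc_le n i : trunc n i <= n.
Proof. by case: i => [j|] //=; rewrite geq_minr. Qed.

Lemma trunc_min n m i : n <= m -> trunc n i = minn (trunc m i) n.
Proof.
by case: i => [j|] /= nm; [rewrite -minnA (minn_idPr nm)|rewrite (minn_idPr nm)].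
Qed.

Lemma copies_atP k n u v : copies_at k n u = copies_at k n v <->
  k n u.2 = k n v.2 /\ trunc n u.1 = trunc n v.1.
Proof.
split=> [e|[h1 h2]]; last by rewrite /copies_at h1 h2.
have := congr1 (divn^~ n.+1) e; have := congr1 (modn^~ n.+1) e.
by rewrite /copies_at !modnMDl !divnMDl// !divn_small ?ltnS ?trunc_le// !addn0 !modn_small ?ltnS ?trunc_le.
Qed.

Lemma copies_chain k P : chain k P -> chain (copies_at k) (copies_rel P).
Proof.
move=> kP; split.
- move=> n u v /copies_atP[h1 h2]; apply/copies_atP; split; first exact: (ch_refineS kP).
  by rewrite !(trunc_min _ (leqnSn n)) h2.
- by move=> n u; split; last exact: (ch_refl kP).
- by move=> n u v [h1 h2]; split; last exact: (ch_sym kP).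
- by move=> n u v w [h1 h2] [h3 h4]; split; [rewrite h1|exact: (ch_trans kP) h2 h4].
- by move=> n u v [h1 h2]; split; last exact: (ch_monoS kP).
- move=> n [i x] [j y] [/= -> h] /copies_atP[/= e _].
  by rewrite (ch_inj kP h e).
- move=> n m u v [i' x'] nm [h1 h2] /copies_atP[/= e1 e2].
  have [y' cy ey] := ch_lift kP nm h2 e1.
  by exists (i', y') => //; apply/copies_atP; split => //=; rewrite -h1.
Qed.

Lemma copies_separated k : separated k -> separated (copies_at k).
Proof.
move=> ks; split.
- move=> n; have [N HN] := sp_fin ks n; exists (N * n.+1) => u.
  apply: (@leq_trans ((k n u.2).+1 * n.+1)); last by rewrite leq_mul2r HN orbT.
  by rewrite mulSn addnC /copies_at ltn_add2l ltnS trunc_le.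
- move=> [i x] [j y] h; congr pair; last first.
    by apply: (sp_sep ks) => n; have /copies_atP[] := h n.
  have tr n : trunc n i = trunc n j by have /copies_atP[] := h n.
  case: i j {h} tr => [i|] [j|] //= tr.
  + by have := tr (maxn i j); rewrite (minn_idPl (leq_maxl _ _)) (minn_idPl (leq_maxr _ _)) => ->.
  + by have := tr i.+1; rewrite (minn_idPl (leqnSn _)) => /eqP; rewrite -[_ == _]/(i == i.+1) ltn_eqF.
  + by have := tr j.+1; rewrite (minn_idPl (leqnSn _)) => /esym/eqP; rewrite ltn_eqF.
- move=> u uS.
  have [|x xP] := sp_lim ks (u := fun n => (u n).2).
    by move=> n; have /copies_atP[] := uS n.
  pose t n := trunc n (u n).1.
  have tS n : t n = minn (t n.+1) n.
    by rewrite /t -(trunc_min _ (leqnSn n)); have /copies_atP[_ ->] := uS n.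
  have tm n m : n <= m -> t n = minn (t m) n.
    move=> /subnK <-; elim: (m - n) => [|d IH].
      by apply/esym/minn_idPl; exact: trunc_le.
    by rewrite addSn IH tS -minnA (minn_idPr (leq_addl _ _)).
  suff [i iP] : exists i, forall n, trunc n i = t n.
    by exists (i, x) => n; apply/copies_atP; split.
  (* A truncated index below its cut-off is final; if this never happens the limit index is
     infinity. *)
  have [[N tN]|ht] := pselect (exists N, t N < N); last first.
    exists None => n /=; apply/eqP; rewrite eqn_leq trunc_le andbT leqNgt.
    by apply/negP => h; apply: ht; exists n.
  exists (Some (t N)) => n /=.
  have [nN|/ltnW Nn] := leqP n N; first by rewrite -tm.
  have e := tm _ _ Nn.
  have tnN : t n < N.
    by rewrite ltnNge; apply/negP => h; move: tN; rewrite e (minn_idPr h) ltnn.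
  by rewrite {1}e (minn_idPl (ltnW tnN)) (minn_idPl (trunc_le _ _)).
Qed.

End Copies.

(** The enlarged relation is not named: the last clause of the conclusion quantifies over all
    symmetric and transitive [S] containing [E] and the [P1]-links on the image of [i]. *)
Theorem chain_absorption (T K : choiceType) (c : nat -> T -> nat) (E : nat -> T -> T -> Prop)
    (k : nat -> K -> nat) (P0 P1 : nat -> K -> K -> Prop) (i : K -> T) (x0 : K) :
  chain c E -> separated c ->
  (forall n, exists m, forall x z, exists2 y, E m x y & c n y = c n z) ->
  (forall n x, exists2 y, y <> x & c n y = c n x) ->
  chain k P0 -> chain k P1 -> separated k ->
  (forall n u v, P0 n u v -> P1 n u v) ->
  (forall u v, k 0 u = k 0 v) ->
  embedding k P0 c E i -> small c E i ->
  (forall x, (forall n, exists y, c n (i y) = c n x) -> exists y, x = i y) ->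
  exists h h' : T -> T, [/\ cancel h h', cancel h' h,
    (forall n, exists m, forall x y, c m x = c m y -> c n (h x) = c n (h y)) /\
    (forall n, exists m, forall x y, c m x = c m y -> c n (h' x) = c n (h' y)),
    (forall n x y, E n x y -> exists m, E m (h x) (h y)) /\
    (forall n u v, P1 n u v -> exists m, E m (h (i u)) (h (i v))) &
    forall S : T -> T -> Prop, (forall x y, S x y -> S y x) ->
      (forall x y z, S x y -> S y z -> S x z) ->
      (forall n x y, E n x y -> S x y) -> (forall n u v, P1 n u v -> S (i u) (i v)) ->
      forall n x y, E n (h x) (h y) -> S x y].
Proof.
move=> cE cs minimal perfect kP0 kP1 ks P01 k0 ei si icl.
pose V x := exists u, x = i u.
have Vcl x : (forall n, exists2 y, V y & c n y = c n x) -> V x.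
  by move=> h; apply: icl => n; have [_ [u ->] cu] := h n; exists u.
have sV : small c E (fun v : {x | V x} => sval v).
  move=> j; have [N HN] := si j; exists N => q Nq b x s us sP.
  apply: (HN q Nq b x s us) => y /sP[h1 [[w [u ew]] ew']].
  by split => //; exists u; rewrite ew'.
have Vfree m : exists w, forall y, E m w y -> ~ V y.
  exact: (small_free cE cs minimal perfect (i x0) m sV).
have lP0 := copies_chain kP0; have lP1 := copies_chain kP1.
have ls := copies_separated ks.
have l01 n u v : copies_rel P0 n u v -> copies_rel P1 n u v.
  by move=> [h1 /P01 h2].
have l0 u v : copies_at k 0 u = copies_at k 0 v.
  apply/copies_atP; split; first exact: k0.
  have tr0 j : trunc 0 j = 0 by apply/eqP; rewrite -leqn0 trunc_le.
  by rewrite !tr0.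
have [a [b [D [f [le bS cD sub emb sm avoid disj frel join]]]]] :=
  breaking cE cs minimal perfect lP0 lP1 ls l01 l0 (None, x0) Vcl Vfree.
have nb n : n <= b n by have /andP[h1 h2] := le n; exact: leq_trans h2.
have na n : n <= a n by have /andP[] := le n.
have cs' : separated (fun n => c (b n)).
  by apply: separated_sub => //; exact: (ch_refineS cE).
pose pr (u : option nat * K) := (ipred u.1, u.2).
pose sh (u : option nat * K) := (isucc u.1, u.2).
(* [g] gives index 0 to [K] and index [j.+1] to copy [j], infinity staying fixed; extending the
   partial conjugacy from [g] to [f] therefore performs the shift. *)
pose g (u : option nat * K) := if u.1 == Some 0 then i u.2 else f (pr u).
have gsh u : g (sh u) = f u by case: u => [[[|j]|] x].
have gV u : u.1 = Some 0 -> g u = i u.2 by move=> e; rewrite /g e eqxx.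
have gF u : u.1 != Some 0 -> g u = f (pr u) by rewrite /g => /negbTE ->.
have iV x : V (i x) by exists x.
have ctle n m x y : n <= m -> c (b m) x = c (b m) y -> c (b n) x = c (b n) y.
  move=> nm; apply: (ch_refine cE); elim: m nm => [|m IH]; first by rewrite leqn0 => /eqP ->.
  by rewrite leq_eqVlt => /orP[/eqP <- //|]; rewrite ltnS => /IH h; exact: leq_trans (bS _).
have linkF n x u : ~ E (a n) (f u) (i x) by move=> h; exact: (disj _ _ _ _ (iV x) h).
have trS n u v : trunc n (pr u).1 = trunc n (pr v).1 -> u.1 != Some 0 -> v.1 != Some 0 ->
    trunc n u.1 = trunc n v.1.
  move=> e hu hv; rewrite (trunc_min _ (leqnSn n)) (trunc_min v.1 (leqnSn n)).
  by rewrite !trunc_pred// e.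
have eg : embedding (copies_at k) (copies_rel P0) (fun n => c (b n)) D g.
  split.
  - move=> u v; case: (eqVneq u.1 (Some 0)) => hu; case: (eqVneq v.1 (Some 0)) => hv.
    + by rewrite !gV// => /(em_inj ei) e; case: u v hu hv e => [? ?] [? ?] /= -> -> ->.
    + rewrite gV// gF// => e; case: (@linkF 0 u.2 (pr v)); rewrite e; exact: (ch_refl cE).
    + rewrite gF// gV// => e; case: (@linkF 0 v.2 (pr u)); rewrite e; exact: (ch_refl cE).
    + rewrite !gF// => /(em_inj emb).
      case: u v hu hv => [[[|ju]|] x] [[[|jv]|] y] //= _ _; by case=> -> ->.
  - move=> n.
    have [M HM] := evI (em_cont ei (b n)) (em_cont emb n).
    exists M.+1 => m Mm u v /copies_atP[ek et].
    have ek' := ch_refine kP0 (ltnW Mm) ek.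
    have et' : trunc M.+1 u.1 = trunc M.+1 v.1 by rewrite !(trunc_min _ Mm) et.
    have [HM1 HM2] := HM M (leqnn _).
    case: (eqVneq u.1 (Some 0)) => hu; case: (eqVneq v.1 (Some 0)) => hv.
    + by rewrite !gV//; exact: HM1.
    + by move: et'; rewrite (trunc_pred _ hv) hu.
    + by move: et'; rewrite (trunc_pred _ hu) hv.
    + rewrite !gF//; apply: HM2; apply/copies_atP; split => //.
      by move: et'; rewrite !trunc_pred// => -[].
  - move=> n.
    have [M HM] := evI (em_open ei n) (em_open emb n).
    exists M => m Mm u v e; have [H1 H2] := HM _ Mm; apply/copies_atP.
    case: (eqVneq u.1 (Some 0)) => hu; case: (eqVneq v.1 (Some 0)) => hv; move: e.
    + rewrite !gV// => e; split; last by rewrite hu hv.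
      by apply: H1; apply: (ch_refine cE) e; exact: leq_trans (nb _).
    + rewrite gV// gF// => e; case: (disj m (pr v) (i u.2) _ (iV _) (ch_refl cE _ _)).
      by rewrite e.
    + rewrite gF// gV// => e; case: (disj m (pr u) (i v.2) _ (iV _) (ch_refl cE _ _)).
      by rewrite e.
    + by rewrite !gF// => /H2/copies_atP[h1 h2]; split => //; exact: trS.
  - move=> n.
    have [M HM] := evI (em_rel ei n) (em_rel emb n).
    exists M => m Mm u v [uv puv]; have [H1 H2] := HM _ Mm.
    case: (eqVneq u.1 (Some 0)) => hu.
      rewrite !gV -?uv//; apply: avoid => //; apply: (ch_mono cE (na m)); exact: H1.
    rewrite !gF -?uv//; apply: H2; split => //=; by rewrite uv.
  - move=> n.
    have [M HM] := evI (em_refl ei (a n)) (em_refl emb n).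
    exists M => m Mm u v e; have [H1 H2] := HM _ Mm; move: e.
    case: (eqVneq u.1 (Some 0)) => hu; case: (eqVneq v.1 (Some 0)) => hv.
    + by rewrite !gV// => /sub/H1 h; split => //; rewrite hu hv.
    + by rewrite gV// gF// => /sub/(ch_sym cE)/linkF.
    + by rewrite gF// gV// => /sub/linkF.
    + rewrite !gF// => /H2[/= h1 h2]; split => //.
      by case: u v hu hv h1 {h2} => [[[|ju]|] x] [[[|jv]|] y] //= _ _ [->].
  - move=> n.
    have [M HM] := evI (evI (em_etale ei (a n)) (em_etale emb n)) (ev_ge n).
    exists M => m Mm u v y e cy; have [[H1 H2] nm] := HM _ Mm; move: e cy.
    case: (eqVneq u.1 (Some 0)) => hu; case: (eqVneq v.1 (Some 0)) => hv.
    + rewrite !gV// => /sub e cy.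
      have [w ->] := H1 _ _ _ e (ch_refine cE (nb m) cy).
      by exists (Some 0, w); rewrite gV.
    + rewrite gV// gF// => /sub/(ch_sym cE) e cy.
      have anm : a n <= b m.
        apply: leq_trans (_ : b n <= _); first by have /andP[] := le n.
        by elim: m nm {Mm H1 H2 cy HM} => [|m IH]; [rewrite leqn0 => /eqP ->|
          rewrite leq_eqVlt => /orP[/eqP <-//|]; rewrite ltnS => /IH h; exact: leq_trans (bS _)].
      have [w cw ew] := ch_lift cE anm e cy.
      by case: (disj n (pr v) (i u.2) w (iV _) ew); exact: ctle nm cw.
    + rewrite gF// gV// => /sub e cy.
      by case: (disj n (pr u) (i v.2) y (iV _) e); exact: ctle nm cy.
    + rewrite !gF// => e cy; have [w ->] := H2 _ _ _ e cy.
      by exists (sh w); rewrite gsh.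
(* By [bc_disj] a class of [D] cannot meet both [K] and the copies; on [K], [bc_avoid] turns
   smallness for [E] into smallness for [D]. *)
have sg : small (fun n => c (b n)) D g.
  move=> j; have [N HN] := evI (si (b j)) (sm j).
  exists N => q Nq b0 x s us sP.
  have [H1 _] := HN (a q) (leq_trans Nq (na q)); have [_ H2] := HN q Nq.
  case: s us sP => [|y0 s] us sP; first by exists [::].
  have [e0 [u eu]] := sP y0 (mem_head _ _).
  case: (eqVneq u.1 (Some 0)) => hu; last first.
    apply: (H2 b0 x _ us) => y ys; have [e [v ev]] := sP y ys; split => //.
    case: (eqVneq v.1 (Some 0)) => hv; last by exists (pr v); rewrite ev gF.
    have := ch_trans cD (ch_sym cD e0) e; rewrite eu ev gF// gV// => /sub.
    by move/linkF.
  have Vy0 : V y0 by rewrite eu gV.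
  have [|s' [us' sz s'P]] := H1 b0 y0 _ us.
    move=> y ys; have [e [v ev]] := sP y ys.
    have ey := ch_trans cD (ch_sym cD e0) e; split; first exact: sub.
    case: (eqVneq v.1 (Some 0)) => hv; first by exists v.2; rewrite ev gV.
    by move: ey; rewrite eu ev gV// gF// => /sub/(ch_sym cE)/linkF.
  exists s'; split => // y /s'P[e cy]; split => //.
  exact: (ch_trans cD) e0 (avoid _ _ _ Vy0 e).
have [h [h' [hh' h'h hg [hc h'c] [hD h'D]]]] := embedding_extension lP0 cD cs' eg emb sg sm.
exists h, h'; split => //.
- by split=> n; [have [m H] := hc n|have [m H] := h'c n]; exists (b m) => x y /H; exact: (ch_refine cE).
- split.
    move=> n x y /(ch_mono cE (na n))/join[[m /hD[m' /sub e]]|[u [v [d1 d2 p]]]].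
      by exists (a m').
    have [m1 /sub e1] := hD _ _ _ d1; have [m2 /sub e2] := hD _ _ _ d2.
    rewrite -(gsh u) hg in e1; rewrite -(gsh v) hg in e2.
    have e3 : E (a n) (f (sh u)) (f (sh v)).
      by apply: frel; case: p => p1 p2; split => //=; rewrite p1.
    pose M := maxn (a m1) (maxn (a m2) (a n)); exists M.
    apply: (ch_trans cE) (ch_mono cE _ e1) _; first by rewrite leq_maxl.
    apply: (ch_trans cE) (ch_mono cE _ e3) (ch_sym cE (ch_mono cE _ e2)).
      by rewrite /M !leq_max leqnn !orbT.
    by rewrite /M !leq_max leqnn !orbT.
  move=> n u v p; exists (a n).
  have -> : i u = g (Some 0, u) by rewrite gV.
  have -> : i v = g (Some 0, v) by rewrite gV.
  by rewrite !hg; apply: frel.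
- move=> S Ss St SE SP n x y /(ch_mono cE (na n))/join[[m /h'D[m' /sub]]|[u [v [d1 d2 p]]]].
    by rewrite !hh'; exact: SE.
  have [m1 /sub e1] := h'D _ _ _ d1; have [m2 /sub e2] := h'D _ _ _ d2.
  rewrite -hg !hh' in e1; rewrite -hg !hh' in e2.
  apply: (St _ _ _ (SE _ _ _ e1)); apply: (fun h => St _ _ _ h (Ss _ _ (SE _ _ _ e2))).
  (* A [P1]-link on copy 0 comes from one on [K]; on any other copy it comes from the preimage copy,
     where [E] already contains it. *)
  case: (eqVneq u.1 (Some 0)) => hu.
    by case: p => p1 p2; rewrite !gV -?p1//; exact: SP p2.
  have p' : copies_rel P1 n (pr u) (pr v) by case: p => p1 p2; split => //=; rewrite p1.
  by rewrite !gF -?(proj1 p)//; exact: SE (frel _ _ _ p').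
Qed.

(** * Ample groups as chains *)

Lemma countable_enum (T : choiceType) (A : set T) : countable A -> A !=set0 ->
  exists g : nat -> T, (forall n, A (g n)) /\ forall x, A x -> exists n, g n = x.
Proof.
move=> /countable_injP[f fi] [x0 Ax0].
exists (fun n => xget x0 [set x | A x /\ f x = n]); split => [n|x Ax].
  by case: xgetP => [x _ []|].
exists (f x); case: xgetP => [y _ [Ay fy]|/(_ x)[]//].
by apply: fi; rewrite ?inE.
Qed.

Section Subgroups.
Context {Z : topologicalType}.
Implicit Types F G : set (Z -> Z).

Lemma homeo_homeo_subgroup : homeo_subgroup (homeo Z).
Proof.
split => //.
- by split; [move=> x; exact: cvg_id|exists id; split => // x; exact: cvg_id].
- move=> f g [cf [f' [cf' ff' f'f]]] [cg [g' [cg' gg' g'g]]]; split.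
    by move=> x; exact: continuous_comp (cg x) (cf _).
  exists (g' \o f'); split => [x|x|x] /=; rewrite ?ff' ?gg' ?g'g ?f'f//.
  exact: continuous_comp (cf' x) (cg' _).
- move=> f g [cf [f' [cf' ff' f'f]]] fg gf.
  have -> : g = f' by apply/funext => x; rewrite -{1}[x]f'f fg.
  by split => //; exists f; split.
Qed.

Lemma generated_sub F G : F `<=` G -> homeo_subgroup G -> smallest (@homeo_subgroup Z) F `<=` G.
Proof. by move=> FG sG g; apply; split. Qed.

Lemma generated_gen F : F `<=` smallest (@homeo_subgroup Z) F.
Proof. by move=> g Fg A [_]; apply. Qed.

Lemma generated_mono F G : F `<=` G ->
  smallest (@homeo_subgroup Z) F `<=` smallest (@homeo_subgroup Z) G.
Proof. by move=> FG g Fg A [sA GA]; apply: Fg; split => // h /FG/GA. Qed.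

Lemma generated_subgroup F : F `<=` homeo Z -> homeo_subgroup (smallest (@homeo_subgroup Z) F).
Proof.
move=> Fh; split.
- exact: generated_sub Fh homeo_homeo_subgroup.
- by move=> A [[_ h _ _] _].
- by move=> f g hf hg A sA; have [[_ _ h _] _] := sA; apply: h; [exact: hf|exact: hg].
- by move=> f g hf fg gf A sA; have [[_ _ _ h] _] := sA; apply: h fg gf; exact: hf.
Qed.

Lemma homeo_subgroup1 : homeo_subgroup [set @id Z].
Proof.
split => //.
- by move=> _ ->; case: homeo_homeo_subgroup.
- by move=> f g -> ->.
- by move=> f g -> h1 h2; apply/funext => x; rewrite -[RHS]h1.
Qed.

End Subgroups.

(** * Locally constant labels on a compact space *)

Section Compactness.
Context {Z : topologicalType}.
Hypothesis cZ : compact [set: Z].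

Lemma compact_eventually (P : nat -> Z -> Prop) :
  (forall n m x, (n <= m)%N -> P n x -> P m x) ->
  (forall x : Z, exists N, \forall y \near x, P N y) -> exists N, forall y, P N y.
Proof.
move=> mono loc.
have /compact_near_coveringP cov := cZ.
have [|N _ HN] := cov nat \oo P eventually_filter.
  move=> x _; have [N HN] := loc x.
  exists ([set y | P N y], [set n | (N <= n)%N]) => /=.
    by split => //; exists N.
  by move=> [y n] /= [h1 h2]; exact: mono h1.
by exists N => y; exact: HN (leqnn N) y I.
Qed.

Variable e : Z -> nat -> bool.
Hypothesis ce : forall k (x : Z), \forall y \near x, e y k = e x k.
Hypothesis ie : injective e.

Lemma near_seq_all (I : eqType) (s : seq I) (P : I -> Z -> Prop) (x : Z) :
  (forall i, i \in s -> \forall y \near x, P i y) ->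
  \forall y \near x, forall i, i \in s -> P i y.
Proof.
elim: s => [|i s IH] h; first exact: nearW.
have h1 := h i (mem_head _ _).
have h2 : \forall y \near x, forall j, j \in s -> P j y.
  by apply: IH => j hj; apply: h; rewrite in_cons hj orbT.
near=> y => j; rewrite in_cons => /orP[/eqP ->|]; first by near: y.
by move: j; near: y.
Unshelve. all: by end_near. Qed.

(** Near a fixed point everything is fixed, as the fixed set is open; near a moved point, a bit
    telling [s x] from [x] stays constant. Compactness makes the number of bits uniform. *)
Lemma homeo_separation (s : Z -> Z) : continuous s -> clopen [set x | s x = x] ->
  exists N, forall x, s x <> x -> exists2 k, (k < N)%N & e (s x) k <> e x k.
Proof.
move=> cs [oF cF].
apply: (@compact_eventually (fun N x => s x <> x -> exists2 k, (k < N)%N & e (s x) k <> e x k)).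
  by move=> n m x nm h /h[k kn ek]; exists k => //; exact: leq_trans nm.
move=> x; have [sx|sx] := pselect (s x = x).
  exists 0%N; have : nbhs x [set x | s x = x] by exact: open_nbhs_nbhs.
  by apply: filterS => y /= ->.
have [k ek] : exists k, e (s x) k <> e x k.
  apply: contrapT => h; apply: sx; apply: ie; apply/funext => k.
  by apply: contrapT => h'; apply: h; exists k.
exists k.+1; have h1 := ce k x; have h2 : \forall y \near x, e (s y) k = e (s x) k by exact: (cs x _ (ce k (s x))).
near=> y => _; exists k => //.
by rewrite (near h1 y)// (near h2 y).
Unshelve. all: by end_near. Qed.

Lemma labelled_separated (c : nat -> Z -> nat) :
  (forall n (x : Z), \forall y \near x, c n y = c n x) ->
  (forall n x y, c n.+1 x = c n.+1 y -> c n x = c n y) ->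
  (forall x y, (forall n, c n x = c n y) -> x = y) ->
  separated c.
Proof.
move=> lc cS sep; split => //.
- move=> n; apply: (@compact_eventually (fun N x => (c n x < N)%N)).
    by move=> N M x NM h; exact: leq_trans h NM.
  by move=> x; exists (c n x).+1; near=> y; rewrite (near (lc n x) y).
- move=> u uS; apply: contrapT => nx.
  have [|x|N HN] := @compact_eventually (fun N x => exists2 n, (n <= N)%N & c n x <> c n (u n)).
  + by move=> n m x nm [k kn ck]; exists k => //; exact: leq_trans nm.
  + have [n cn] : exists n, c n x <> c n (u n).
      apply: contrapT => h; apply: nx; exists x => n.
      by apply: contrapT => h'; apply: h; exists n.
    by exists n; near=> y; exists n => //; rewrite (near (lc n x) y).
  + have [n nN] := HN (u N); apply.
    move: nN => /subnK <-; elim: (N - n)%N => [//|d IH].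
    rewrite -IH addSn; have : (n <= d + n)%N by exact: leq_addl.
    move: (uS (d + n)%N) => e1 le1.
    have cle m k x y : (m <= k)%N -> c k x = c k y -> c m x = c m y.
      by move=> /subnK <-; elim: (k - m)%N => // j IHj; rewrite addSn => /cS/IHj.
    exact: cle le1 e1.
Unshelve. all: by end_near. Qed.

Lemma labelled_base (c : nat -> Z -> nat) (U : set Z) x :
  (forall n (x : Z), \forall y \near x, c n y = c n x) ->
  (forall n m x y, (n <= m)%N -> c m x = c m y -> c n x = c n y) ->
  (forall x y, (forall n, c n x = c n y) -> x = y) ->
  open U -> U x -> exists n, forall y, c n y = c n x -> U y.
Proof.
move=> lc cle sep oU Ux.
apply: (@compact_eventually (fun n y => c n y = c n x -> U y)).
  by move=> n m y nm h /(cle n m _ _ nm)/h.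
move=> y; have [Uy|nUy] := pselect (U y).
  exists 0%N; have : nbhs y U by exact: open_nbhs_nbhs.
  by apply: filterS.
have [n cn] : exists n, c n y <> c n x.
  apply: contrapT => h; apply: nUy; rewrite (sep y x)// => n.
  by apply: contrapT => h'; apply: h; exists n.
by exists n; near=> z => cz; case: cn; rewrite -(near (lc n y) z).
Unshelve. all: by end_near. Qed.

(** The label of [x] records finitely many bits of [s x] for every [s] in [S n]. Closure under
    composition makes the labels equivariant, and enough bits separate [x] from every other point of
    its orbit. *)
Lemma group_labels (S : nat -> set (Z -> Z)) :
  (forall n, finite_set (S n)) -> (forall n, homeo_subgroup (S n)) ->
  (forall n, S n `<=` S n.+1) -> (forall n g, S n g -> clopen [set x | g x = x]) ->
  exists c : nat -> Z -> nat,
    [/\ forall n (x : Z), \forall y \near x, c n y = c n x,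
        separated c,
        forall n x y, c n.+1 x = c n.+1 y -> c n x = c n y,
        forall x y, c 0%N x = c 0%N y &
        (forall n g x, (0 < n)%N -> S n g -> c n (g x) = c n x -> g x = x) /\
        (forall n m g x y, (n <= m)%N -> S n g -> c m x = c m y -> c m (g x) = c m (g y))].
Proof.
move=> fS sS SS cS.
have Sle n m : (n <= m)%N -> S n `<=` S m.
  by move=> /subnK <-; elim: (m - n)%N => // k IH; apply: subset_trans IH (SS _).
have [l lS] := choice (fun n => iffLR (finite_seqP (S n)) (fS n)).
have lP n g : g \in l n <-> S n g by rewrite lS.
have cont n g : S n g -> continuous g by case: (sS n) => h _ _ _ /h[].
have [N0 N0P] : exists N0 : nat -> nat, forall n g x, S n g -> g x <> x ->
    exists2 k, (k < N0 n)%N & e (g x) k <> e x k.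
  suff /choice[N0 H] : forall n, exists N, forall g x, S n g -> g x <> x ->
      exists2 k, (k < N)%N & e (g x) k <> e x k by exists N0.
  move=> n; suff [N HN] : exists N, forall g, g \in l n -> forall x, g x <> x ->
      exists2 k, (k < N)%N & e (g x) k <> e x k.
    by exists N => g x /lP hg; exact: HN g hg x.
  have : forall g, g \in l n -> S n g by move=> g /lP.
  elim: (l n) => [|g s IH] h; first by exists 0%N.
  have [|N HN] := IH; first by move=> f hf; apply: h; rewrite in_cons hf orbT.
  have Sg := h g (mem_head _ _).
  have [M HM] := homeo_separation (cont _ _ Sg) (cS _ _ Sg).
  exists (maxn N M) => f; rewrite in_cons => /orP[/eqP ->|hf] x fx.
    by have [k kM ek] := HM x fx; exists k => //; apply: leq_trans kM (leq_maxr _ _).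
  by have [k kM ek] := HN f hf x fx; exists k => //; apply: leq_trans kM (leq_maxl _ _).
(* The sum is monotone, at least [n], and dominates [N0 n] for positive [n]. Since [N 0 = 0] the
   label of level 0 is constant, so injectivity is claimed for positive levels only. *)
pose N n := \sum_(i < n) (N0 i.+1).+1.
have NS n : (N n <= N n.+1)%N by rewrite /N big_ord_recr leq_addr.
have N0N n : (0 < n)%N -> (N0 n <= N n)%N.
  by case: n => // n _; rewrite /N big_ord_recr /=; exact: leq_trans (leqnSn _) (leq_addl _ _).
have nN n : (n <= N n)%N.
  by elim: n => // n IH; rewrite /N big_ord_recr /= addnS ltnS; apply: leq_trans IH (leq_addr _ _).
pose c n x := pickle [seq [seq e (s x) k | k <- iota 0 (N n)] | s <- l n].
have cP n x y : c n x = c n y <-> forall s k, S n s -> (k < N n)%N -> e (s x) k = e (s y) k.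
  split.
    move=> /(pcan_inj pickleK)/eq_in_map h s k /lP/h/eq_in_map + kN; apply.
    by rewrite mem_iota.
  move=> h; congr pickle; apply/eq_in_map => s /lP sn; apply/eq_in_map => k.
  by rewrite mem_iota => /andP[_ kN]; exact: h.
have lc n x : \forall y \near x, c n y = c n x.
  have : \forall y \near x, forall s, s \in l n -> forall k, k \in iota 0 (N n) -> e (s y) k = e (s x) k.
    apply: near_seq_all => s /lP sn; apply: near_seq_all => k _.
    exact: (cont _ _ sn x _ (ce k (s x))).
  apply: filterS => y h; apply/cP => s k /lP sn kN; apply: h => //.
  by rewrite mem_iota.
have cS' n x y : c n.+1 x = c n.+1 y -> c n x = c n y.
  move=> /cP h; apply/cP => s k /SS sn kN; apply: h => //; exact: leq_trans (NS n).
have S1 n : S n id by case: (sS n).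
have sep x y : (forall n, c n x = c n y) -> x = y.
  move=> h; apply: ie; apply/funext => k; have /cP := h k.+1; apply; first exact: S1.
  exact: nN.
exists c; split => //.
- exact: labelled_separated.
- by move=> x y; apply/cP => s k _; rewrite /N big_ord0.
- split.
    move=> n g x n0 Sg /cP h; apply: contrapT => gx.
    have [k kN ek] := N0P _ _ _ Sg gx; apply: ek.
    by apply: (h id) => //; apply: leq_trans kN (N0N _ n0).
  move=> n m g x y nm Sg /cP h; apply/cP => s k Ss kN.
  apply: (h (s \o g)) => //; case: (sS m) => _ _ + _; apply => //; exact: Sle Sg.
Qed.

End Compactness.

Lemma locally_constant_clopen (Z : topologicalType) (A : set Z) :
  (forall x : Z, \forall y \near x, A y <-> A x) -> clopen A.
Proof.
have op (B : set Z) : (forall x : Z, \forall y \near x, B y <-> B x) -> open B.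
  move=> h; rewrite openE => x Bx; have := h x; rewrite /interior /=.
  by apply: filterS => y /= ->.
move=> h; split; first exact: op.
rewrite -openC; apply: op => x; have := h x; apply: filterS => y hy /=.
by rewrite hy.
Qed.

Lemma set_val_in (T : Type) (A : set T) (u : A) : A (set_val u).
Proof. by rewrite set_valE; case: u => v h; exact: set_mem h. Qed.

Definition orbit_step (Z : Type) (S : nat -> set (Z -> Z)) n x y := exists2 g, S n g & g x = y.

Lemma subgroup_inv (Z : topologicalType) (G : set (Z -> Z)) g : homeo_subgroup G -> G g ->
  exists g', [/\ G g', cancel g g' & cancel g' g].
Proof.
move=> [Gh _ _ Gi] Gg; have [_ [g' [_ h1 h2]]] := Gh _ Gg.
by exists g'; split => //; exact: Gi h1 h2.
Qed.

Lemma orbit_chain (Z : topologicalType) (c : nat -> Z -> nat) (S P : nat -> set (Z -> Z)) :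
  (forall n x y, c n.+1 x = c n.+1 y -> c n x = c n y) ->
  (forall n g x, (0 < n)%N -> S n g -> c n (g x) = c n x -> g x = x) ->
  (forall n m g x y, (n <= m)%N -> S n g -> c m x = c m y -> c m (g x) = c m (g y)) ->
  (forall g, S 0%N g -> g = id) ->
  (forall n, homeo_subgroup (P n)) -> (forall n, P n `<=` P n.+1) -> (forall n, P n `<=` S n) ->
  chain c (orbit_step P).
Proof.
move=> cS cinj clift S0 sP PP PS; split => //.
- by move=> n x; exists id => //; case: (sP n).
- move=> n x y [g Pg <-]; have [g' [Pg' h1 h2]] := subgroup_inv (sP n) Pg.
  by exists g'.
- move=> n x y z [g Pg <-] [h Ph <-]; exists (h \o g) => //.
  by case: (sP n) => _ _ + _; apply.
- by move=> n x y [g Pg <-]; exists g => //; exact: PP.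
- move=> n x y [g /PS Sg <-] e; case: n Sg e => [/S0 -> //|n] Sg e.
  by rewrite (cinj _ _ _ _ Sg).
- move=> n m x y x' nm [g Pg <-] e; exists (g x'); last by exists g.
  by apply/esym/(clift n); [|exact: PS|].
Qed.

Lemma set_type_nbhs (X : topologicalType) (K : set X) (x : K) (U : set X) :
  nbhs (set_val x) U -> nbhs x (set_val @^-1` U).
Proof. exact: (@initial_continuous _ _ (@set_val X K)). Qed.

Lemma set_type_compact (X : topologicalType) (K : set X) : compact K -> compact [set: K].
Proof.
move=> cK F FF _.
have [|p [Kp cp]] := cK (set_val @ F) _.
  by change (F (set_val @^-1` K)); apply: filterE => x; exact: (set_val_in x).
have [x xp] : exists x : K, set_val x = p.
  by exists (exist _ p (mem_set Kp)); rewrite set_valE.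
exists x; split => // A B FA /= [_ [[W oW <-] /= Wx WB]].
have FA' : (set_val @ F) (set_val @` A).
  by change (F (set_val @^-1` (set_val @` A))); apply: filterS FA => a Aa; exists a.
have Wp : nbhs p W by apply: open_nbhs_nbhs; split => //; rewrite -xp.
have [q [[a Aa aq] Wq]] := cp _ _ FA' Wp.
by exists a; split => //; apply: WB => /=; rewrite aq.
Qed.

Lemma cantor_near_bit k (x : cantor_space) : \forall y \near x, y k = x k.
Proof.
exact: (@proj_continuous _ (fun _ : nat => bool) k x _ (discrete_set1 (x k))).
Qed.

Lemma label_factor (Z : topologicalType) (c : nat -> Z -> nat) (f : Z -> nat) :
  compact [set: Z] -> (forall n (x : Z), \forall y \near x, c n y = c n x) ->
  (forall n m x y, (n <= m)%N -> c m x = c m y -> c n x = c n y) ->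
  (forall x y, (forall n, c n x = c n y) -> x = y) ->
  (forall x : Z, \forall y \near x, f y = f x) ->
  ev (fun m => forall x y, c m x = c m y -> f x = f y).
Proof.
move=> cZ lc cle sep lf.
suff [N HN] : exists N, forall x y, c N x = c N y -> f x = f y.
  by exists N => m Nm x y /(cle _ _ _ _ Nm)/HN.
apply: (@compact_eventually Z cZ (fun N x => forall y, c N x = c N y -> f x = f y)).
  by move=> n m x nm h y /(cle _ _ _ _ nm)/h.
move=> x.
have oU : open [set y | f y = f x].
  rewrite openE => y /= fy; have := lf y; apply: filterS => z /= ->//.
have [n hn] := labelled_base cZ lc cle sep oU (erefl (f x)).
exists n; near=> x' => y cy.
have cx : c n x' = c n x by near: x'; exact: lc.
by rewrite (hn _ cx) (hn y)// -cy.
Unshelve. all: by end_near. Qed.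

Lemma clopen_homeo_preimage (Z : topologicalType) (g : Z -> Z) (A : set Z) :
  continuous g -> clopen A -> clopen (g @^-1` A).
Proof.
move=> cg [oA cA]; split; first by apply: open_comp oA => x _; exact: cg.
by apply: closed_comp cA => x _; exact: cg.
Qed.

(** Glue [g] on [A], its inverse on [B] and the identity elsewhere. This realises links between
    different atoms by involutions of the kind that define [induced_group]. *)
Lemma exchange_involution (Z : topologicalType) (G : set (Z -> Z)) g (A B : set Z) :
  full_group G -> G g -> clopen A -> clopen B -> A `&` B = set0 ->
  (forall x, A x <-> B (g x)) ->
  exists s, [/\ G s, s \o s = id & forall x, A x -> s x = g x].
Proof.
move=> [sG fG] Gg cA cB AB gAB.
have [g' [Gg' gg' g'g]] := subgroup_inv sG Gg.
have [Gh G1 _ _] := sG.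
pose s x := if pselect (A x) then g x else if pselect (B x) then g' x else x.
have sA x : A x -> s x = g x by rewrite /s; case: pselect.
have nAB x : A x -> B x -> False by move=> a b; have : (A `&` B) x by []; rewrite AB.
have sB x : B x -> s x = g' x.
  by move=> b; rewrite /s; case: pselect => [a|?]; [case: (nAB x)|case: pselect].
have sN x : ~ A x -> ~ B x -> s x = x.
  by move=> a b; rewrite /s; case: pselect => //= ?; case: pselect.
have gA x : B x -> A (g' x) by move=> b; apply/gAB; rewrite g'g.
have ss x : s (s x) = x.
  have [a|a] := pselect (A x).
    by rewrite (sA x)// sB ?gg'//; exact/gAB.
  have [b|b] := pselect (B x).
    by rewrite (sB x)// sA ?g'g//; exact: gA.
  by rewrite !(sN x).
have cs : continuous s.
  have near_eq (f : Z -> Z) (C : set Z) x : continuous f -> open C -> C x ->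
      (forall y, C y -> s y = f y) -> {for x, continuous s}.
    move=> cf oC Cx e W; rewrite (e x)// => /cf Wf.
    have : nbhs x C by exact: open_nbhs_nbhs.
    apply: filter_app; near=> y => Cy; rewrite /= e//; near: y; exact: Wf.
  move=> x; have [a|a] := pselect (A x).
    by apply: (near_eq g A) => //; [case: (Gh _ Gg)|case: cA].
  have [b|b] := pselect (B x).
    by apply: (near_eq g' B) => //; [case: (Gh _ Gg')|case: cB].
  apply: (near_eq id (~` A `&` ~` B)) => //.
  - by move=> y; exact: cvg_id.
  - by apply: openI; rewrite openC; [case: cA|case: cB].
  - by move=> y [? ?]; exact: sN.
exists s; split => //; last by apply/funext => x /=.
pose U (i : 'I_3) := nth set0 [:: A; B; ~` A `&` ~` B] i.
pose gs (i : 'I_3) := nth id [:: g; g'; id] i.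
apply: (fG s 3 U gs).
- by split => //; exists s; split.
- case=> [[|[|[|//]]] ?] //=.
  by rewrite /U /=; apply: clopenI; apply: clopenC => //; exact: setT.
- apply/seteqP; split => // x _.
  have [a|a] := pselect (A x); first by exists (inord 0) => //; rewrite /U inordK.
  have [b|b] := pselect (B x); first by exists (inord 1) => //; rewrite /U inordK.
  by exists (inord 2) => //; rewrite /U inordK.
- move=> [[|[|[|//]]] hi] [[|[|[|//]]] hj] _ _ [x []]; rewrite /U /= => h1 h2;
    try exact: val_inj; exfalso; try exact: (nAB x);
    by [case: h1|case: h2].
- by case=> [[|[|[|//]]] ?].
- by move=> [[|[|[|//]]] ?] x; rewrite /U /gs /=; [exact: sA|exact: sB|case; exact: sN].
Unshelve. all: by end_near. Qed.

Lemma generated_tower (Z : topologicalType) (G : set (Z -> Z)) (F : nat -> set (Z -> Z)) :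
  homeo_subgroup G -> locally_finite_group G ->
  (forall n, F n `<=` G) -> (forall n, finite_set (F n)) -> (forall n, F n `<=` F n.+1) ->
  F 0%N = set0 ->
  let S n := smallest (@homeo_subgroup Z) (F n) in
  [/\ forall n, finite_set (S n), forall n, homeo_subgroup (S n), forall n, S n `<=` S n.+1,
    forall n, S n `<=` G & forall g, S 0%N g -> g = id].
Proof.
move=> sG lfG FG fF FF F0 S; split.
- by move=> n; exact: lfG (FG n) (fF n).
- by move=> n; apply: generated_subgroup => g /FG; case: sG => h _ _ _; exact: h.
- by move=> n; exact: generated_mono.
- by move=> n; exact: generated_sub.
- by move=> g; rewrite /S F0; apply: (generated_sub _ (@homeo_subgroup1 Z)).
Qed.

Lemma extended_equivalence (X : topologicalType) (G : set (X -> X)) (K : set X) (D : set (K -> K)) :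
  is_equivalence (extended_relation G D).
Proof.
split.
- by move=> x S [[r _ _] _]; exact: r.
- by move=> x y h S sS; have [[_ s _] _] := sS; apply: s; exact: h.
- move=> x y z h1 h2 S sS; have [[_ _ t] _] := sS.
  by apply: t; [exact: h1|exact: h2].
Qed.

Lemma orbit_equivalence (X : topologicalType) (G : set (X -> X)) :
  homeo_subgroup G -> is_equivalence (orbit_relation G).
Proof.
move=> sG; have [_ G1 Gm _] := sG; split.
- by move=> x; exists id.
- move=> x y [g Gg /= <-]; have [g' [Gg' h1 h2]] := subgroup_inv sG Gg.
  by exists g' => /=.
- by move=> x y z [g Gg /= <-] [h Gh /= <-]; exists (h \o g) => //; exact: Gm.
Qed.

Lemma extended_relation_set0 (X : topologicalType) (G : set (X -> X)) (K : set X) (D : set (K -> K)) :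
  homeo_subgroup G -> ~ (exists x, K x) -> extended_relation G D = orbit_relation G.
Proof.
move=> sG K0; apply/seteqP; split => p.
  apply; split; first exact: orbit_equivalence.
  by move=> q [//|[x _ _]]; case: K0; exists (set_val x); exact: set_val_in.
by move=> Gp S [_ GS]; apply: GS; left.
Qed.

(** One sequence of labels serves all subfamilies [F'], because [P0] and [P1] have to be chains over
    the same atoms. *)
Lemma generated_chain (Z : topologicalType) (G : set (Z -> Z)) (F : nat -> set (Z -> Z))
    (e : Z -> nat -> bool) :
  compact [set: Z] -> (forall k (x : Z), \forall y \near x, e y k = e x k) -> injective e ->
  homeo_subgroup G -> locally_finite_group G -> (forall g, G g -> clopen [set x | g x = x]) ->
  (forall n, F n `<=` G) -> (forall n, finite_set (F n)) -> (forall n, F n `<=` F n.+1) ->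
  F 0%N = set0 ->
  exists c : nat -> Z -> nat, [/\ forall n (x : Z), \forall y \near x, c n y = c n x,
    separated c, forall x y, c 0%N x = c 0%N y &
    forall F' : nat -> set (Z -> Z), (forall n, F' n `<=` F n) -> (forall n, F' n `<=` F' n.+1) ->
      chain c (orbit_step (fun n => smallest (@homeo_subgroup Z) (F' n)))].
Proof.
move=> cZ ce ie sG lfG fixG FG fF FF F0.
have [fS sS SS SG S0] := generated_tower sG lfG FG fF FF F0.
have [c [lc cs cS c0 [cinj clift]]] :=
  group_labels cZ ce ie fS sS SS (fun n g Sg => fixG _ (SG n g Sg)).
exists c; split => // F' F'F F'S.
apply: (orbit_chain cS cinj clift S0) => n.
- by apply: generated_subgroup => g /F'F/FG; case: sG => h _ _ _; exact: h.
- exact: generated_mono.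
- exact: generated_mono.
Qed.

Lemma set_val_onto (T : Type) (K : set T) x : K x -> exists y : K, set_val y = x.
Proof. by move=> Kx; exists (exist _ x (mem_set Kx)); rewrite set_valE. Qed.

Lemma ev_seq (I : eqType) (s : seq I) (P : I -> nat -> Prop) :
  (forall i, i \in s -> ev (P i)) -> ev (fun n => forall i, i \in s -> P i n).
Proof.
elim: s => [|i s IH] h; first by exists 0%N.
have [|N HN] := IH; first by move=> j js; apply: h; rewrite in_cons js orbT.
have [M HM] := h i (mem_head _ _).
exists (maxn N M) => n; rewrite geq_max => /andP[Nn Mn] j; rewrite in_cons => /orP[/eqP ->|].
  exact: HM.
exact: HN.
Qed.

(** Elements that are not involutions contribute the identity, so [p] and [g] share their indices.
    For [em_refl] the finitely many elements of [S n] are cut along pairs of atoms: within one atom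
    a link is trivial, between two different atoms an involution performs it. *)
Lemma induced_embedding (X : ptopologicalType) (Gamma : set (X -> X)) (K : set X)
    (g : nat -> X -> X) (c : nat -> X -> nat) (k : nat -> K -> nat) :
  let S n := smallest (@homeo_subgroup X) (g @` `I_n) in
  let p i := if pselect (g i \o g i = id) then induced_map (K := K) (g i) else id in
  let P n := smallest (@homeo_subgroup K) (p @` `I_n) in
  compact [set: X] -> closed K -> etale Gamma K -> full_group Gamma ->
  (forall n, Gamma (g n)) -> (forall h, Gamma h -> exists n, g n = h) ->
  (forall n, finite_set (S n)) -> (forall n, homeo K (p n)) ->
  (forall n (x : X), \forall y \near x, c n y = c n x) -> separated c ->
  chain c (orbit_step S) ->
  (forall n (x : K), \forall y \near x, k n y = k n x) -> separated k ->
  chain k (orbit_step P) ->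
  embedding k (orbit_step P) c (orbit_step S) (@set_val X K).
Proof.
move=> S p P cX clK etK fullG gG gsurj fS ph lc cs cE lk ks kP.
have cK : compact [set: K] := set_type_compact (subclosed_compact clK cX (@subsetT _ K)).
have cle n m x y : (n <= m)%N -> c m x = c m y -> c n x = c n y by exact: (ch_refine cE).
have kle n m x y : (n <= m)%N -> k m x = k m y -> k n x = k n y by exact: (ch_refine kP).
have lv n (x : K) : \forall y \near x, c n (set_val y) = c n (set_val x).
  exact: set_type_nbhs (lc n (set_val x)).
have vi : injective (@set_val X K) by move=> u v; rewrite set_valE; exact: val_inj.
have [sG _] := fullG.
have SG n h : S n h -> Gamma h.
  by apply: (generated_sub _ sG) => _ [i _ <-].
have [l lS] := choice (fun n => iffLR (finite_seqP (S n)) (fS n)).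
have lP n h : h \in l n <-> S n h by rewrite lS.
have pE i u : g i \o g i = id -> K (g i (set_val u)) -> set_val (p i u) = g i (set_val u).
  move=> gi Kgu; rewrite /p; case: pselect => // ?.
  by rewrite /induced_map !set_valE val_insubd mem_set.
have lcl n (Q : nat -> Prop) : clopen [set x | Q (c n x)].
  by apply: locally_constant_clopen => x; have := lc n x; apply: filterS => y /= ->.
split => //.
- by move=> n; exact: (label_factor cK lk kle (sp_sep ks) (lv n)).
- move=> n; apply: (label_factor cK lv _ _ (lk n)) => [a b x y|x y h]; first exact: cle.
  by apply: vi; exact: (sp_sep cs).
- move=> n; exists n => m nm u v [s Ps <-]; apply: (ch_mono cE nm); move: s Ps u {v}.
  suff PQ : P n `<=` [set s | homeo K s /\ forall u, orbit_step S n (set_val u) (set_val (s u))].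
    by move=> s /PQ[].
  apply: generated_sub.
    move=> _ [i ni <-]; split => // u; rewrite /p; case: pselect => [gi|_] /=; last exact: (ch_refl cE).
    rewrite /induced_map !set_valE val_insubd; case: ifP => _; last exact: (ch_refl cE).
    by exists (g i); [apply: generated_gen; exists i|].
  have [_ h1 hm hi] := @homeo_homeo_subgroup K; split.
  + by move=> s [].
  + by split => // u; exact: (ch_refl cE).
  + move=> s t [hs es] [ht et]; split; first exact: hm.
    by move=> u; exact: (ch_trans cE) (et u) (es _).
  + move=> s t [hs es] st ts; split; first exact: hi st ts.
    by move=> u; apply: (ch_sym cE); rewrite -{2}[u]ts; exact: es.
- move=> n.
  have [N HN] := sp_fin cs n.+1.
  have : ev (fun m => forall h, h \in l n -> forall v, (v < N)%N -> forall w, (w < N)%N ->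
      forall u u', set_val u' = h (set_val u) -> c n.+1 (set_val u) = v -> c n.+1 (set_val u') = w ->
      orbit_step P m u u').
    apply: ev_seq => h /lP Sh; apply: ev_bounded => v _; apply: ev_bounded => w _.
    case: (eqVneq v w) => [<-|vw].
      exists 0%N => m _ u u' hu' cu cu'; have -> : u' = u; last exact: (ch_refl kP).
      apply: vi; apply: (ch_inj cE (n := n.+1)); last by rewrite cu cu'.
      by apply: (ch_sym cE); apply: (ch_monoS cE); exists h.
    have [h' [Gh' hh' h'h]] := subgroup_inv sG (SG _ _ Sh).
    have [Ghomeo _ _ _] := sG.
    have [ch _] := Ghomeo _ (SG _ _ Sh); have [ch' _] := Ghomeo _ Gh'.
    pose A := [set x | c n.+1 x = v] `&` h @^-1` [set x | c n.+1 x = w].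
    pose B := [set x | c n.+1 x = w] `&` h' @^-1` [set x | c n.+1 x = v].
    have [|||x|s [Gs ss sA]] := @exchange_involution X Gamma h A B fullG (SG _ _ Sh).
    + by apply: clopenI; [exact: (lcl _ (fun a => a = v))|
        apply: clopen_homeo_preimage => //; exact: (lcl _ (fun a => a = w))].
    + by apply: clopenI; [exact: (lcl _ (fun a => a = w))|
        apply: clopen_homeo_preimage => //; exact: (lcl _ (fun a => a = v))].
    + by apply/seteqP; split => // x [[/= e1 _] [/= e2 _]]; move: vw; rewrite -e1 e2 eqxx.
    + by rewrite /A /B /= hh'; split => -[].
    have [i ei] := gsurj _ Gs; exists i.+1 => m im u u' hu' cu cu'.
    have su : g i (set_val u) = set_val u'.
      by rewrite ei sA ?hu'//; split => //=; rewrite -hu'.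
    exists (p i); first by apply: generated_gen; exists i.
    apply: vi; rewrite pE ?ei// -ei su//; exact: set_val_in.
  move=> [M HM]; exists M => m Mm u v [h Sh hu].
  by apply: (HM m Mm h _ _ (HN (set_val u)) _ (HN (set_val v))) => //; apply/lP.
- move=> n.
  have : ev (fun m => forall h, h \in l n -> forall u v : K,
      c m (h (set_val u)) = c m (set_val v) -> K (h (set_val u))).
    apply: ev_seq => h /lP Sh.
    have [h' [Gh' hh' h'h]] := subgroup_inv sG (SG _ _ Sh).
    have [Ghomeo _ _ _] := sG; have [ch _] := Ghomeo _ (SG _ _ Sh).
    suff [m Hm] : exists m, forall u v : K, c m (h (set_val u)) = c m (set_val v) -> K (h (set_val u)).
      by exists m => m' mm' u v /(cle _ _ _ _ mm'); exact: Hm.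
    apply: (compact_eventually cK
      (P := fun m (u : K) => forall v : K, c m (h (set_val u)) = c m (set_val v) -> K (h (set_val u)))).
      by move=> a b u ab H v /(cle _ _ _ _ ab); exact: H.
    (* If [h] sends [u] into [K], étaleness for the inverse of [h] does so for the points of [K]
       near [u]; if not, closedness of [K] keeps the images of nearby points away from it. *)
    move=> u; have [Ku|nKu] := pselect (K (h (set_val u))).
      exists 0%N.
      have [oD _] := etK _ Gh' setT (conj openT closedT).
      have Du : nbhs u [set y : K | (h' @` (set_val @` [set: K])) (set_val y)].
        apply: open_nbhs_nbhs; split => //=; exists (h (set_val u)); last exact: hh'.
        by have [z ez] := set_val_onto Ku; exists z.
      apply: filterS Du => y [_ [z _ <-] /= <-] _ _; rewrite h'h; exact: set_val_in.
    have oK : open (~` K) by rewrite openC.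
    have [b hb] := labelled_base cX lc cle (sp_sep cs) oK nKu.
    have hb' : \forall y \near set_val u, c b (h y) = c b (h (set_val u)) by exact: ch (lc b _).
    exists b; have := set_type_nbhs hb'.
    apply: filterS => y /= cy v cv; case: (hb (set_val v)); last exact: set_val_in.
    by rewrite -cv.
  move=> [M HM]; exists M => m Mm u v y [h /lP Sh <-] cy.
  have Ky := HM m Mm h Sh u v cy.
  by have [z ez] := set_val_onto Ky; exists z.
Qed.

(** * Thin sets are combinatorially small *)

Import Order.TTheory GRing.Theory Num.Theory.
Import numFieldNormedType.Exports.
Local Open Scope ring_scope.

Lemma ultrafilter_limit (R : realType) (U : set_system nat) (f : nat -> R) :
  UltraFilter U -> (forall n, 0 <= f n <= 1) -> exists l : R, f @ U --> l.
Proof.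
move=> UU f01.
have FF : ProperFilter (f @ U) by apply: fmap_proper_filter.
have [|p [_ pc]] := @segment_compact R 0 1 (f @ U) FF.
  by change (U (f @^-1` `[0, 1])); apply: filterE => n; rewrite /= in_itv /=; exact: f01.
exists p => N Np /=.
have [//|UN] := in_ultra_setVsetC (f @^-1` N) UU.
by have [x [/= h1 /h1]] := pc (~` N) N UN Np.
Qed.

Section Frequencies.
Context {R : realType} {X : choiceType} (s : nat -> seq X).
Hypothesis s0 : forall n, (0 < size (s n))%N.

Definition frequency n (A : set X) : R :=
  (count (fun y => `[< A y >]) (s n))%:R / (size (s n))%:R.

Lemma frequency01 n A : 0 <= frequency n A <= 1.
Proof.
rewrite /frequency divr_ge0 ?ler0n//= ler_pdivrMr ?ltr0n// mul1r ler_nat.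
exact: count_size.
Qed.

(** A finitely additive mean on all subsets, as a limit of counting frequencies along an ultrafilter
    finer than [\oo]. *)
Lemma limit_frequency : exists rho : set X -> R, [/\ forall A, 0 <= rho A,
  rho setT = 1,
  forall A B, A `&` B = set0 -> rho (A `|` B) = rho A + rho B,
  forall A B, (exists N, forall n, (N <= n)%N -> frequency n A <= frequency n B) -> rho A <= rho B &
  forall A r, (exists N, forall n, (N <= n)%N -> r <= frequency n A) -> r <= rho A].
Proof.
have [U [UU UN]] := ultraFilterLemma (eventually_filter : ProperFilter \oo).
have UP : ProperFilter U by exact: ultra_proper.
have [rho rhoP] := choice (fun A => ultrafilter_limit UU (fun n => frequency01 n A)).
have evU P : (exists N, forall n, (N <= n)%N -> P n) -> \forall n \near U, P n.
  by move=> [N HN]; apply: UN; exists N.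
have le A B : (exists N, forall n, (N <= n)%N -> frequency n A <= frequency n B) -> rho A <= rho B.
  by move=> /evU h; apply: (ler_cvg_to (rhoP A) (rhoP B)) h.
have ge A r : (exists N, forall n, (N <= n)%N -> r <= frequency n A) -> r <= rho A.
  by move=> /evU h; apply: (ler_cvg_to _ (rhoP A)) h; exact: cvg_cst.
exists rho; split => //.
- by move=> A; apply: ge; exists 0%N => n _; case/andP: (frequency01 n A).
- have h : frequency ^~ setT @ U --> (1 : R).
    apply: cvg_near_cst; apply: nearW => n; rewrite /frequency.
    rewrite (_ : count _ _ = size (s n)) ?divff ?pnatr_eq0 -?lt0n//.
    by apply/eqP; rewrite -all_count; apply/allP => x _; apply/asboolP.
  exact: cvg_unique (rhoP setT) h.
- move=> A B AB.
  have h : frequency ^~ (A `|` B) @ U --> rho A + rho B.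
    rewrite (_ : frequency ^~ _ = frequency ^~ A \+ frequency ^~ B).
      exact: cvgD (rhoP A) (rhoP B).
    apply/funext => n; rewrite /frequency /= -mulrDl -natrD; congr (_%:R / _).
    rewrite -count_predUI [X in (_ + X)%N](_ : _ = 0%N) ?addn0.
      by apply: eq_count => x /=; rewrite asbool_or.
    apply/eqP; rewrite -leqn0 leqNgt -has_count; apply/hasPn => x _ /=.
    by rewrite -asbool_and; apply/asboolP => h; have : (A `&` B) x by []; rewrite AB.
  exact: cvg_unique (rhoP _) h.
Qed.

End Frequencies.

(** An alias of [X] whose measurable sets are the clopen sets, from which the measure extension
    starts. *)
Definition clopen_algebra (X : ptopologicalType) : Type := X.
HB.instance Definition _ (X : ptopologicalType) := Pointed.on (clopen_algebra X).
HB.instance Definition _ (X : ptopologicalType) :=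
  isAlgebraOfSets.Build default_measure_display (clopen_algebra X)
    (@clopen0 X) (@clopenU X) (fun A => @clopenC X A setT).

Lemma compact_bigcup_clopen (X : ptopologicalType) (F : nat -> set X) :
  compact [set: X] -> (forall n, clopen (F n)) -> clopen (\bigcup_n F n) ->
  exists N, \bigcup_n F n `<=` \bigcup_(n < N) F n.
Proof.
move=> cX cF [_ cU].
have : compact (\bigcup_n F n) by exact: subclosed_compact cU cX _.
rewrite compact_cover => /(_ nat setT F)[|//|D _ DU].
  by move=> i _; case: (cF i).
exists (\max_(i <- finmap.enum_fset D) i).+1 => x /DU[i /= iD Fi]; exists i => //=.
by rewrite ltnS; apply: leq_bigmax_seq.
Qed.

(** * Borel measures from additive set functions on clopen sets *)

Section Extension.
Context {R : realType} {X : ptopologicalType}.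
Hypothesis cX : compact [set: X].
Hypothesis base : forall U : set X, open U ->
  exists F : nat -> set X, (forall n, clopen (F n)) /\ U = \bigcup_n F n.

Lemma sigma_clopen : <<s @open X >> = <<s @clopen X >>.
Proof.
apply/seteqP; split; apply: smallest_sub.
- exact: smallest_sigma_algebra.
- move=> U /base[F [cF ->]]; apply: sigma_algebra_bigcup => n.
  exact: sub_sigma_algebra.
- exact: smallest_sigma_algebra.
- by move=> U [oU _]; exact: sub_sigma_algebra.
Qed.

Local Notation borel_probability := (probability (g_sigma_algebraType (@open X)) R).

Lemma clopen_measure_unique (m1 m2 : {measure set (g_sigma_algebraType (@open X)) -> \bar R}) :
  (forall A, clopen A -> m1 A = m2 A) -> (m1 setT < +oo)%E ->
  forall A, (@open X).-sigma.-measurable A -> m1 A = m2 A.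
Proof.
move=> e fin A mA.
apply: (@measure_unique _ R (g_sigma_algebraType (@open X)) (@clopen X) (fun=> setT)) => //.
- by rewrite -sigma_clopen.
- by move=> B C; exact: clopenI.
- by move=> _; exact: clopenT.
- by apply/seteqP; split => // x _; exists 0%N.
Qed.

(** By compactness a clopen countable union of clopen sets is a finite one, so finite additivity is
    already countable additivity on clopen sets. On other sets [mu] and [rho] may differ. *)
Lemma clopen_extension (rho : set X -> R) :
  (forall A, 0 <= rho A) -> rho setT = 1 ->
  (forall A B, A `&` B = set0 -> rho (A `|` B) = rho A + rho B) ->
  exists mu : borel_probability, forall A, clopen A -> mu A = (rho A)%:E.
Proof.
move=> rho_ge0 rhoT rhoU.
have rho0 : rho set0 = 0.
  by apply: (@addrI _ (rho set0)); rewrite -rhoU ?setU0 ?addr0// setI0.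
pose m0 (A : set (clopen_algebra X)) : \bar R := (rho A)%:E.
have m00 : m0 set0 = 0%E by rewrite /m0 rho0.
have m0_ge0 A : (0 <= m0 A)%E by rewrite lee_fin.
have m0_sum (F : nat -> set X) n : trivIset setT F ->
    rho (\bigcup_(i < n) F i) = \sum_(0 <= i < n) rho (F i).
  move=> tF; elim: n => [|n IH]; first by rewrite big_geq// II0 bigcup_set0.
  rewrite big_nat_recr//= -IH -rhoU ?bigcup_mkord ?big_ord_recr//= -?bigcup_mkord//.
  apply/seteqP; split => // x [[i /= ni Fi] Fn].
  by have := tF i n I I (ex_intro _ x (conj Fi Fn)) => e; rewrite e ltnn in ni.
have m0_sigma : semi_sigma_additive m0.
  move=> F mF tF mU; have [N NU] := compact_bigcup_clopen cX mF mU.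
  apply: cvg_near_cst; exists N => // n /= Nn.
  rewrite sumEFin -m0_sum//; congr (rho _)%:E; apply/seteqP; split.
    by move=> x [i _ Fi]; exists i.
  by move=> x /NU[i /= iN Fi]; exists i => //=; exact: leq_trans Nn.
pose m : {measure set (clopen_algebra X) -> \bar R} :=
  HB.pack m0 (isMeasure.Build _ _ _ m0 m00 m0_ge0 m0_sigma).
have extE A : clopen A -> measure_extension m A = (rho A)%:E.
  by move=> cA; rewrite /measure_extension measurable_mu_extE.
pose mu0 (A : set (g_sigma_algebraType (@open X))) : \bar R := measure_extension m A.
have mu00 : mu0 set0 = 0%E by rewrite /mu0 extE ?rho0//; exact: clopen0.
have mu0_ge0 A : (0 <= mu0 A)%E by exact: measure_ge0.
have mu0_sigma : semi_sigma_additive mu0.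
  have cl A : (@open X).-sigma.-measurable A -> (@clopen X).-sigma.-measurable A.
    by rewrite /measurable /= sigma_clopen.
  move=> F mF tF mU.
  exact: (@measure_semi_sigma_additive _ _ _ (measure_extension m) F
    (fun n => cl _ (mF n)) tF (cl _ mU)).
have mu0T : mu0 setT = 1%E by rewrite /mu0 extE ?rhoT//; exact: clopenT.
pose mu1 : {measure set _ -> \bar R} := HB.pack mu0 (isMeasure.Build _ _ _ mu0 mu00 mu0_ge0 mu0_sigma).
pose mu : borel_probability := HB.pack mu0 (isMeasure.Build _ _ _ mu0 mu00 mu0_ge0 mu0_sigma)
  (Measure_isProbability.Build _ _ _ mu1 mu0T).
by exists mu => A cA; exact: extE.
Qed.
End Extension.

Section ThinSmall.
Context {R : realType} {X : ptopologicalType} {c : nat -> X -> nat} {E : nat -> X -> X -> Prop}.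
Hypotheses (cX : compact [set: X]) (lc : forall n (x : X), \forall y \near x, c n y = c n x).
Hypotheses (cE : chain c E) (cs : separated c).
Hypothesis minimal : forall n, exists m, forall x z, exists2 y, E m x y & c n y = c n z.
Variable G : set (X -> X).
Hypothesis GE : forall g, G g -> continuous g /\ injective g /\
  exists N, forall n x, (N <= n)%N -> E n x (g x).

Lemma label_clopen n (Q : nat -> Prop) : clopen [set x : X | Q (c n x)].
Proof.
apply: locally_constant_clopen => x; have := lc n x.
by apply: filterS => y /= ->.
Qed.

Lemma open_bigcup_clopen (U : set X) : open U ->
  exists F : nat -> set X, (forall n, clopen (F n)) /\ U = \bigcup_n F n.
Proof.
move=> oU; exists (fun n => [set x | forall y, c n y = c n x -> U y]); split.
  by move=> n; exact: (label_clopen n (fun v => forall y, c n y = v -> U y)).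
apply/seteqP; split => [x Ux|x [n _ h]]; last exact: h.
have [n hn] := labelled_base cX lc (fun n m x y => @ch_refine _ _ _ cE n m x y) (sp_sep cs) oU Ux.
by exists n.
Qed.

Let class n x := sval (cid2 (class_seq cE cs n x)).

Let class_uniq n x : uniq (class n x).
Proof. by rewrite /class; case: cid2. Qed.

Let classP n x y : y \in class n x <-> E n x y.
Proof. by rewrite /class; case: cid2 => s /= _; apply. Qed.

(** Minimality moves every point of a class into the atom of [b] within its own [E m]-class. As
    [c m] is injective on such a class, it has at most [H] points, so the map is at most [H] to
    one. *)
Lemma class_atom_bound j : exists H m, (0 < H)%N /\ forall n x b, (m <= n)%N ->
  (size (class n x) <= H * count (fun y => c j y == c j b) (class n x))%N.
Proof.
have [m Hm] := minimal j.
have [H HH] := sp_fin cs m.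
exists H, m; split => [|n x b mn]; first exact: leq_ltn_trans (leq0n _) (HH point).
have [f fP] := choice (fun y => let: ex_intro2 z e h := Hm y b in
  ex_intro (fun z => E m y z /\ c j z = c j b) z (conj e h)).
pose B := [seq y <- class n x | c j y == c j b].
have : (size [seq (f y, c m y) | y <- class n x] <= size [seq (y, i) | y <- B, i <- iota 0 H])%N.
  apply: uniq_leq_size.
    rewrite map_inj_in_uniq// => y z hy hz [e1 e2].
    apply: (ch_inj cE (n := m)) => //.
    by apply: (ch_trans cE (proj1 (fP y))); rewrite e1; exact: (ch_sym cE (proj1 (fP z))).
  move=> _ /mapP[y /classP hy ->]; apply/allpairsP; exists (f y, c m y) => /=; split => //.
    rewrite mem_filter (proj2 (fP y)) eqxx /=; apply/classP.
    exact: (ch_trans cE) hy (ch_mono cE mn (proj1 (fP y))).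
  by rewrite mem_iota /= HH.
by rewrite size_map size_allpairs size_iota size_filter mulnC.
Qed.

Lemma invariant_count g n x (A : set X) : injective g -> (forall y, E n y (g y)) ->
  count (fun y => `[< A (g y) >]) (class n x) = count (fun y => `[< A y >]) (class n x).
Proof.
move=> ig gE; rewrite -(count_map g (fun y => `[< A y >])).
have sub : {subset [seq g y | y <- class n x] <= class n x}.
  move=> _ /mapP[y /classP hy ->]; apply/classP; exact: (ch_trans cE) hy (gE y).
have us : uniq [seq g y | y <- class n x] by rewrite map_inj_uniq.
have [_ e] := uniq_min_size us sub (eq_leq (esym (size_map _ _))).
by have /permP := uniq_perm us (class_uniq n x) e; apply.
Qed.

(** Otherwise there are arbitrarily late classes in which [K] has at least as many points as some
    [j]-atom, hence frequency at least [1/H]. The limit measure of these classes is invariant, since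
    each element of [G] eventually permutes every class, and it charges [K]. *)
Theorem thin_small (K : set X) : closed K -> thin R G K -> small c E (@set_val X K).
Proof.
move=> clK thK j; apply: contrapT => nsm.
have bad n : exists t : nat * X * X * seq X, [/\ (n <= t.1.1.1)%N, uniq t.2,
    forall y, y \in t.2 -> E t.1.1.1 t.1.1.2 y /\ K y &
    (count (fun y => c j y == c j t.1.2) (class t.1.1.1 t.1.1.2) <= size t.2)%N].
  apply: contrapT => h; apply: nsm; exists n => q nq b x s us sP.
  apply: contrapT => ns; apply: h; exists (q, x, b, s) => /=; split => //.
    by move=> y /sP[e [u yu]]; split => //; rewrite yu; exact: set_val_in.
  rewrite leqNgt; apply/negP => lt; apply: ns.
  exists [seq y <- class q x | c j y == c j b]; split.
  - by rewrite filter_uniq.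
  - by rewrite size_filter ltnW.
  - by move=> y; rewrite mem_filter => /andP[/eqP e /classP h].
have [t tP] := choice bad.
pose cl n := class (t n).1.1.1 (t n).1.1.2.
have cl0 n : (0 < size (cl n))%N.
  have : (t n).1.1.2 \in cl n by apply/classP; exact: (ch_refl cE).
  by case: (cl n).
have [H [m [H0 Hm]]] := class_atom_bound j.
have [rho [rho0 rhoT rhoU rho_le rho_ge]] := @limit_frequency R X cl cl0.
have [mu muE] := clopen_extension cX open_bigcup_clopen rho0 rhoT rhoU.
have freqK n : (m <= n)%N -> (H%:R^-1 : R) <= frequency cl n K.
  move=> mn; have [nt us sK cnt] := tP n.
  have h1 := Hm _ (t n).1.1.2 (t n).1.2 (leq_trans mn nt).
  rewrite /frequency ler_pdivlMr ?ltr0n// ler_pdivrMl ?ltr0n// -natrM ler_nat.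
  apply: leq_trans h1 _; rewrite leq_mul2l; apply/orP; right; apply: leq_trans cnt _.
  rewrite -size_filter; apply: uniq_leq_size => // y /sK[e Ky].
  by rewrite mem_filter; apply/andP; split; [exact/asboolP|exact/classP].
have inv : invariant_probabilities G mu.
  move=> g Gg; have [cg [ig [N gE]]] := GE Gg.
  have mg : measurable_fun [set: g_sigma_algebraType (@open X)]
      (g : g_sigma_algebraType (@open X) -> g_sigma_algebraType (@open X)).
    apply: (@measurability _ _ (g_sigma_algebraType (@open X))
      (g_sigma_algebraType (@open X)) setT g (@open X) erefl).
    move=> _ [U oU <-]; rewrite setTI; apply: sub_sigma_algebra.
    by apply: open_comp oU => x _; exact: cg.
  have mpre A : (@open X).-sigma.-measurable A -> (@open X).-sigma.-measurable (g @^-1` A).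
    by move=> mA; rewrite -[X in _ X]setTI; exact: mg.
  pose nu (A : set (g_sigma_algebraType (@open X))) : \bar R := mu (g @^-1` A).
  have nu0 : nu set0 = 0%E by rewrite /nu preimage_set0 measure0.
  have nu_ge0 A : (0 <= nu A)%E by exact: measure_ge0.
  have nu_sigma : semi_sigma_additive nu.
    move=> F mF tF mU; rewrite /nu preimage_bigcup.
    apply: measure_semi_sigma_additive.
    - by move=> n; exact: mpre.
    - apply/trivIsetP => /= i k _ _ ik; rewrite -preimage_setI.
      by move/trivIsetP : tF => /(_ _ _ _ _ ik) ->//; rewrite preimage_set0.
    - by rewrite -preimage_bigcup; exact: mpre.
  pose nu' : {measure set _ -> \bar R} := HB.pack nu (isMeasure.Build _ _ _ nu nu0 nu_ge0 nu_sigma).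
  apply: (@clopen_measure_unique R X open_bigcup_clopen nu' mu).
    move=> A cA; rewrite /= /nu !muE//; last first.
      by case: cA => oA cA; split; [apply: open_comp oA => x _|apply: closed_comp cA => x _]; exact: cg.
    have eq n : (N <= n)%N -> frequency cl n (g @^-1` A) = frequency cl n A :> R.
      move=> Nn; have [nt _ _ _] := tP n; rewrite /frequency; congr (_%:R / _).
      exact: (@invariant_count g _ _ A ig (fun y => gE _ y (leq_trans Nn nt))).
    congr (_%:E); apply/eqP; rewrite eq_le; apply/andP; split; apply: rho_le;
      by exists N => n Nn; rewrite eq.
  by rewrite /= /nu preimage_setT probability_setT ltry.
(* [K] need not be clopen, so the mean [rho] does not give [mu K] directly; the bound passes to the
   clopen neighbourhoods [F n] and then, by continuity from above, to their intersection. *)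
pose F n := [set y : X | exists u, K u /\ c n u = c n y].
have cF n : clopen (F n) by exact: (label_clopen n (fun v => exists u, K u /\ c n u = v)).
have FK n : K `<=` F n by move=> y Ky; exists y.
have muF n : (H%:R^-1%:E <= mu (F n))%E.
  rewrite muE// lee_fin; apply: rho_ge; exists m => k mk.
  apply: (le_trans (freqK k mk)); rewrite /frequency ler_pM2r ?invr_gt0 ?ltr0n// ler_nat.
  by apply: sub_count => y /= /asboolP Ky; apply/asboolP; exact: FK.
have capF : \bigcap_n F n = K.
  apply/seteqP; split => [y hy|y Ky n _]; last exact: FK.
  apply: contrapT => nKy.
  have oK : open (~` K) by rewrite openC.
  have [n hn] := labelled_base cX lc (fun n m x y => @ch_refine _ _ _ cE n m x y) (sp_sep cs) oK nKy.
  by have [u [Ku cu]] := hy n I; exact: hn cu Ku.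
have mF n : (@open X).-sigma.-measurable (F n) by apply: sub_sigma_algebra; case: (cF n).
have F0 : (mu (F 0%N) < +oo)%E by rewrite muE ?ltry.
have cvgF : (mu \o F : nat -> \bar R) @ \oo --> mu (\bigcap_n F n).
  apply: (@nonincreasing_cvg_mu _ (g_sigma_algebraType (@open X)) R mu F F0 mF).
  - by apply: bigcap_measurable => // n _; exact: mF.
  - move=> n k nk; apply/subsetPset => y [u [Ku cu]]; exists u; split => //.
    exact: (ch_refine cE nk).
have : (H%:R^-1%:E <= mu (\bigcap_n F n))%E by apply: (cvge_to_ge cvgF); exact: nearW.
by rewrite capF thK// lee_fin leNgt invr_gt0 ltr0n H0.
Qed.

End ThinSmall.

Local Close Scope ring_scope.

(** * From chains back to orbit relations on the Cantor space *)

Theorem theorem6p3 (R : realType) (Gamma : set (cantor_space -> cantor_space))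
    (K : set cantor_space) (Sigma : set (K -> K)) :
  ample_group Gamma ->
  minimal_group Gamma ->
  malleable R Gamma K ->
  ample_group Sigma ->
  induced_group Gamma (K := K) `<=` Sigma ->
  orbit_equivalent (extended_relation Gamma Sigma) (orbit_relation Gamma).
Proof.
move=> [fullG cG lfG fixG] minG [clK thK etK] [fullS cS lfS fixS] indS.
have [sG _] := fullG; have [sS _] := fullS.
(* An empty [K] adds no links; otherwise a point of [K] serves to start the stages. *)
have [K0|nK] := pselect (exists x, K x); last first.
  exists id; first by case: (@homeo_homeo_subgroup cantor_space).
  rewrite extended_relation_set0//; apply/seteqP; split => [[x y] [[u v] h [<- <-]]//|[x y] h].
  by exists (x, y).
have cX := cantor_space_compact.
have [g [gG gsurj]] := countable_enum cG (ex_intro _ id (let: And4 _ h _ _ := sG in h)).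
pose F n := g @` `I_n.
have FG n : F n `<=` Gamma by move=> _ [i _ <-].
have fF n : finite_set (F n) by apply: finite_image; exact: finite_II.
have FF n : F n `<=` F n.+1 by move=> _ [i /= ni <-]; exists i => //=; exact: leqW.
have F0 : F 0%N = set0 by rewrite /F II0 image_set0.
have [c [lc cs _ cch]] := generated_chain (e := fun (x : cantor_space) k => x k) cX (fun k x => cantor_near_bit k x)
  (fun x y e => e) sG lfG fixG FG fF FF F0.
have cE := cch F (fun n => @subset_refl _ _) FF.
set E := orbit_step _ in cE.
have orbE x y : orbit_relation Gamma (x, y) <-> exists n, E n x y.
  split.
    move=> [h /gsurj[i <-] /= <-]; exists i.+1, (g i) => //.
    by apply: generated_gen; exists i => /=.
  by move=> [n [h Sh <-]]; exists h => //; exact: generated_sub (FG n) sG _ Sh.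
have cle n m x y : (n <= m)%N -> c m x = c m y -> c n x = c n y by exact: (ch_refine cE).
have GE h : Gamma h -> continuous h /\ injective h /\
    exists N, forall n x, (N <= n)%N -> E n x (h x).
  move=> Gh; have [[hc _] [h' [_ hh' _]]] := (let: And4 h0 _ _ _ := sG in h0 _ Gh, subgroup_inv sG Gh).
  split => //; split; first exact: can_inj hh'.
  have [i ei] := gsurj _ Gh; exists i.+1 => n x ni; apply: (ch_mono cE ni).
  by exists (g i); [apply: generated_gen; exists i => /=|rewrite ei].
(* Dense orbits give a level for each point, and compactness a uniform one. *)
have minimal n : exists m, forall x z, exists2 y, E m x y & c n y = c n z.
  have [N HN] := sp_fin cs n.
  suff [m Hm] : ev (fun m => forall v, (v < N)%N -> forall x, (exists z, c n z = v) ->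
      exists2 y, E m x y & c n y = v).
    exists m => x z; apply: (Hm m (leqnn _) _ (HN z)); by exists z.
  apply: ev_bounded => v _.
  have [[z cz]|nz] := pselect (exists z, c n z = v); last by exists 0%N.
  suff [m Hm] : exists m, forall x, exists2 y, E m x y & c n y = v.
    exists m => k mk x _; have [y e cy] := Hm x; exists y => //; exact: (ch_mono cE mk).
  apply: (compact_eventually cX).
    by move=> k m x km [y e cy]; exists y => //; exact: (ch_mono cE km).
  move=> x.
  have oA : open [set y | c n y = v].
    rewrite openE => y /= cy; have := lc n y; apply: filterS => w /= ->//.
  have [y [/= cy [h Gh ehy]]] := minG x _ (ex_intro _ z cz) oA.
  have [ch [_ [N' HN']]] := GE _ Gh.
  exists N'; have nb : nbhs (h x) [set y | c n y = v] by apply: open_nbhs_nbhs; split => //; rewrite /= ehy.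
  have nb' : \forall w \near x, c n (h w) = v by exact: ch nb.
  by apply: filterS nb' => w cw; exists (h w) => //; exact: HN'.
have perfect n x : exists2 y, y <> x & c n y = c n x.
  have [_ lp] := cantor_perfect.
  have : limit_point [set: cantor_space] x by rewrite lp.
  move=> /(_ [set y | c n y = c n x] (lc n x))[y [/eqP yx _ cy]]; by exists y.
have smK : small c E (@set_val _ K).
  exact: (thin_small cX lc cE cs minimal GE clK thK).
pose p i := if pselect (g i \o g i = id) then induced_map (K := K) (g i) else id.
have Sp i : Sigma (p i).
  have [_ S1 _ _] := sS; rewrite /p; case: pselect => //= gi.
  by apply: indS => S [_ genS]; apply: (genS); exists (g i).
have cK : compact [set: K] := set_type_compact (subclosed_compact clK cX (@subsetT _ K)).
have [sig [Ssig sigsurj]] := countable_enum cS (ex_intro _ id (let: And4 _ h _ _ := sS in h)).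
(* The generators of [P1] include those of [P0], which lie in [Sigma] by [indS]; hence [P0]-links
   are [P1]-links of the same level. *)
pose FP n := p @` `I_n; pose FK n := FP n `|` sig @` `I_n.
have II m : (fun i => (i < m)%N) `<=` (fun i => (i < m.+1)%N) by move=> i /leqW.
have FPS n : FP n `<=` FP n.+1 by apply: image_subset; exact: II.
have FKS n : FK n `<=` FK n.+1 by apply: setUSS => //; apply: image_subset; exact: II.
have FKG n : FK n `<=` Sigma by move=> _ [[i _ <-]|[i _ <-]].
have fFK n : finite_set (FK n) by rewrite finite_setU; split; apply: finite_image; exact: finite_II.
have FK0 : FK 0%N = set0 by rewrite /FK /FP II0 !image_set0 setU0.
have lval (n : nat) (x : K) : \forall y \near x, set_val y n = set_val x n.
  exact: set_type_nbhs (cantor_near_bit n (set_val x)).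
have ival : injective (fun (x : K) (n : nat) => set_val x n).
  by move=> x y e; apply: val_inj; rewrite -!set_valE.
have [k [lk ks k0 kch]] := generated_chain cK lval ival sS lfS fixS FKG fFK FKS FK0.
have kP0 := kch FP (fun n => @subsetUl _ _ _) FPS.
have kP1 := kch FK (fun n => @subset_refl _ _) FKS.
set P0 := orbit_step _ in kP0; set P1 := orbit_step _ in kP1.
have P01 n u v : P0 n u v -> P1 n u v.
  by move=> [s Ps e]; exists s => //; apply: generated_mono Ps; exact: subsetUl.
have emb : embedding k P0 c E (@set_val _ K).
  have [Sh _ _ _] := sS; have [fS0 _ _ _ _] := generated_tower sG lfG FG fF FF F0.
  by apply: (induced_embedding cX clK etK fullG gG gsurj) => // i; exact: Sh (Sp i).
have closed_K x : (forall n, exists y : K, c n (set_val y) = c n x) -> exists y : K, x = set_val y.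
  move=> h; have [Kx|nKx] := pselect (K x); first by have [z ez] := set_val_onto Kx; exists z.
  have oK : open (~` K) by rewrite openC.
  have [n hn] := labelled_base cX lc cle (sp_sep cs) oK nKx.
  by have [y /hn] := h n; case; exact: set_val_in.
have [w Kw] := K0; have [x0 _] := set_val_onto Kw.
have [h [h' [hh' h'h [hc h'c] [hE hP] hS]]] := chain_absorption x0
  cE cs minimal perfect kP0 kP1 ks P01 k0 emb smK closed_K.
have cont f : (forall n, exists m, forall x y, c m x = c m y -> c n (f x) = c n (f y)) -> continuous f.
  move=> fc x U; rewrite nbhsE => -[V [oV Vx] VU].
  have [n hn] := labelled_base cX lc cle (sp_sep cs) oV Vx.
  have [m hm] := fc n; have := lc m x; apply: filterS => y cy.
  by apply/VU/hn/hm.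
exists h; first by split; [exact: cont|exists h'; split => //; exact: cont].
have [eR eS eT] := orbit_equivalence sG.
have [xR xS xT] := extended_equivalence Gamma Sigma.
(* Minimality of [extended_relation] is tested against the orbit relation pulled back along [h];
   conversely the last clause of [chain_absorption] is applied to [extended_relation] itself. *)
apply/seteqP; split => [_ [[x y] Rxy <-]|[x y] /orbE[n exy]] /=.
  suff : extended_relation Gamma Sigma `<=` [set q | orbit_relation Gamma (h q.1, h q.2)].
    by move=> H; exact: (H _ Rxy).
  move=> q; apply; split.
    split; [by move=> ?; exact: eR|by move=> ? ?; exact: eS|by move=> ? ? ?; exact: eT].
  move=> [u v] [/orbE[n /hE/orbE //]|[a _ [s Ss [<- <-]]]] /=.
  have [i ei] := sigsurj _ Ss; apply/orbE; apply: (hP i.+1); exists s => //.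
  by apply: generated_gen; right; exists i => /=.
exists (h' x, h' y) => /=; last by rewrite !h'h.
apply: (hS (fun x y => extended_relation Gamma Sigma (x, y)) xS xT _ _ n).
- by move=> m u v e S [_ GS]; apply: GS; left; apply/orbE; exists m.
- move=> m u v [s Ps <-] S [_ GS]; apply: GS; right; exists u => //; exists s => //.
  exact: generated_sub (FKG m) sS _ Ps.
- by rewrite !h'h.
Qed.
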